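(* Assume that $(\Gamma,\check g)$ and $(\check\Gamma,g)$ are facewise regular. There are noncanonical decompositions $$\mathcal B_\Phi^{\Gamma,\check\Gamma}(\check g,g)\simeq\bigoplus_{\vartheta\in\Phi}V_\vartheta^{\Gamma,\check\Gamma}\otimes_{\mathbb C}\mathcal L_\Phi^\vartheta,\qquad \mathscr C_\Phi^{\Gamma,\check\Gamma}(\check g,g)\simeq\bigoplus_{\vartheta\in\Phi}V_\vartheta^{\Gamma,\check\Gamma}\otimes_{\mathbb C}\mathcal K_{\Phi,\vartheta}.$$ Consequently, $$R\Gamma\bigl(\Phi,\mathscr C_\Phi^{\Gamma,\check\Gamma}(\check g,g)\bigr)\simeq\bigoplus_{\vartheta\in\Phi}V_\vartheta^{\Gamma,\check\Gamma}\otimes_{\mathbb C}R\Gamma\bigl(\Phi,\mathcal K_{\Phi,\vartheta}\bigr).$$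
   Context: **Stacky fans.** $M$, $N=M^\vee$ are dual lattices of finite rank. A stacky fan $\boldsymbol\Sigma=(\Sigma,\{b_\rho\})$ in $M$ is a finite rational fan of strongly convex cones with a nonzero lattice vector $b_\rho\in\rho\cap M$ on each ray. $P_{\boldsymbol\Sigma}=\bigcup_{c\in\Sigma}\operatorname{Conv}(\{0\}\cup\{b_\rho:\rho\preceq c\})$. It is stacky log-$\mathbb Q$-Gorenstein if there is a function $\psi:|\Sigma|\to\mathbb R$, rationally linear on each cone, with $\psi(b_\rho)=1$ for all $\rho$ (the height). A toric Landau--Ginzburg datum $(\boldsymbol\Sigma,f)$: $\Sigma$ quasi-projective, $\boldsymbol\Sigma$ stacky log-$\mathbb Q$-Gorenstein, $P_{\boldsymbol\Sigma}$ convex, $f\in\mathbb C[N]$ regular on $X_\Sigma$. $P_{f,\infty}=\operatorname{Conv}(\{0\}\cup\operatorname{Supp}f)$. A subdivision of data $(\boldsymbol\Gamma,\widehat f)\to(\boldsymbol\Sigma,f)$ is a subdivision of fans retaining original stacky vectors, with nonzero lattice vectors on new rays, both sides being data and $\widehat f=f$; crepant if new stacky vectors have $\psi_{\boldsymbol\Sigma}=1$. **Setting.** $\boldsymbol\Sigma$ (in $M$, height $\psi$) and $\check{\boldsymbol\Sigma}$ (in $N$, height $\check\psi$) come from a mirror pair of data $(\boldsymbol\Sigma,f),(\check{\boldsymbol\Sigma},\check f)$ with $P:=P_{\boldsymbol\Sigma}=P_{\check f,\infty}$, $Q:=P_{\check{\boldsymbol\Sigma}}=P_{f,\infty}$ (so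 $\langle P,Q\rangle\ge0$). $g=\sum\xi_vy^v\in\mathbb C[N]$ and $\check g=\sum\check\xi_ux^u\in\mathbb C[M]$ are height-one representatives of $Q$ and $P$ (supports on faces not containing $0$; $P_{g,\infty}=Q$, $P_{\check g,\infty}=P$). $(\boldsymbol\Gamma,\widehat g)\to(\boldsymbol\Sigma,g)$, $(\check{\boldsymbol\Gamma},\widehat{\check g})\to(\check{\boldsymbol\Sigma},\check g)$ are crepant subdivisions of data. $\Phi=\{\eta=(c,\check c)\in\Sigma\times\check\Sigma:\langle c,\check c\rangle=0\}$, a fan of cones $c\oplus\check c$. **Sheaves on fans.** A finite fan $\Psi$ is a topological space with open sets the subfans; sheaves are collections of stalks $\mathcal F_\eta=\Gamma(\{\gamma\preceq\eta\},\mathcal F)$ with face restrictions. $\partial\eta=\{\gamma\prec\eta\}$, $\operatorname{Star}(\eta)=\{\gamma\succeq\eta\}$. $\mathcal A_{\Psi,\eta}=\operatorname{Sym}(\eta_{\mathbb C}^* )$; on $\Phi$ bigraded with $\deg c_{\mathbb C}^*=(1,0)$, $\deg\check c_{\mathbb C}^*=(0,1)$. A graded $\mathcal A_\Psi$-module sheaf is pure if stalks are finitely generated free and $\mathcal F_\eta\to\Gamma(\partial\eta,\mathcal F)$ is surjective for all $\eta$. $\mathcal L_\Psi^\vartheta$ is the unique pure sheaf supported on $\operatorname{Star}(\vartheta)$ with stalk $\mathcal A_{\Psi,\vartheta}$ at $\vartheta$ and such that for $\eta\succ\vartheta$ the boundary map $(\mathcal L_\Psi^\vartheta)_\eta\to\Gamma(\partial\eta,\mathcal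 L_\Psi^\vartheta)$ is a minimal free cover over $\mathcal A_{\Psi,\eta}$. **Toric face algebras and coefficient sheaf.** $\mathbb C[c]^\Gamma=\bigoplus_{m\in c\cap M}\mathbb Cx^m$ with $x^m\star_\Gamma x^{m'}=x^{m+m'}$ if $m,m'$ lie in a common cone of $\Gamma|_c$ and $0$ otherwise, graded by $\psi(m)$; face restriction fixes monomials in the face and kills the others. Likewise $\mathbb C[\check c]^{\check\Gamma}$, graded by $\check\psi$. Put $\partial_\ell^\Gamma\check g_c=\sum_{u\in c\cap M}\check\xi_u\ell(u)x^u$ for $\ell\in c_{\mathbb C}^*$, and make $\mathbb C[c]^\Gamma$ an $\mathcal A_{\Sigma,c}$-algebra via $\ell\mapsto\partial_\ell^\Gamma\check g_c$; this gives $\mathcal B_{\Sigma,\check g}^\Gamma$ on $\Sigma$, and analogously $\mathcal B_{\check\Sigma,g}^{\check\Gamma}$ on $\check\Sigma$. $\mathcal B_\Phi^{\Gamma,\check\Gamma}(\check g,g)=(\mathcal B_{\Sigma,\check g}^\Gamma\boxtimes\mathcal B_{\check\Sigma,g}^{\check\Gamma})|_\Phi$, with stalk $\mathbb C[c]^\Gamma\otimes\mathbb C[\check c]^{\check\Gamma}$. **Facewise regularity.** $(\Gamma,\check g)$ is facewise regular if for every $c\in\Sigma$ and a basis $\ell_1,\dots,\ell_{\dim c}$ of $c_{\mathbb C}^*$, $\partial^\Gamma_{\ell_1}\check g_c,\dots,\partial^\Gamma_{\ell_{\dim c}}\check g_c$ is a regular sequence in $\mathbb C[c]^\Gamma$;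 analogously for $(\check\Gamma,g)$. **The complex.** $\mathscr C_\Phi^{\Gamma,\check\Gamma}(\check g,g)=\operatorname{Gr}_F\widehat{\mathscr C}$, where $\widehat{\mathscr C}$ has stalks $\mathbb C[c]^\Gamma\otimes\mathbb C[\check c]^{\check\Gamma}\otimes\bigwedge^\bullet N_{\mathbb C}$ and differential sending $x^my^n\otimes\omega$ to $\sum_{u\in c\cap M}\check\xi_u(x^u\star_\Gamma x^m)y^n\otimes\iota_u\omega+\sum_{v\in\check c\cap N}\xi_vx^m(y^v\star_{\check\Gamma}y^n)\otimes(v\wedge\omega)+x^my^n\otimes(n\wedge\omega)$. For $\omega\in\bigwedge^k$: $a=k+\psi(m)-\check\psi(n)$, $r=\psi(m)+\check\psi(n)$, cohomological degree $a+r$; $F^\lambda$ is spanned by elements with $a\ge\lambda$. **Primitive and support parts.** For $\sigma\in\Sigma$, $R_0^\Gamma(\check g_\sigma,\sigma)=\mathbb C[\sigma]^\Gamma/(\partial_\ell^\Gamma\check g_\sigma:\ell\in\sigma_{\mathbb C}^* )$, and $R_1^\Gamma(\check g_\sigma,\sigma)$ is the image in it of the span of monomials $x^m$, $m\in\operatorname{relint}(\sigma)\cap M$; analogously $R_1^{\check\Gamma}(g_{\check\sigma},\check\sigma)$. For $\vartheta=(\sigma,\check\sigma)\in\Phi$: $V_\vartheta^{\Gamma,\check\Gamma}=R_1^\Gamma(\check g_\sigma,\sigma)\otimes_{\mathbb C}R_1^{\check\Gamma}(g_{\check\sigma},\check\sigma)$ (zero differential). $\operatorname{Cl}_\Phi$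 is the complex with stalks $\mathcal A_{\Phi,\eta}\otimes\bigwedge^\bullet N_{\mathbb C}$ and differential $\iota_{\mathbf m_c}+\mathbf n_{\check c}\wedge$, where $\mathbf m_c\in c_{\mathbb C}^*\otimes c_{\mathbb C}$ and $\mathbf n_{\check c}\in\check c_{\mathbb C}^*\otimes\check c_{\mathbb C}$ are the identity tensors. $\mathcal K_{\Phi,\vartheta}=\mathcal L_\Phi^\vartheta\otimes_{\mathcal A_\Phi}\operatorname{Cl}_\Phi$. *)

(* Defs.v *)
From HB Require Import structures.
From mathcomp Require Import all_boot all_order all_algebra.
From mathcomp Require Import generic_quotient ring_quotient.
From mathcomp Require Import boolp classical_sets reals complex.
From mathcomp Require Import finmap monalg mpoly.

Set Implicit Arguments.
Unset Strict Implicit.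
Unset Printing Implicit Defensive.

Import GRing.Theory Num.Theory.
Local Open Scope classical_set_scope.
Local Open Scope ring_scope.
Local Open Scope complex_scope.
Local Open Scope quotient_scope.

Definition lspan (K : fieldType) (E : lmodType K) (A : set E) : set E :=
  [set x | exists k (a : 'I_k -> K) (v : 'I_k -> E),
     (forall i, A (v i)) /\ x = \sum_(i < k) a i *: v i].

Section Quotients.
Variables (K : fieldType) (E : lmodType K).
Implicit Type A : set E.

Definition inspan A : {pred E} := fun x => `[< lspan A x >].

Lemma inspan_submod A : submod_closed (inspan A).
Proof.
split.
  by apply/asboolP; exists 0, (fun=> 0), (fun=> 0); split=> [[]|]; rewrite ?big_ord0.
move=> c _ _ /asboolP [k [a [v [Av ->]]]] /asboolP [l [b [w [Aw ->]]]].
apply/asboolP; exists (k + l)%N.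
exists (fun i => match split i with inl i => c * a i | inr j => b j end).
exists (fun i => match split i with inl i => v i | inr j => w j end).
split=> [i|]; first by case: (split i).
rewrite scaler_sumr big_split_ord /=; congr (_ + _); apply: eq_bigr => i _.
  by have /= -> := unsplitK (inl i : 'I_k + 'I_l); rewrite scalerA.
by have /= -> := unsplitK (inr i : 'I_k + 'I_l).
Qed.
HB.instance Definition _ A :=
  GRing.isSubmodClosed.Build K E (inspan A) (inspan_submod A).

Definition span_type A := {x : E | inspan A x}.
HB.instance Definition _ A := SubChoice.on (span_type A).
HB.instance Definition _ A :=
  [SubChoice_isSubLmodule of span_type A by <:].

Definition quo A := Quotient.quot (inspan A).
HB.instance Definition _ A := GRing.Zmodule.on (quo A).
Definition quo_pi A : E -> quo A := \pi_(quo A).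
Definition quo_repr A : quo A -> E := @repr E (quo A).

Definition quo_scale A (a : K) (x : quo A) : quo A := quo_pi A (a *: quo_repr x).

Lemma quo_piK A (x : quo A) : quo_pi A (quo_repr x) = x.
Proof. exact: reprK. Qed.

Lemma quo_eqP A (x y : E) : (quo_pi A x = quo_pi A y) <-> inspan A (x - y).
Proof.
have -> : inspan A (x - y) = (quo_pi A x == quo_pi A y).
  exact: (Quotient.idealrBE (inspan A) x y).
by split=> /eqP.
Qed.

Lemma quo_piZ A (a : K) (x : E) : quo_pi A (a *: x) = quo_scale a (quo_pi A x).
Proof.
apply/quo_eqP; rewrite -scalerBr; apply: rpredZ.
by apply/quo_eqP; rewrite quo_piK.
Qed.

Lemma quo_piD A (x y : E) : quo_pi A (x + y) = quo_pi A x + quo_pi A y.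
Proof. exact: raddfD. Qed.

Lemma quo_scaleA A (a b : K) (x : quo A) :
  quo_scale a (quo_scale b x) = quo_scale (a * b) x.
Proof. by rewrite -[x]quo_piK -!quo_piZ scalerA. Qed.
Lemma quo_scale1 A : left_id 1 (@quo_scale A).
Proof. by move=> x; rewrite -[x]quo_piK -quo_piZ scale1r. Qed.
Lemma quo_scaleDr A : right_distributive (@quo_scale A) +%R.
Proof.
move=> a x y; rewrite -[x]quo_piK -[y]quo_piK -quo_piD -!quo_piZ.
by rewrite scalerDr quo_piD.
Qed.
Lemma quo_scaleDl A (x : quo A) :
  {morph (@quo_scale A)^~ x : a b / a + b >-> a + b}.
Proof. by move=> a b; rewrite -[x]quo_piK -!quo_piZ scalerDl quo_piD. Qed.
HB.instance Definition _ A := GRing.Zmodule_isLmodule.Build K (quo A)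
  (@quo_scaleA A) (@quo_scale1 A) (@quo_scaleDr A) (@quo_scaleDl A).
End Quotients.

Section Products.
Variables (K : fieldType) (I : Type) (E : I -> lmodType K).

Definition dprod := forall i : I, E i.
HB.instance Definition _ := Choice.on dprod.
Implicit Types f g : dprod.

Lemma dprodA : associative (fun f g : dprod => (fun i => f i + g i) : dprod).
Proof. by move=> f g h; apply: functional_extensionality_dep => i; rewrite addrA. Qed.
Lemma dprodC : commutative (fun f g : dprod => (fun i => f i + g i) : dprod).
Proof. by move=> f g; apply: functional_extensionality_dep => i; rewrite addrC. Qed.
Lemma dprod0 : left_id ((fun=> 0) : dprod) (fun f g : dprod => fun i => f i + g i).
Proof. by move=> f; apply: functional_extensionality_dep => i; rewrite add0r. Qed.
Lemma dprodN : left_inverse ((fun=> 0) : dprod) (fun f i => - f i)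
  (fun f g : dprod => fun i => f i + g i).
Proof. by move=> f; apply: functional_extensionality_dep => i; rewrite addNr. Qed.
HB.instance Definition _ := GRing.isZmodule.Build dprod dprodA dprodC dprod0 dprodN.

Definition dprod_scale (a : K) (f : dprod) : dprod := fun i => a *: f i.
Lemma dprod_scaleA a b f : dprod_scale a (dprod_scale b f) = dprod_scale (a * b) f.
Proof. by apply: functional_extensionality_dep => i; rewrite /dprod_scale scalerA. Qed.
Lemma dprod_scale1 : left_id 1 dprod_scale.
Proof. by move=> f; apply: functional_extensionality_dep => i; rewrite /dprod_scale scale1r. Qed.
Lemma dprod_scaleDr : right_distributive dprod_scale +%R.
Proof. by move=> a f g; apply: functional_extensionality_dep => i; exact: scalerDr. Qed.
Lemma dprod_scaleDl f : {morph dprod_scale^~ f : a b / a + b >-> a + b}.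
Proof. by move=> a b; apply: functional_extensionality_dep => i; exact: scalerDl. Qed.
HB.instance Definition _ := GRing.Zmodule_isLmodule.Build K dprod
  dprod_scaleA dprod_scale1 dprod_scaleDr dprod_scaleDl.
End Products.

(* {malg K[X]} is used as the free K-module on X; mext extends h linearly. *)
Definition mext (K : fieldType) (X : choiceType) (E : lmodType K)
    (h : X -> E) (x : {malg K[X]}) : E :=
  \sum_(k <- monalg.msupp x) monalg.mcoeff k x *: h k.

Section Tensor.
Variables (K : fieldType) (V : lmodType K).

Definition tensor_rel (E : lmodType K) : set {malg K[(V * E)%type]} :=
  [set x | (exists v v' e, x = << (v + v', e) >> - << (v, e) >> - << (v', e) >>) \/
           (exists v e e', x = << (v, e + e') >> - << (v, e) >> - << (v, e') >>) \/
           (exists a v e, x = << (a *: v, e) >> - a *: << (v, e) >>) \/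
           (exists a v e, x = << (v, a *: e) >> - a *: << (v, e) >>)].
Definition tensor (E : lmodType K) := quo (@tensor_rel E).
HB.instance Definition _ (E : lmodType K) := GRing.Lmodule.on (tensor E).
Definition tpure (E : lmodType K) (v : V) (e : E) : tensor E :=
  quo_pi (@tensor_rel E) << (v, e) >>.
(* id (x) f, meaningful for linear f. *)
Definition tmap (E E' : lmodType K) (f : E -> E') (t : tensor E) : tensor E' :=
  mext (fun p => tpure p.1 (f p.2)) (quo_repr t).
End Tensor.

Definition dot (K : fieldType) d (x y : 'rV[K]_d) : K :=
  \sum_(i < d) x 0 i * y 0 i.

Section Geometry.
Variables (R : realType) (d : nat).
Local Notation V := 'rV[R]_d.
Local Notation lattice := 'rV[int]_d.
Implicit Type A sigma tau : set V.

Definition realpt (m : lattice) : V := map_mx intr m.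

Definition conic_hull A : set V :=
  [set x | exists k (a : 'I_k -> R) (p : 'I_k -> V),
     [/\ forall i, 0 <= a i, forall i, A (p i) & x = \sum_(i < k) a i *: p i]].

Definition conv_hull A : set V :=
  [set x | exists k (a : 'I_k -> R) (p : 'I_k -> V),
     [/\ forall i, 0 <= a i, \sum_(i < k) a i = 1,
         forall i, A (p i) & x = \sum_(i < k) a i *: p i]].

Definition is_convex A :=
  forall x y (t : R), A x -> A y -> 0 <= t <= 1 -> A (t *: x + (1 - t) *: y).

Definition rational_cone sigma :=
  exists s : seq lattice, sigma = conic_hull [set realpt m | m in [set` s]].

Definition strongly_convex sigma := forall x, sigma x -> sigma (- x) -> x = 0.

Definition is_face tau sigma :=
  exists y : V, (forall x, sigma x -> 0 <= dot y x) /\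
                tau = [set x | sigma x /\ dot y x = 0].

Definition is_ray sigma :=
  exists2 m : lattice, m != 0 & sigma = conic_hull [set realpt m].

Definition relint sigma : set V :=
  [set x | sigma x /\ exists2 e : R, 0 < e &
     forall y, lspan sigma y -> (forall i, `|y 0 i - x 0 i| < e) -> sigma y].

Definition face_off0 (P F : set V) :=
  exists (y : V) (t : R), [/\ forall x, P x -> dot y x <= t,
    F = [set x | P x /\ dot y x = t] & ~ F 0].

Definition cspan sigma : set 'rV[R[i]]_d :=
  lspan [set map_mx (real_complex R) x | x in sigma].

End Geometry.

Record cone_family (R : realType) (d : nat) := ConeFamily {
  cidx :> finType;
  cone : cidx -> set 'rV[R]_d }.

Section Fans.
Variables (R : realType) (d : nat).
Local Notation V := 'rV[R]_d.
Local Notation lattice := 'rV[int]_d.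
Implicit Types F : cone_family R d.

Definition face_le F (i j : F) := is_face (cone i) (cone j).
Definition face_lt F (i j : F) := face_le i j /\ i <> j.

Definition support F : set V := [set x | exists c : F, cone c x].

Definition is_fan F :=
  [/\ injective (@cone R d F),
      forall c : F, rational_cone (cone c) /\ strongly_convex (cone c),
      forall (c : F) tau, is_face tau (cone c) -> exists c' : F, cone c' = tau &
      forall c c' : F, is_face (cone c `&` cone c') (cone c) /\
                       is_face (cone c `&` cone c') (cone c')].

(* The toric variety of F is quasi-projective iff F carries a strictly convex
   piecewise linear function: for each cone c, a linear function agreeing with
   phi exactly on c and lying below it elsewhere on the support. *)
Definition quasi_projective F :=
  exists phi : V -> R, forall c : F, exists q : 'rV[rat]_d,
    (forall x, cone c x -> phi x = dot (map_mx ratr q) x) /\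
    (forall x, support F x -> ~ cone c x -> dot (map_mx ratr q) x < phi x).

(* svec is only meaningful on the indices of rays. *)
Record stacky_fan := StackyFan {
  sfan :> cone_family R d;
  svec : sfan -> lattice }.
Implicit Types S G : stacky_fan.

Definition is_stacky_fan S := is_fan S /\
  forall rho : S, is_ray (cone rho) -> svec rho != 0 /\ cone rho (realpt R (svec rho)).

Definition stacky_poly S : set V :=
  [set x | exists c : S, conv_hull ([set 0] `|`
     [set realpt R (svec rho) | rho in [set rho : S | is_ray (cone rho) /\ face_le rho c]]) x].

(* Only the restriction of psi to the support of S matters. *)
Definition is_height S (psi : V -> R) :=
  (forall c : S, exists q : 'rV[rat]_d,
     forall x, cone c x -> psi x = dot (map_mx ratr q) x) /\
  (forall rho : S, is_ray (cone rho) -> psi (realpt R (svec rho)) = 1).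

Definition newton_infty (f : {malg R[i][lattice]}) : set V :=
  conv_hull ([set 0] `|` [set realpt R v | v in [set v | v \in monalg.msupp f]]).

Definition regular_on S (f : {malg R[i][lattice]}) :=
  forall v, v \in monalg.msupp f -> forall x, support S x -> 0 <= dot (realpt R v) x.

Definition LG_datum S (f : {malg R[i][lattice]}) :=
  [/\ is_stacky_fan S, quasi_projective S, exists psi, is_height S psi,
      is_convex (stacky_poly S) & regular_on S f].

Definition height_one_rep (Q : set V) (g : {malg R[i][lattice]}) :=
  (forall v, v \in monalg.msupp g -> exists2 F, face_off0 Q F & F (realpt R v)) /\
  newton_infty g = Q.

Definition is_subdivision G S :=
  [/\ support G = support S,
      forall c' : G, exists c : S, cone c' `<=` cone c &
      forall (rho' : G) (rho : S), is_ray (cone rho) -> cone rho' = cone rho ->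
        svec rho' = svec rho].

Definition crepant_subdivision G S (psi : V -> R) (g : {malg R[i][lattice]}) :=
  [/\ LG_datum G g, LG_datum S g, is_subdivision G S &
      forall rho : G, is_ray (cone rho) -> psi (realpt R (svec rho)) = 1].

End Fans.

Section FaceAlgebra.
Variables (R : realType) (d : nat) (G : cone_family R d).
Local Notation lattice := 'rV[int]_d.
Implicit Type sigma : set 'rV[R]_d.

Definition latpt sigma := {m : lattice | `[< sigma (realpt R m) >]}.
HB.instance Definition _ sigma := Choice.on (latpt sigma).

Definition falg sigma := {malg R[i][latpt sigma]}.
HB.instance Definition _ sigma := GRing.Lmodule.on (falg sigma).

(* x^m, read as 0 when m lies outside sigma: restriction to a face tau is then
   x^m |-> mono tau m. *)
Definition mono sigma (m : lattice) : falg sigma :=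
  if (insub m : option (latpt sigma)) is Some k then << k >> else 0.

Definition share sigma (m m' : lattice) : bool :=
  `[< exists c : G, [/\ cone c `<=` sigma, cone c (realpt R m) & cone c (realpt R m')] >].

Definition star sigma (a b : falg sigma) : falg sigma :=
  mext (fun m => mext (fun m' =>
    if share sigma (val m) (val m') then mono sigma (val m + val m') else 0) b) a.

Definition clattice (u : lattice) : 'rV[R[i]]_d := map_mx intr u.

(* The logarithmic derivative of g along the linear form l; the form on the
   span of sigma is given by a form on the ambient space restricting to it. *)
Definition dlog (g : {malg R[i][lattice]}) sigma (l : 'rV[R[i]]_d) : falg sigma :=
  mext (fun u => dot l (clattice u) *: mono sigma u) g.

Definition form_basis sigma k (l : 'I_k -> 'rV[R[i]]_d) :=
  (forall a : 'I_k -> R[i],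
     (forall x, cspan sigma x -> \sum_(i < k) a i * dot (l i) x = 0) ->
     forall i, a i = 0) /\
  (forall l0 : 'rV[R[i]]_d, exists a : 'I_k -> R[i],
     forall x, cspan sigma x -> dot l0 x = \sum_(i < k) a i * dot (l i) x).

Definition fideal sigma k (P : pred 'I_k) (f : 'I_k -> falg sigma) : set (falg sigma) :=
  [set x | exists a : 'I_k -> falg sigma, x = \sum_(i < k | P i) star (a i) (f i)].

Definition regular_sequence sigma k (f : 'I_k -> falg sigma) :=
  (forall (i : 'I_k) (x : falg sigma),
     fideal (fun j : 'I_k => (j < i)%N) f (star (f i) x) ->
     fideal (fun j : 'I_k => (j < i)%N) f x) /\
  ~ fideal predT f (mono sigma 0).

Definition facewise_regular (S : cone_family R d) (g : {malg R[i][lattice]}) :=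
  forall c : S, exists k (l : 'I_k -> 'rV[R[i]]_d),
    form_basis (cone c) l /\
    regular_sequence (fun i => dlog g (cone c) (l i)).

Definition jac (g : {malg R[i][lattice]}) sigma : set (falg sigma) :=
  [set x | exists (l : 'rV[R[i]]_d) (a : falg sigma), x = star a (dlog g sigma l)].

Definition R0 g sigma := quo (@jac g sigma).
HB.instance Definition _ g sigma := GRing.Lmodule.on (R0 g sigma).

Definition R1 g sigma := span_type
  [set quo_pi (@jac g sigma) (mono sigma m) | m in [set m | relint sigma (realpt R m)]].
HB.instance Definition _ g sigma := GRing.Lmodule.on (R1 g sigma).

Definition R1_homog g sigma (psi : 'rV[R]_d -> R) (t : R) : set (R1 g sigma) :=
  [set x | lspan [set quo_pi (@jac g sigma) (mono sigma m) | m in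
     [set m | relint sigma (realpt R m) /\ psi (realpt R m) = t]] (val x)].

End FaceAlgebra.

Definition mon_act (E : Type) d (X : 'I_d -> E -> E) (m : 'X_{1..d}) (x : E) : E :=
  foldr (fun i y => iter (m i) (X i) y) x (enum 'I_d).

Definition poly_act (K : fieldType) (E : lmodType K) d (X : 'I_d -> E -> E)
    (p : mpoly d K) (x : E) : E :=
  \sum_(m <- mpoly.msupp p) mpoly.mcoeff m p *: mon_act X m x.

Definition is_grading (K : fieldType) (E : lmodType K) (T : eqType) (H : T -> set E) :=
  [/\ forall t, lspan (H t) `<=` H t,
      forall x, exists (D : seq T) (y : T -> E),
        (forall t, H t (y t)) /\ x = \sum_(t <- D) y t &
      forall (D : seq T) (y : T -> E), uniq D -> (forall t, H t (y t)) ->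
        \sum_(t <- D) y t = 0 -> forall t, t \in D -> y t = 0].

Section Sheaves.
Variables (R : realType) (n : nat) (Psi : cone_family R (n + n)).
Local Notation C := R[i].

(* A sheaf of bigraded A-modules is given by its stalks and face restrictions.
   As A_eta = Sym(eta_C^* ) is a quotient of the polynomial ring on the
   coordinate forms of C^n (+) C^n, an A_eta-module is recorded by the commuting
   operators through which these forms act; the forms vanishing on eta_C act by
   zero.  The first n coordinates have degree (1, 0), the last n (0, 1).
   Degrees range over R x R because heights of lattice points need not be
   integers.  The laws are collected in is_gsheaf. *)
Record gsheaf := GSheaf {
  stalk : Psi -> lmodType C;
  res : forall eta gamma : Psi, stalk eta -> stalk gamma;
  act : forall eta : Psi, 'I_(n + n) -> stalk eta -> stalk eta;
  hpart : forall eta : Psi, R * R -> set (stalk eta) }.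

Definition var_degree (i : 'I_(n + n)) : R * R :=
  match fintype.split i with inl _ => (1, 0) | inr _ => (0, 1) end.

Record is_gsheaf (F : gsheaf) : Prop := IsGSheaf {
  res_lin : forall eta gamma, linear (@res F eta gamma);
  res_id : forall eta x, @res F eta eta x = x;
  res_comp : forall eta gamma beta x, face_le gamma eta -> face_le beta gamma ->
    @res F gamma beta (res gamma x) = @res F eta beta x;
  act_lin : forall eta i, linear (@act F eta i);
  act_comm : forall eta i j x, @act F eta i (act j x) = act j (act i x);
  act_van : forall (eta : Psi) (l : 'rV[C]_(n + n)),
    (forall y, cspan (cone eta) y -> dot l y = 0) ->
    forall x : stalk F eta, \sum_i l 0 i *: act i x = 0;
  res_act : forall eta gamma i x, face_le gamma eta ->
    @res F eta gamma (act i x) = act i (res gamma x);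
  homog_grading : forall eta, is_grading (@hpart F eta);
  homog_res : forall eta gamma t x, face_le gamma eta ->
    hpart t x -> hpart t (@res F eta gamma x);
  homog_act : forall eta i t x, @hpart F eta t x -> hpart (t + var_degree i) (act i x) }.

(* e is a basis of the stalk at eta over A_eta: coefficients are polynomials,
   unique modulo those vanishing on eta_C. *)
Definition is_basis (F : gsheaf) (eta : Psi) k (e : 'I_k -> stalk F eta) :=
  (forall x, exists p : 'I_k -> mpoly (n + n)%N C,
     x = \sum_(i < k) poly_act (@act F eta) (p i) (e i)) /\
  (forall p : 'I_k -> mpoly (n + n)%N C,
     \sum_(i < k) poly_act (@act F eta) (p i) (e i) = 0 ->
     forall i (y : 'rV[C]_(n + n)), cspan (cone eta) y -> (p i).@[fun j => y 0 j] = 0).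

Definition free_stalk (F : gsheaf) (eta : Psi) :=
  exists k (e : 'I_k -> stalk F eta) (t : 'I_k -> R * R),
    (forall i, hpart (t i) (e i)) /\ is_basis e.

Definition boundary_section (F : gsheaf) (eta : Psi) (s : forall gamma, stalk F gamma) :=
  forall gamma beta, face_lt gamma eta -> face_le beta gamma ->
    res beta (s gamma) = s beta.

Definition boundary_onto (F : gsheaf) (eta : Psi) :=
  forall s, boundary_section eta s ->
    exists x : stalk F eta, forall gamma, face_lt gamma eta -> res gamma x = s gamma.

Definition is_pure (F : gsheaf) :=
  is_gsheaf F /\ forall eta, free_stalk F eta /\ boundary_onto F eta.

(* The kernel of the boundary map lies in the irrelevant ideal times the stalk:
   together with purity, the boundary map is a minimal free cover. *)
Definition boundary_minimal (F : gsheaf) (eta : Psi) :=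
  forall x : stalk F eta,
    (forall gamma, face_lt gamma eta -> res gamma x = 0 :> stalk F gamma) ->
    exists z : 'I_(n + n) -> stalk F eta, x = \sum_i act i (z i).

Record is_minimal_sheaf (theta : Psi) (L : gsheaf) : Prop := IsMinimalSheaf {
  min_pure : is_pure L;
  min_supp : forall eta, ~ face_le theta eta -> forall x : stalk L eta, x = 0;
  min_theta : exists e : 'I_1 -> stalk L theta, hpart (0, 0) (e ord0) /\ is_basis e;
  min_cover : forall eta, face_lt theta eta -> boundary_minimal L eta }.

(* For complexes, hpart is indexed by the bidegrees (a, r) of regrade below. *)
Record csheaf := CSheaf {
  csheaf_sheaf :> gsheaf;
  cdiff : forall eta : Psi, stalk csheaf_sheaf eta -> stalk csheaf_sheaf eta }.

Definition gsheaf_map (F G : gsheaf) (phi : forall eta, stalk F eta -> stalk G eta) :=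
  [/\ forall eta, linear (phi eta),
      forall eta gamma x, face_le gamma eta -> phi gamma (res gamma x) = res gamma (phi eta x),
      forall eta i x, phi eta (act i x) = act i (phi eta x) &
      forall eta t x, hpart t x <-> hpart t (phi eta x)].

Definition gsheaf_iso (F G : gsheaf) :=
  exists phi : forall eta, stalk F eta -> stalk G eta,
    gsheaf_map phi /\ forall eta, bijective (phi eta).

Definition csheaf_iso (F G : csheaf) :=
  exists phi : forall eta, stalk F eta -> stalk G eta,
    [/\ gsheaf_map phi, forall eta, bijective (phi eta) &
        forall eta x, phi eta (cdiff x) = cdiff (phi eta x)].

(* Passage from the bidegree (i, j) and exterior degree k to the bidegree
   (a, r) = (k + i - j, i + j); the cohomological degree is a + r. *)
Definition regrade (k : nat) (t : R * R) : R * R := (k%:R + t.1 - t.2, t.1 + t.2).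

(* E (x) /\^* C^n, an element being the family of its coefficients on the basis
   e_I, the wedge of the e_i, i \in I, in increasing order. *)
Definition ext (E : lmodType C) := {ffun {set 'I_n} -> E}.
HB.instance Definition _ E := GRing.Lmodule.on (ext E).

Definition ext_sign (i : 'I_n) (I : {set 'I_n}) : C :=
  (-1) ^+ #|[set j in I | (j < i)%N]|.
Definition ext_map (E E' : lmodType C) (f : E -> E') (w : ext E) : ext E' :=
  [ffun I => f (w I)].
Definition ext_wedge (E : lmodType C) (i : 'I_n) (w : ext E) : ext E :=
  [ffun I : {set 'I_n} => if i \in I then ext_sign i I *: w (I :\ i)%SET else 0].
Definition ext_iota (E : lmodType C) (i : 'I_n) (w : ext E) : ext E :=
  [ffun I : {set 'I_n} => if i \in I then 0 else ext_sign i I *: w (i |: I)%SET].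

(* F (x)_A Cl.  The stalk F_eta (x)_A (A_eta (x)_C /\ N_C) is F_eta (x)_C /\ N_C.
   The identity tensors of c_C and of c'_C, read in c_C^* (x) M_C and
   c'_C^* (x) N_C, are the sums over the coordinates of the i-th coordinate form
   tensored with the i-th basis vector. *)
Definition koszul_diff (F : gsheaf) (eta : Psi) (w : ext (stalk F eta)) :
    ext (stalk F eta) :=
  \sum_(i < n) ext_iota i (ext_map (@act F eta (lshift n i)) w) +
  \sum_(i < n) ext_wedge i (ext_map (@act F eta (rshift n i)) w).

Definition koszul (F : gsheaf) : csheaf :=
  {| csheaf_sheaf := {|
       stalk := fun eta => ext (stalk F eta) : lmodType C;
       res := fun eta gamma => ext_map (@res F eta gamma);
       act := fun eta i => ext_map (@act F eta i);
       hpart := fun eta t => [set w | forall I : {set 'I_n},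
         exists2 ij, t = regrade #|I| ij & hpart ij (w I)] |};
     cdiff := @koszul_diff F |}.

Section DirectSum.
Variables (J : finType) (W : J -> lmodType C) (HW : forall j, R * R -> set (W j)).

Definition gsheaf_sum (L : J -> gsheaf) : gsheaf :=
  {| stalk := fun eta =>
       dprod (fun j => tensor (W j) (stalk (L j) eta) : lmodType C) : lmodType C;
     res := fun eta gamma x j => tmap (@res (L j) eta gamma) (x j);
     act := fun eta i x j => tmap (@act (L j) eta i) (x j);
     hpart := fun eta t => [set x | forall j, lspan
       [set y | exists t1 t2 v e, [/\ t = t1 + t2, HW t1 v,
                  @hpart (L j) eta t2 e & y = tpure v e]] (x j)] |}.

Definition csheaf_sum (L : J -> csheaf) : csheaf :=
  {| csheaf_sheaf := gsheaf_sum L;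
     cdiff := fun eta x j => tmap (@cdiff (L j) eta) (x j) |}.
End DirectSum.

(* Complexes of vector spaces, with gdeg (a, r) the component of bidegree
   (a, r), in cohomological degree a + r. *)
Record gcomplex := GComplex {
  gspace : lmodType C;
  gdiff : gspace -> gspace;
  gdeg : R * R -> set gspace }.

(* Over a field, two complexes are isomorphic in the derived category iff there
   is a quasi-isomorphism from the first to the second. *)
Definition quasi_iso (X Y : gcomplex) (phi : gspace X -> gspace Y) :=
  [/\ linear phi,
      forall x, phi (gdiff x) = gdiff (phi x),
      forall t x, gdeg t x -> gdeg t (phi x),
      forall x, gdiff x = 0 -> (exists y, phi x = gdiff y) -> exists x', x = gdiff x' &
      forall y, gdiff y = 0 -> exists x y', gdiff x = 0 /\ y = phi x + gdiff y'].

Definition gcomplex_sum (J : finType) (W : J -> lmodType C)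
    (HW : forall j, R * R -> set (W j)) (X : J -> gcomplex) : gcomplex :=
  {| gspace := dprod (fun j => tensor (W j) (gspace (X j)) : lmodType C) : lmodType C;
     gdiff := fun x j => tmap (@gdiff (X j)) (x j);
     gdeg := fun t => [set x | forall j, lspan
       [set y | exists t1 t2 v e, [/\ t = t1 + t2, @HW j t1 v,
                  @gdeg (X j) t2 e & y = tpure v e]] (x j)] |}.

(* The derived functor of global sections (the limit over the faces) is computed
   by the normalized Godement (Roos) cochain complex
     C^p = prod over strict chains eta_0 < ... < eta_p of F_(eta_0),
   and for a complex of sheaves by its total complex.  A chain is stored as
   eta_0 and the list of the other cones. *)
Definition face_ltb (eta gamma : Psi) : bool := `[< face_lt eta gamma >].

Definition chains (eta : Psi) := {s : seq Psi | path face_ltb eta s}.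

Definition cochains (F : gsheaf) : lmodType C :=
  dprod (fun eta : Psi => dprod (fun _ : chains eta => stalk F eta) : lmodType C).

Definition cochain_at (F : gsheaf) (f : cochains F) (eta : Psi) (s : seq Psi) :
    stalk F eta :=
  if (insub s : option (chains eta)) is Some s' then f eta s' else 0.

Definition roos_diff (F : gsheaf) (f : cochains F) : cochains F :=
  fun eta s =>
    (if val s is eta1 :: s' then res eta (cochain_at f eta1 s') else 0) +
    \sum_(i < size (val s))
      (-1) ^+ i.+1 *: cochain_at f eta (take i (val s) ++ drop i.+1 (val s)).

Definition RGamma (F : csheaf) : gcomplex :=
  {| gspace := cochains F;
     gdiff := fun f eta s => roos_diff f s + (-1) ^+ size (val s) *: cdiff (f eta s);
     gdeg := fun t => [set f | forall eta (s : chains eta),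
       hpart (t - (0, (size (val s))%:R)) ((f : cochains F) eta s)] |}.

End Sheaves.

Section Mirror.
Variables (R : realType) (n : nat).
Local Notation C := R[i].
Local Notation lattice := 'rV[int]_n.
(* M = N = Z^n, in duality by dot. *)
Variables (S S' : cone_family R n) (G G' : cone_family R n).
Variables (psi psi' : 'rV[R]_n -> R).
(* g' (the mirror potential) has support in M and g in N. *)
Variables (g g' : {malg C[lattice]}).

Definition Phi_idx := {eta : S * S' |
  `[< forall x y, cone eta.1 x -> cone eta.2 y -> dot x y = 0 >]}.
HB.instance Definition _ := Finite.on Phi_idx.

Definition Phi : cone_family R (n + n) :=
  {| cidx := Phi_idx : finType;
     cone := fun eta => [set z | exists x y,
       [/\ cone (val eta).1 x, cone (val eta).2 y & z = row_mx x y]] |}.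

Implicit Types (eta gamma theta : Phi).

Definition lcone eta : set 'rV[R]_n := cone (val eta).1.
Definition rcone eta : set 'rV[R]_n := cone (val eta).2.

(* The tensor product of the face algebras, on its basis of monomials x^m y^l. *)
Definition bimon eta := (latpt (lcone eta) * latpt (rcone eta))%type.
HB.instance Definition _ eta := Choice.on (bimon eta).
Definition bialg eta : lmodType C := {malg C[bimon eta]}.

Definition bimono eta (m l : lattice) : bialg eta :=
  if (insub m : option (latpt (lcone eta))) is Some m' then
    if (insub l : option (latpt (rcone eta))) is Some l' then << (m', l') >> else 0
  else 0.

(* Multiplication by x^u and by y^v; it is 0 for u, resp. v, not in the cone. *)
Definition mulx eta (u : lattice) : bialg eta -> bialg eta :=
  mext (fun p : bimon eta => if share G (lcone eta) u (val p.1)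
                   then bimono eta (u + val p.1) (val p.2) else 0).
Definition muly eta (v : lattice) : bialg eta -> bialg eta :=
  mext (fun p : bimon eta => if share G' (rcone eta) v (val p.2)
                   then bimono eta (val p.1) (v + val p.2) else 0).

Definition B_act eta (i : 'I_(n + n)) (b : bialg eta) : bialg eta :=
  match fintype.split i with
  | inl i => mext (fun u : lattice => (u 0 i)%:~R *: mulx u b) g'
  | inr i => mext (fun v : lattice => (v 0 i)%:~R *: muly v b) g
  end.

Definition B_sheaf : gsheaf Phi :=
  {| stalk := bialg;
     res := fun eta gamma =>
       mext (fun p : bimon eta => bimono gamma (val p.1) (val p.2));
     act := B_act;
     hpart := fun eta t => [set b : bialg eta | forall p, p \in monalg.msupp b ->
       t = (psi (realpt R (val p.1)), psi' (realpt R (val p.2)))] |}.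

Definition hatC_diff eta (w : ext n (bialg eta)) : ext n (bialg eta) :=
  mext (fun u : lattice => \sum_(i < n) (u 0 i)%:~R *: ext_iota i (ext_map (mulx u) w)) g' +
  mext (fun v : lattice => \sum_(i < n) (v 0 i)%:~R *: ext_wedge i (ext_map (muly v) w)) g +
  \sum_(i < n) ext_wedge i (ext_map
    (mext (fun p : bimon eta => (val p.2 0 i)%:~R *: (<< p >> : bialg eta))) w).

(* The degree a of the basis element x^m y^l (x) e_I. *)
Definition a_degree eta (p : bimon eta) (I : {set 'I_n}) : R :=
  #|I|%:R + psi (realpt R (val p.1)) - psi' (realpt R (val p.2)).

(* The span of the basis elements with a = lambda; it maps isomorphically to
   Gr_F^lambda, F^lambda being the span of those with a >= lambda. *)
Definition a_part eta (lambda : R) (w : ext n (bialg eta)) : ext n (bialg eta) :=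
  [ffun I => mext (fun p : bimon eta => if a_degree p I == lambda
                       then << p >> : bialg eta else 0) (w I)].

Definition basis_elt eta (p : bimon eta) (I : {set 'I_n}) : ext n (bialg eta) :=
  [ffun I' => if I' == I then << p >> else 0].

(* The differential induced by hatC_diff on Gr_F, through this identification. *)
Definition C_diff eta (w : ext n (bialg eta)) : ext n (bialg eta) :=
  \sum_(I : {set 'I_n}) mext (fun p : bimon eta =>
    a_part (a_degree p I) (hatC_diff (basis_elt p I))) (w I).

Definition C_sheaf : csheaf Phi :=
  {| csheaf_sheaf := {|
       stalk := fun eta => ext n (bialg eta) : lmodType C;
       res := fun eta gamma => ext_map (@res _ _ _ B_sheaf eta gamma);
       act := fun eta i => ext_map (@B_act eta i);
       hpart := fun eta t => [set w : ext n (bialg eta) |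
         forall (I : {set 'I_n}) p, p \in monalg.msupp (w I) ->
         t = (a_degree p I, psi (realpt R (val p.1)) + psi' (realpt R (val p.2)))] |};
     cdiff := C_diff |}.

Definition Vmult theta : lmodType C :=
  tensor (R1 G g' (lcone theta)) (R1 G' g (rcone theta)).

Definition Vmult_homog theta (t : R * R) : set (Vmult theta) :=
  lspan [set y | exists v w,
    [/\ R1_homog psi t.1 v, R1_homog psi' t.2 w & y = tpure v w]].

Definition Vmult_homog_ar theta (t : R * R) : set (Vmult theta) :=
  [set v | exists2 ij, t = regrade 0 ij & Vmult_homog ij v].

End Mirror.

(* Main.v *)
Require Import Defs.
From mathcomp Require Import all_boot all_order all_algebra.
From mathcomp Require Import boolp classical_sets reals complex.
From mathcomp Require Import finmap monalg mpoly.
From mathcomp Require Import ring lra.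

Set Implicit Arguments.
Unset Strict Implicit.
Unset Printing Implicit Defensive.

Import Order.TTheory GRing.Theory Num.Theory.
Local Open Scope classical_set_scope.
Local Open Scope ring_scope.

(** On each cone the boundary map of [B_sheaf] is onto and its kernel is spanned by
the interior monomials, so a homogeneous basis of the primitive part at [theta]
lifts to interior sections over [theta].  As the stalks of [L theta] are free and the
boundary maps of [B_sheaf] are onto, each such section extends, one cone at a time, to
a map of sheaves [L theta -> B_sheaf], and these add up to a map from the direct sum to
[B_sheaf].  Induction on the cones shows that it is bijective on stalks: it is onto by
the graded Nakayama lemma, heights being nonnegative; its kernel [K] lies in the maximal
ideal times the stalk because the covers are minimal, and facewise regularity then gives
[K = m K], whence [K = 0].

The associated graded complex is the Koszul complex of [B_sheaf]: wedging with the
exponent raises the degree [a] by one and disappears in [Gr_F].  Forming the Koszul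
complex and the Roos cochains commutes with finite sums of tensor products, so the two
other decompositions follow from the first. *)

(** * Linear maps, spans and tensor products *)

(** The stalks of [B_sheaf] are not known to be free beforehand: freeness comes out of the
    decomposition. What facewise regularity supplies is the vanishing of $\mathrm{Tor}_1$ of a stalk
    with $\mathbb C$. For a surjection of a free module $E$ onto the stalk with kernel $K$, this
    means $K\cap\mathfrak mE=\mathfrak mK$, so that $K\subseteq\mathfrak mE$ becomes $K=\mathfrak
    mK$. Bidegrees are pairs of real numbers, so no induction runs on them directly. The arguments
    use the total degree, which each coordinate form raises by exactly one and which is bounded
    below. Nonnegativity of heights rests on a strongly convex rational cone being generated by its
    rays, where the stacky vectors have height one. The noncanonical choices are bases: in each
    Jacobian quotient, classes of monomials, taken among the interior monomials first. Statements on
    a tensor product with a multiplicity space are proved on its coordinates in such a basis. *)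

Section LinearFunctions.
Variables (K : fieldType) (E E' : lmodType K) (f : E -> E').
Hypothesis flin : linear f.

Lemma linfZ a x : f (a *: x) = a *: f x.
Proof.
have f0 : f 0 = 0.
  by have := flin (-1) 0 0; rewrite scaler0 addr0 scaleN1r addNr.
by have := flin a x 0; rewrite !addr0 f0 addr0.
Qed.
Lemma linf0 : f 0 = 0. Proof. by rewrite -(scale0r 0) linfZ scale0r. Qed.
Lemma linfD x y : f (x + y) = f x + f y.
Proof. by have := flin 1 x y; rewrite !scale1r. Qed.
Lemma linfN x : f (- x) = - f x. Proof. by rewrite -scaleN1r linfZ scaleN1r. Qed.
Lemma linfB x y : f (x - y) = f x - f y. Proof. by rewrite linfD linfN. Qed.
Lemma linf_sum I (r : seq I) (P : pred I) (F : I -> E) :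
  f (\sum_(i <- r | P i) F i) = \sum_(i <- r | P i) f (F i).
Proof. exact: (big_morph f linfD linf0). Qed.
End LinearFunctions.

Section LinearClosure.
Variables (K : fieldType) (E E' E'' : lmodType K).
Lemma lin_id : linear (@id E). Proof. by []. Qed.
Lemma lin_0 : linear (fun _ : E => 0 : E').
Proof. by move=> a x y; rewrite scaler0 addr0. Qed.
Lemma lin_comp (g : E' -> E'') (f : E -> E') :
  linear g -> linear f -> linear (fun x => g (f x)).
Proof. by move=> hg hf a x y; rewrite hf hg. Qed.
Lemma lin_add (f g : E -> E') : linear f -> linear g -> linear (fun x => f x + g x).
Proof. by move=> hf hg a x y; rewrite hf hg scalerDr addrACA. Qed.
Lemma lin_scale c (f : E -> E') : linear f -> linear (fun x => c *: f x).
Proof. by move=> hf a x y; rewrite hf scalerDr !scalerA mulrC. Qed.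
Lemma lin_sum I (r : seq I) (P : pred I) (f : I -> E -> E') :
  (forall i, P i -> linear (f i)) -> linear (fun x => \sum_(i <- r | P i) f i x).
Proof.
move=> hf a x y; rewrite scaler_sumr -big_split.
by apply: eq_bigr => i Pi; rewrite hf.
Qed.
Lemma lin_can (f : E -> E') (g : E' -> E) :
  linear f -> cancel f g -> cancel g f -> linear g.
Proof. by move=> hf fK gK a x y; rewrite -{1}[x]gK -{1}[y]gK -hf fK. Qed.
End LinearClosure.

Section LSpan.
Variables (K : fieldType) (E : lmodType K).
Implicit Type A : set E.

Lemma lspanE A x : lspan A x <-> x \in inspan A.
Proof. by split=> /asboolP. Qed.
Lemma lspan0 A : lspan A 0. Proof. by apply/lspanE; exact: rpred0. Qed.
Lemma lspan_lin A a x y : lspan A x -> lspan A y -> lspan A (a *: x + y).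
Proof. by move=> /lspanE h /lspanE h'; apply/lspanE; rewrite rpredD ?rpredZ. Qed.
Lemma lspanD A x y : lspan A x -> lspan A y -> lspan A (x + y).
Proof. by move=> hx hy; rewrite -[x]scale1r; apply: lspan_lin. Qed.
Lemma lspanZ A a x : lspan A x -> lspan A (a *: x).
Proof. by move=> hx; rewrite -[_ *: _]addr0; apply: lspan_lin => //; apply: lspan0. Qed.
Lemma lspanN A x : lspan A x -> lspan A (- x).
Proof. by rewrite -scaleN1r; apply: lspanZ. Qed.
Lemma lspanB A x y : lspan A x -> lspan A y -> lspan A (x - y).
Proof. by move=> hx hy; apply: lspanD => //; apply: lspanN. Qed.
Lemma lspan_sum A (I : eqType) (r : seq I) (P : pred I) (F : I -> E) :
  (forall i, i \in r -> P i -> lspan A (F i)) -> lspan A (\sum_(i <- r | P i) F i).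
Proof.
move=> h; rewrite big_seq_cond; elim/big_ind: _ => [|x y|i /andP[ir Pi]].
- exact: lspan0.
- exact: lspanD.
- exact: h.
Qed.
Lemma lspan_gen A x : A x -> lspan A x.
Proof.
move=> Ax; exists 1%N, (fun=> 1), (fun=> x); split=> //.
by rewrite big_ord1 scale1r.
Qed.
Lemma lspan_ind A (P : E -> Prop) :
  P 0 -> (forall a x y, A x -> P y -> P (a *: x + y)) -> forall x, lspan A x -> P x.
Proof.
move=> P0 PD x [k [a [v [Av ->]]]].
elim: k a v Av => [|k IH] a v Av; first by rewrite big_ord0.
by rewrite big_ord_recl; apply: PD => //; apply: IH.
Qed.
Lemma lspan_sub A (B : set E) x : A `<=` lspan B -> lspan A x -> lspan B x.
Proof.
move=> AB; elim/lspan_ind=> [|a y z /AB hy hz]; first exact: lspan0.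
exact: lspan_lin.
Qed.
Lemma lspan_mono A (B : set E) x : A `<=` B -> lspan A x -> lspan B x.
Proof. by move=> AB; apply: lspan_sub => y /AB; apply: lspan_gen. Qed.
Lemma lspan_idem A x : lspan (lspan A) x -> lspan A x.
Proof. exact: lspan_sub. Qed.
End LSpan.

Lemma lspan_img (K : fieldType) (E E' : lmodType K) (A : set E) (B : set E')
    (f : E -> E') : linear f -> (forall x, A x -> lspan B (f x)) ->
  forall x, lspan A x -> lspan B (f x).
Proof.
move=> hf h; apply: lspan_ind => [|a x y Ax hy].
  by rewrite (linf0 hf); apply: lspan0.
by rewrite hf; apply: lspan_lin => //; apply: h.
Qed.

Lemma lspan_ker (K : fieldType) (E E' : lmodType K) (A : set E)
    (f : E -> E') : linear f -> (forall x, A x -> f x = 0) ->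
  forall x, lspan A x -> f x = 0.
Proof.
move=> hf h; apply: lspan_ind => [|a x y Ax hy]; first exact: linf0.
by rewrite hf hy (h _ Ax) scaler0 addr0.
Qed.

Section FreeModules.
Variables (K : fieldType) (X : choiceType).

Lemma mextEw (E : lmodType K) (h : X -> E) (x : {malg K[X]}) (D : {fset X}) :
  (monalg.msupp x `<=` D)%fset -> mext h x = \sum_(k <- D) monalg.mcoeff k x *: h k.
Proof.
move=> sub; rewrite /mext (big_fset_incl _ sub) // => k _.
by move=> /monalg.mcoeff_outdom ->; rewrite scale0r.
Qed.

Lemma mext_lin (E : lmodType K) (h : X -> E) : linear (mext h).
Proof.
move=> a x y.
pose D := (monalg.msupp x `|` monalg.msupp y `|` monalg.msupp (a *: x + y)%R)%fset.
have s3 : (monalg.msupp (a *: x + y)%R `<=` D)%fset by apply: fsubsetUr.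
have s12 : (monalg.msupp x `|` monalg.msupp y `<=` D)%fset by apply: fsubsetUl.
have s1 := fsubset_trans (fsubsetUl _ _) s12.
have s2 := fsubset_trans (fsubsetUr _ _) s12.
rewrite (mextEw _ s1) (mextEw _ s2) (mextEw _ s3).
rewrite scaler_sumr -big_split; apply: eq_bigr => k _ /=.
by rewrite monalg.mcoeffD monalg.mcoeffZ scalerDl scalerA.
Qed.

Lemma mextU (E : lmodType K) (h : X -> E) k : mext h << k >> = h k.
Proof. by rewrite /mext monalg.msuppU oner_eq0 big_seq_fset1 monalg.mcoeffUU scale1r. Qed.

Lemma malg_sumE (x : {malg K[X]}) :
  x = \sum_(k <- monalg.msupp x) monalg.mcoeff k x *: << k >>.
Proof.
rewrite {1}[x]monalg.monalgE; apply: eq_bigr => k _; apply/monalg.malgP => j.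
by rewrite monalg.mcoeffZ !monalg.mcoeffU; case: eqP; rewrite ?mulr1 ?mulr0.
Qed.

Lemma malg_linP (E : lmodType K) (f g : {malg K[X]} -> E) :
  linear f -> linear g -> (forall k, f << k >> = g << k >>) -> f =1 g.
Proof.
move=> hf hg fg x; rewrite [x]malg_sumE (linf_sum hf) (linf_sum hg).
by apply: eq_bigr => k _; rewrite (linfZ hf) (linfZ hg) fg.
Qed.

Lemma mext_comp (E E' : lmodType K) (f : E -> E') (h : X -> E) x :
  linear f -> f (mext h x) = mext (fun k => f (h k)) x.
Proof.
move=> hf; rewrite /mext (linf_sum hf); apply: eq_bigr => k _.
by rewrite (linfZ hf).
Qed.

Lemma eq_in_mext (E : lmodType K) (h h' : X -> E) (x : {malg K[X]}) :
  (forall k, k \in monalg.msupp x -> h k = h' k) -> mext h x = mext h' x.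
Proof. by move=> hh; rewrite /mext big_seq [RHS]big_seq; apply: eq_bigr => k /hh ->. Qed.

Lemma mextD (E : lmodType K) (h h' : X -> E) x :
  mext (fun k => h k + h' k) x = mext h x + mext h' x.
Proof. by rewrite /mext -big_split; apply: eq_bigr => k _; rewrite scalerDr. Qed.
Lemma mext_scale (E : lmodType K) c (h : X -> E) x :
  mext (fun k => c *: h k) x = c *: mext h x.
Proof.
rewrite /mext scaler_sumr; apply: eq_bigr => k _.
by rewrite !scalerA mulrC.
Qed.
Lemma mext_sum (E : lmodType K) I (r : seq I) (h : I -> X -> E) x :
  mext (fun k => \sum_(i <- r) h i k) x = \sum_(i <- r) mext (h i) x.
Proof.
rewrite /mext exchange_big; apply: eq_bigr => k _ /=.
by rewrite scaler_sumr.
Qed.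
Lemma mext0 (E : lmodType K) (h : X -> E) x : (forall k, h k = 0) -> mext h x = 0.
Proof. by move=> h0; rewrite /mext big1 // => k _; rewrite h0 scaler0. Qed.
Lemma mext_linp (E E' : lmodType K) (h : E -> X -> E') x :
  (forall k, linear (h ^~ k)) -> linear (fun e => mext (h e) x).
Proof.
move=> hh; apply: lin_sum => k _; apply: lin_scale; exact: hh.
Qed.
End FreeModules.

Section QuotientMaps.
Variables (K : fieldType) (E : lmodType K).
Implicit Type A : set E.

Lemma quo_pi_lin A : linear (@quo_pi K E A).
Proof. by move=> a x y; rewrite quo_piD quo_piZ. Qed.

Lemma quo_pi_eq0 A x : quo_pi A x = 0 <-> lspan A x.
Proof.
rewrite -(linf0 (@quo_pi_lin A)) quo_eqP subr0; exact: (iff_sym (@lspanE _ _ A x)).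
Qed.

(** [quo_repr] picks an arbitrary representative. A linear map that kills the relations cannot see
    the choice, so [f (quo_repr _)] is the induced map on the quotient. *)
Lemma quo_lift A (E' : lmodType K) (f : E -> E') : linear f ->
  (forall x, A x -> f x = 0) -> forall x, f (quo_repr (quo_pi A x)) = f x.
Proof.
move=> hf h x; apply/eqP; rewrite -subr_eq0 -(linfB hf); apply/eqP.
apply: (lspan_ker hf h); apply/lspanE.
by apply/(quo_eqP A (quo_repr (quo_pi A x)) x); rewrite quo_piK.
Qed.

Lemma quo_lift_lin A (E' : lmodType K) (f : E -> E') : linear f ->
  (forall x, A x -> f x = 0) -> linear (fun x : quo A => f (quo_repr x)).
Proof.
move=> hf h a x y.
rewrite -{1}[x]quo_piK -{1}[y]quo_piK -(quo_pi_lin A) (quo_lift hf h).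
exact: hf.
Qed.
End QuotientMaps.

Section TensorMaps.
Variables (K : fieldType) (V : lmodType K).

Lemma tpureDl (E : lmodType K) (v v' : V) (e : E) :
  tpure (v + v') e = tpure v e + tpure v' e.
Proof.
apply/eqP; rewrite -subr_eq0 opprD addrA -!(linfB (@quo_pi_lin _ _ _)); apply/eqP.
by apply/quo_pi_eq0/lspan_gen; left; exists v, v', e.
Qed.
Lemma tpureDr (E : lmodType K) (v : V) (e e' : E) :
  tpure v (e + e') = tpure v e + tpure v e'.
Proof.
apply/eqP; rewrite -subr_eq0 opprD addrA -!(linfB (@quo_pi_lin _ _ _)); apply/eqP.
by apply/quo_pi_eq0/lspan_gen; right; left; exists v, e, e'.
Qed.
Lemma tpureZl (E : lmodType K) a (v : V) (e : E) : tpure (a *: v) e = a *: tpure v e.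
Proof.
apply/eqP; rewrite -subr_eq0 /tpure -(linfZ (@quo_pi_lin _ _ _)).
rewrite -!(linfB (@quo_pi_lin _ _ _)); apply/eqP.
by apply/quo_pi_eq0/lspan_gen; right; right; left; exists a, v, e.
Qed.
Lemma tpureZr (E : lmodType K) a (v : V) (e : E) : tpure v (a *: e) = a *: tpure v e.
Proof.
apply/eqP; rewrite -subr_eq0 /tpure -(linfZ (@quo_pi_lin _ _ _)).
rewrite -!(linfB (@quo_pi_lin _ _ _)); apply/eqP.
by apply/quo_pi_eq0/lspan_gen; right; right; right; exists a, v, e.
Qed.
Lemma tpure_linl (E : lmodType K) (e : E) : linear (fun v : V => tpure v e).
Proof. by move=> a v v'; rewrite tpureDl tpureZl. Qed.
Lemma tpure_linr (E : lmodType K) (v : V) : linear (fun e : E => tpure v e).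
Proof. by move=> a e e'; rewrite tpureDr tpureZr. Qed.

Lemma tensor_span (E : lmodType K) (t : tensor V E) :
  lspan [set x | exists v e, x = tpure v e] t.
Proof.
rewrite -[t]quo_piK [quo_repr t]malg_sumE (linf_sum (@quo_pi_lin _ _ _)).
apply: lspan_sum => -[v e] _ _; rewrite (linfZ (@quo_pi_lin _ _ _)).
by apply/lspanZ/lspan_gen; exists v, e.
Qed.

Lemma tensor_linP (E E' : lmodType K) (f g : tensor V E -> E') :
  linear f -> linear g -> (forall v e, f (tpure v e) = g (tpure v e)) -> f =1 g.
Proof.
move=> hf hg fg t; elim/lspan_ind: {t}(tensor_span t) => [|a x y [v [e ->]] h].
  by rewrite (linf0 hf) (linf0 hg).
by rewrite hf hg h fg.
Qed.

Definition bilin (E E' : lmodType K) (b : V -> E -> E') :=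
  (forall e, linear (b ^~ e)) /\ (forall v, linear (b v)).

(** The map given by the universal property of the tensor product; it has a meaning only under
    [bilin b]. *)
Definition tlift (E E' : lmodType K) (b : V -> E -> E') (t : tensor V E) : E' :=
  mext (fun p => b p.1 p.2) (quo_repr t).

Lemma tlift_rel (E E' : lmodType K) (b : V -> E -> E') : bilin b ->
  forall x, tensor_rel x -> mext (fun p : V * E => b p.1 p.2) x = 0.
Proof.
move=> [hl hr]; have hm := @mext_lin K (V * E)%type E' (fun p => b p.1 p.2).
have hB := linfB hm; have hZ := linfZ hm.
move=> x; case=> [[v [v' [e ->]]]|]; first rewrite !hB !mextU /=.
  by rewrite (linfD (hl e)) -addrA -opprD subrr.
case=> [[v [e [e' ->]]]|]; first rewrite !hB !mextU /=.
  by rewrite (linfD (hr v)) -addrA -opprD subrr.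
case=> -[a [v [e ->]]]; rewrite hB hZ !mextU /=.
  by rewrite (linfZ (hl e)) subrr.
by rewrite (linfZ (hr v)) subrr.
Qed.

Lemma tlift_pure (E E' : lmodType K) (b : V -> E -> E') : bilin b ->
  forall v e, tlift b (tpure v e) = b v e.
Proof.
move=> hb v e; rewrite /tlift /tpure (quo_lift (@mext_lin _ _ _ _) (tlift_rel hb)).
by rewrite mextU.
Qed.

Lemma tlift_lin (E E' : lmodType K) (b : V -> E -> E') : bilin b -> linear (tlift b).
Proof. by move=> hb; apply: quo_lift_lin (tlift_rel hb); apply: mext_lin. Qed.

Section TMap.
Variables (E E' : lmodType K) (f : E -> E').
Hypothesis hf : linear f.
Let hb : bilin (fun (v : V) (e : E) => tpure v (f e)).
Proof.
split=> [e|v]; first exact: tpure_linl.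
by apply: (lin_comp (tpure_linr _)).
Qed.
Lemma tmap_pure (v : V) (e : E) : tmap f (tpure v e) = tpure v (f e).
Proof. exact: (tlift_pure hb). Qed.
Lemma tmap_lin : linear (@tmap K V E E' f).
Proof. exact: (tlift_lin hb). Qed.
End TMap.

Lemma tmap_comp (E E' E'' : lmodType K) (g : E' -> E'') (f : E -> E') :
  linear g -> linear f -> forall t : tensor V E, tmap g (tmap f t) = tmap (fun x => g (f x)) t.
Proof.
move=> hg hf; have hgf := lin_comp hg hf.
apply: tensor_linP; first by apply: lin_comp; apply: tmap_lin.
  exact: tmap_lin.
by move=> v e; rewrite !tmap_pure.
Qed.

Lemma tmap_id (E : lmodType K) (t : tensor V E) : tmap id t = t.
Proof.
move: t; apply: tensor_linP => [||v e]; try exact: tmap_lin (@lin_id _ _).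
exact: lin_id. by rewrite (tmap_pure (@lin_id _ _)).
Qed.

Lemma eq_tmap (E E' : lmodType K) (f g : E -> E') : f =1 g ->
  forall t : tensor V E, tmap f t = tmap g t.
Proof. by move=> fg t; have -> : f = g by apply: functional_extensionality_dep. Qed.

Lemma tmapD (E E' : lmodType K) (f g : E -> E') : linear f -> linear g ->
  forall t : tensor V E, tmap (fun x => f x + g x) t = tmap f t + tmap g t.
Proof.
move=> hf hg; have hfg := lin_add hf hg.
apply: tensor_linP; first exact: tmap_lin.
  by apply: lin_add; apply: tmap_lin.
by move=> v e; rewrite !tmap_pure // tpureDr.
Qed.
Lemma tmapZ (E E' : lmodType K) c (f : E -> E') : linear f ->
  forall t : tensor V E, tmap (fun x => c *: f x) t = c *: tmap f t.
Proof.
move=> hf; have hcf := lin_scale c hf.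
apply: tensor_linP; first exact: tmap_lin.
  by apply: lin_scale; apply: tmap_lin.
by move=> v e; rewrite !tmap_pure // tpureZr.
Qed.
Lemma tmap0 (E E' : lmodType K) (t : tensor V E) : tmap (fun=> 0 : E') t = 0.
Proof.
have h := @lin_0 K E E'; move: t.
apply: tensor_linP; [exact: tmap_lin | exact: lin_0 |] => v e.
by rewrite tmap_pure // (linf0 (tpure_linr _)).
Qed.
Lemma tmap_sum (E E' : lmodType K) I (r : seq I) (P : pred I) (f : I -> E -> E') :
  (forall i, linear (f i)) -> forall t : tensor V E,
  tmap (fun x => \sum_(i <- r | P i) f i x) t = \sum_(i <- r | P i) tmap (f i) t.
Proof.
move=> hf t; elim: r => [|i r IH].
  rewrite big_nil -[RHS](@tmap0 E E' t); apply: eq_tmap => x; exact: big_nil.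
rewrite big_cons -{}IH; set g := fun x => \sum_(i <- r | P i) f i x.
have hg : linear g by apply: lin_sum.
case Pi: (P i); last by apply: eq_tmap => x; rewrite big_cons Pi.
rewrite -(tmapD (hf i) hg).
by apply: eq_tmap => x; rewrite big_cons Pi.
Qed.
End TensorMaps.

Lemma big_dprod (K : fieldType) (I : Type) (E : I -> lmodType K) (J : Type) (r : seq J)
    (P : pred J) (f : J -> dprod E) i :
  (\sum_(j <- r | P j) f j) i = \sum_(j <- r | P j) f j i.
Proof. by elim/big_rec2: _ => [//|j _ y _ <-]. Qed.

Section DirectProducts.
Variables (K : fieldType) (I : eqType) (E : I -> lmodType K).
Implicit Types (x : dprod E) (i j : I).

Definition dinj i (e : E i) : dprod E := dfwith (0 : dprod E) e.

Lemma dinj_in i (e : E i) : dinj e i = e.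
Proof. by rewrite /dinj dfwith_in. Qed.
Lemma dinj_out i j (e : E i) : i != j -> dinj e j = 0.
Proof. by move=> ne; rewrite /dinj dfwith_out. Qed.
Lemma dinj_lin i : linear (@dinj i).
Proof.
move=> a e e'; apply: functional_extensionality_dep => j.
rewrite -[RHS]/(a *: dinj e j + dinj e' j).
have [<-|ne] := eqVneq i j; first by rewrite !dinj_in.
by rewrite !dinj_out // scaler0 addr0.
Qed.
Lemma dpr_lin i : linear (fun x => x i). Proof. by []. Qed.

Variables (V : lmodType K) (r : seq I).
Hypotheses (ru : uniq r) (rT : forall i, i \in r).

Lemma sum_dinj x : \sum_(i <- r) dinj (x i) = x.
Proof.
apply: functional_extensionality_dep => j; rewrite big_dprod.
rewrite (big_rem j) //= dinj_in big_seq big1 ?addr0 // => i.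
by rewrite mem_rem_uniq // inE => /andP[ne _]; rewrite dinj_out.
Qed.

(** With [tmap_dpr_sum], this identifies $V\otimes\prod_iE_i$ with $\prod_iV\otimes E_i$ for a
    finite index. Finiteness is given by an enumeration [r], so that it also applies to the type of
    chains. *)
Lemma tmap_sum_dinj (t : tensor V (dprod E)) :
  \sum_(i <- r) tmap (@dinj i) (tmap (fun x => x i) t) = t.
Proof.
rewrite -[RHS]tmap_id.
under eq_bigr => i _ do rewrite (tmap_comp (@dinj_lin i) (@dpr_lin i)).
rewrite -(tmap_sum _ _ (fun i => lin_comp (@dinj_lin i) (@dpr_lin i))).
by apply: eq_tmap => x; apply: sum_dinj.
Qed.

Lemma tmap_dpr_sum (y : forall i, tensor V (E i)) j :
  tmap (fun x => x j) (\sum_(i <- r) tmap (@dinj i) (y i)) = y j.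
Proof.
rewrite (linf_sum (tmap_lin (@dpr_lin j))) (big_rem j) //=.
rewrite (tmap_comp (@dpr_lin j) (@dinj_lin j)) (eq_tmap (@dinj_in j)) tmap_id.
rewrite big_seq big1 ?addr0 // => i; rewrite mem_rem_uniq // inE => /andP[ne _].
rewrite (tmap_comp (@dpr_lin j) (@dinj_lin i)) -(tmap0 (E j) (y i)).
by apply: eq_tmap => e; rewrite dinj_out.
Qed.
End DirectProducts.

(** * Bases chosen inside a spanning family *)

Section Bases.
Variables (K : fieldType) (E : lmodType K) (Y : choiceType) (w : Y -> E).
Implicit Types (T : set Y) (z : {malg K[Y]}).

Definition supported T z := forall y, monalg.mcoeff y z != 0 -> T y.

Lemma supported_lin T a z z' :
  supported T z -> supported T z' -> supported T (a *: z + z').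
Proof.
move=> h h' y; rewrite monalg.mcoeffD monalg.mcoeffZ.
have [e|/h //] := eqVneq (monalg.mcoeff y z) 0.
by rewrite e mulr0 add0r => /h'.
Qed.

Lemma supportedU T y : T y -> supported T << y >>.
Proof. by move=> Ty y'; rewrite monalg.mcoeffU; case: (y =P y') => [<-|]; rewrite ?eqxx. Qed.

Definition indep T := forall z, supported T z -> mext w z = 0 -> z = 0.

Definition generated T (x : E) := exists2 z, supported T z & mext w z = x.

(** The support is finite, and among finitely many members of a chain one contains all the
    others. *)
Lemma supported_chain (F : set (set Y)) T0 z :
  total_on F subset -> (exists A, F A) ->
  supported (\bigcup_(X in F) X `|` T0) z -> exists2 A, F A & supported (A `|` T0) z.
Proof.
move=> tot [A0 FA0] sz.
suff [A FA h] : exists2 A, F A & forall y, y \in (monalg.msupp z : seq Y) -> (A `|` T0) y.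
  by exists A => // y; rewrite monalg.mcoeff_neq0; exact: h.
have : forall y, y \in (monalg.msupp z : seq Y) -> (\bigcup_(X in F) X `|` T0) y.
  by move=> y yz; apply: sz; rewrite monalg.mcoeff_neq0.
elim: (monalg.msupp z : seq Y) => [|y s IH] h; first by exists A0.
have [|A FA hA] := IH; first by move=> y' y's; apply: h; rewrite inE y's orbT.
have [|[B FB By]|T0y] := h y; first by rewrite inE eqxx.
  have [AB|BA] := tot _ _ FA FB.
    exists B => // y'; rewrite inE => /orP[/eqP ->|/hA[/AB|]]; by [left|right].
  exists A => // y'; rewrite inE => /orP[/eqP ->|/hA //]; by left; apply: BA.
exists A => // y'; rewrite inE => /orP[/eqP ->|/hA //]; by right.
Qed.

(** Zorn's lemma runs over the sets [A] for which the union of [A] and [T0] is independent, rather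
    than over the sets containing [T0]: the empty chain has empty union, and that case is the
    independence of [T0]. *)
Lemma basis_extension T0 (Y1 : set Y) : indep T0 -> T0 `<=` Y1 ->
  exists T, [/\ T0 `<=` T, T `<=` Y1, indep T & forall y, Y1 y -> generated T (w y)].
Proof.
move=> i0 T01; pose P (A : set Y) := A `<=` Y1 /\ indep (A `|` T0).
have [F FP' tot|A [[AY iA] Amax]] := @Zorn_bigcup Y P.
  have FP B : F B -> B `<=` Y1 /\ indep (B `|` T0) by move=> /FP'.
  split=> [y [A FA Ay]|]; first by have [h _] := FP _ FA; exact: h.
  have [neF|nF] := pselect (exists A, F A).
    move=> z sz; have [A FA sA] := supported_chain tot neF sz.
    by have [_ h] := FP _ FA; exact: h.
  move=> z sz; apply: i0 => y /sz[[A FA _]|//]; by case: nF; exists A.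
have sT : A `|` T0 `<=` Y1 by move=> y [/AY|/T01].
exists (A `|` T0); split=> // y Yy.
have [Ty|nTy] := pselect ((A `|` T0) y).
  by exists << y >>; [exact: supportedU | rewrite mextU].
have : ~ P (A `|` [set y]).
  apply: Amax; split; first by move=> u; left.
  by move=> sub; apply: nTy; left; apply: sub; right.
apply: contra_notP => nG; split=> [u [/AY //|-> //]|z sz z0].
have zE : z = (z - monalg.mcoeff y z *: << y >>) + monalg.mcoeff y z *: << y >>.
  by rewrite subrK.
have sz' : supported (A `|` T0) (z - monalg.mcoeff y z *: << y >>).
  move=> u; rewrite monalg.mcoeffB monalg.mcoeffZ monalg.mcoeffU.
  have [->|yu] := eqVneq y u; first by rewrite mulr1n mulr1 subrr eqxx.
  rewrite mulr0n mulr0 subr0 => /sz[[?|uy]|?]; [by left| |by right].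
  by rewrite uy eqxx in yu.
have [a0|an0] := eqVneq (monalg.mcoeff y z) 0.
  by apply: iA => // u; move: (sz' u); rewrite a0 scale0r subr0.
(* A relation with nonzero coefficient at [y] is solved for [w y]. *)
case: nG; exists (- (monalg.mcoeff y z)^-1 *: (z - monalg.mcoeff y z *: << y >>)).
  by rewrite -[X in supported _ X]addr0; apply: supported_lin => // u;
    rewrite monalg.mcoeff0 eqxx.
rewrite (linfZ (mext_lin _)) (linfB (mext_lin _)) z0 sub0r (linfZ (mext_lin _)) mextU.
by rewrite scalerN scaleNr opprK scalerA mulVf ?scale1r.
Qed.

(** The basis is indexed by a subset [T] of the index type of a given family. Extending or
    intersecting bases then never changes the type [Y]. *)
Record coordinates T (c : E -> {malg K[Y]}) : Prop := Coordinates {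
  crd_lin : linear c;
  crd_supp : forall x, supported T (c x);
  crdK : forall x, mext w (c x) = x;
  crd_gen : forall y, T y -> c (w y) = << y >> }.

Lemma indep_inj T z z' : indep T -> supported T z -> supported T z' ->
  mext w z = mext w z' -> z = z'.
Proof.
move=> iT sz sz' e; apply/eqP; rewrite -subr_eq0; apply/eqP; apply: iT.
  by rewrite addrC -scaleN1r; apply: supported_lin.
by rewrite (linfB (mext_lin _)) e subrr.
Qed.

Lemma coordinates_exist T : indep T -> (forall x, generated T x) ->
  exists c, coordinates T c.
Proof.
move=> iT gT; pose c x := projT1 (cid2 (gT x)).
have sc x : supported T (c x) by rewrite /c; case: cid2.
have cK x : mext w (c x) = x by rewrite /c; case: cid2.
exists c; split=> // [a x y|y Ty].
  apply: (indep_inj iT) => //; first exact: supported_lin.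
  by rewrite mext_lin !cK.
apply: (indep_inj iT) => //; first exact: supportedU.
by rewrite cK mextU.
Qed.

Lemma generated_lspan T x : generated T x <-> lspan [set w y | y in T] x.
Proof.
split=> [[z sz <-]|].
  apply: lspan_sum => y yz _; apply/lspanZ/lspan_gen; exists y => //.
  by apply: sz; rewrite monalg.mcoeff_neq0.
elim/lspan_ind=> [|a _ x' [y Ty <-] [z sz <-]].
  exists 0; first by move=> y; rewrite monalg.mcoeff0 eqxx.
  by rewrite (linf0 (mext_lin _)).
exists (a *: << y >> + z); first by apply: supported_lin => //; apply: supportedU.
by rewrite mext_lin mextU.
Qed.
End Bases.

Section TensorCoordinates.
Variables (K : fieldType) (V : lmodType K) (Y : choiceType) (w : Y -> V).
Variables (T : set Y) (c : V -> {malg K[Y]}).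
Hypothesis hc : coordinates w T c.

(** The component at [y] under $V\otimes E\cong\bigoplus_{y\in T}E$. It commutes with [tmap], which
    is how properties of [E] are transported to $V\otimes E$ and back. *)
Definition tcrd (E : lmodType K) (y : Y) : tensor V E -> E :=
  tlift (fun v e => monalg.mcoeff y (c v) *: e).

Lemma tcrd_bilin (E : lmodType K) y :
  bilin (fun (v : V) (e : E) => monalg.mcoeff y (c v) *: e).
Proof.
split=> [e a v v'|v a e e'].
  by rewrite (crd_lin hc) monalg.mcoeffD monalg.mcoeffZ scalerDl scalerA.
by rewrite scalerDr !scalerA mulrC.
Qed.

Lemma tcrd_lin (E : lmodType K) y : linear (@tcrd E y).
Proof. exact/tlift_lin/tcrd_bilin. Qed.

Lemma tcrd_pure (E : lmodType K) y (v : V) (e : E) :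
  tcrd y (tpure v e) = monalg.mcoeff y (c v) *: e.
Proof. exact: (tlift_pure (tcrd_bilin E y)). Qed.

Lemma tcrd_gen (E : lmodType K) y y' (e : E) : T y' ->
  tcrd y (tpure (w y') e) = if y == y' then e else 0.
Proof.
move=> Ty; rewrite tcrd_pure (crd_gen hc) // monalg.mcoeffU eq_sym.
by case: eqP; rewrite ?scale1r ?scale0r.
Qed.

Lemma tcrd_map (E E' : lmodType K) (f : E -> E') y t : linear f ->
  tcrd y (tmap f t) = f (tcrd y t).
Proof.
move=> hf; move: t; apply: tensor_linP.
- by apply: lin_comp; [apply: tcrd_lin | apply: tmap_lin].
- by apply: lin_comp; last exact: tcrd_lin.
- by move=> v e; rewrite (tmap_pure hf) !tcrd_pure (linfZ hf).
Qed.

Lemma tcrd_sum (E : lmodType K) (t : tensor V E) :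
  exists D : {fset Y}, [/\ forall y, y \in D -> T y,
    forall y, y \notin D -> tcrd y t = 0 &
    t = \sum_(y <- D) tpure (w y) (tcrd y t)].
Proof.
suff [D DT tE] : exists2 D : {fset Y}, (forall y, y \in D -> T y) &
    exists u : Y -> E, t = \sum_(y <- D) tpure (w y) (u y).
  case: tE => u tE.
  have tcE y : tcrd y t = if y \in D then u y else 0.
    rewrite tE (linf_sum (tcrd_lin _)).
    under eq_big_seq => y' y'D do rewrite (tcrd_gen _ _ (DT _ y'D)).
    case: ifP => yD; last first.
      rewrite big_seq big1 // => y' y'D; case: eqP => // yy'.
      by rewrite yy' y'D in yD.
    rewrite (bigD1_seq y) //= eqxx big1 ?addr0 // => y'.
    by rewrite eq_sym => /negPf ->.
  exists D; split=> // [y /negPf yD|]; first by rewrite tcE yD.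
  by rewrite {1}tE; apply: eq_big_seq => y yD; rewrite tcE yD.
elim/lspan_ind: {t}(tensor_span t) => [|a x y [v [e ->]] [D DT [u ->]]].
  by exists fset0 => //; exists (fun=> 0); rewrite big_seq_fset0.
exists (monalg.msupp (c v) `|` D)%fset.
  move=> y'; rewrite inE => /orP[|/DT //].
  by rewrite -monalg.mcoeff_neq0; apply: (crd_supp hc).
exists (fun y' => (a * monalg.mcoeff y' (c v)) *: e + if y' \in D then u y' else 0).
under [RHS]eq_bigr => y' _ do rewrite tpureDr tpureZr -tpureZl.
rewrite big_split /=; congr (_ + _).
  rewrite -{1}[v](crdK hc) (mextEw _ (fsubsetUl (monalg.msupp (c v)) D)).
  rewrite (linf_sum (tpure_linl e)) scaler_sumr.
  by apply: eq_bigr => y' _; rewrite -scalerA (tpureZl a).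
transitivity (\sum_(y' <- D) tpure (w y') (if y' \in D then u y' else 0)).
  by apply: eq_big_seq => y' ->.
apply: (big_fset_incl _ (fsubsetUr (monalg.msupp (c v)) D)) => y' _ /negPf ->.
exact: (linf0 (tpure_linr _)).
Qed.
End TensorCoordinates.

(** * Polynomial actions and gradings *)

Section PolynomialFunctions.
Variables (K : numFieldType) (d : nat).
Implicit Types p q : mpoly d K.

(** Uniqueness of expansions in base [B]: reduce modulo [B], then divide by [B]. The digits are
    functions on [nat] so that the induction can shift them. *)
Lemma kronecker_eq0 (B k : nat) (m m' : nat -> nat) :
  (forall i, (i < k)%N -> (m i < B)%N) -> (forall i, (i < k)%N -> (m' i < B)%N) ->
  (\sum_(i < k) m i * B ^ i = \sum_(i < k) m' i * B ^ i)%N ->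
  forall i, (i < k)%N -> m i = m' i.
Proof.
elim: k m m' => [//|k IH] m m' hm hm'.
rewrite !big_ord_recl !expn0 !muln1.
have S (u : nat -> nat) : (\sum_(i < k) u (bump 0 i) * B ^ (bump 0 i) =
    (\sum_(i < k) u i.+1 * B ^ i) * B)%N.
  rewrite big_distrl; apply: eq_bigr => i _ /=.
  by rewrite /bump leq0n add1n expnSr mulnA.
rewrite !S => e; have e0 : m 0%N = m' 0%N.
  have /(congr1 (fun x => x %% B)%N) := e.
  by rewrite ![(_ + _ * B)%N]addnC !modnMDl !modn_small ?hm ?hm'.
move: e; rewrite e0 => /addnI e; case=> [//|i ik].
have B0 : (0 < B)%N by apply: leq_ltn_trans (hm 0%N _).
move/eqP: e; rewrite eqn_pmul2r // => /eqP e.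
by apply: (IH (fun i => m i.+1) (fun i => m' i.+1)) => // j jk; [apply: hm|apply: hm'].
Qed.

(* Kronecker substitution [X_i |-> t ^ (B ^ i)], with [B] larger than all exponents,
   separates the monomials of [p]. *)
Lemma mpoly_eq0_fun p : (forall v : 'I_d -> K, p.@[v] = 0) -> p = 0.
Proof.
move=> p0; pose B := (\max_(m <- msupp p) \max_(i < d) m i).+1.
have mB m i : m \in msupp p -> (m i < B)%N.
  move=> mp; rewrite ltnS; apply: leq_trans (leq_bigmax_seq _ mp isT).
  exact: (@leq_bigmax _ (fun i : 'I_d => m i : nat)).
pose ex (m : 'X_{1..d}) := (\sum_(i < d) m i * B ^ i)%N.
have exI : {in msupp p &, injective ex}.
  move=> m m' mp m'p e; apply/mnmP => i.
  pose u (m : 'X_{1..d}) j := if insub j is Some i then m (i : 'I_d) else 0%N.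
  have uE (m0 : 'X_{1..d}) (i0 : 'I_d) : u m0 i0 = m0 i0 by rewrite /u valK.
  have h m0 : m0 \in msupp p -> forall j, (j < d)%N -> (u m0 j < B)%N.
    by move=> m0p j jd; rewrite /u insubT; apply: mB.
  rewrite -!uE; apply: (kronecker_eq0 (h _ mp) (h _ m'p)) => //.
  rewrite (eq_bigr (fun i : 'I_d => m i * B ^ i)%N); last by move=> j _; rewrite uE.
  by rewrite [RHS](eq_bigr (fun i : 'I_d => m' i * B ^ i)%N) // => j _; rewrite uE.
pose P : {poly K} := \sum_(m <- msupp p) p@_m *: 'X^(ex m).
have Pe t : P.[t] = 0.
  rewrite -(p0 (fun i => t ^+ (B ^ i))) mevalE /P horner_sum.
  apply: eq_bigr => m _; rewrite hornerZ hornerXn; congr (_ * _).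
  under [RHS]eq_bigr => i _ do rewrite -exprM mulnC.
  by rewrite prodrXr.
(* In characteristic zero the integers below [size P] are distinct roots, too many for a nonzero
   polynomial of that size. *)
have P0 : P = 0.
  apply/eqP; apply/negPn/negP => Pn0.
  suff : (size P < size P)%N by rewrite ltnn.
  rewrite -{1}(size_iota 0 (size P)) -(size_map (fun i => i%:R : K)).
  apply: (max_poly_roots Pn0).
    by apply/allP => t _; apply/rootP; apply: Pe.
  rewrite map_inj_in_uniq ?iota_uniq // => i j _ _ /eqP.
  by rewrite eqr_nat => /eqP.
apply/mpolyP => m; rewrite mcoeff0.
have [mp|/memN_msupp_eq0 //] := boolP (m \in msupp p).
have := congr1 (fun q : {poly K} => q`_(ex m)) P0.
rewrite coef0 /P coef_sum (bigD1_seq m) ?msupp_uniq //= coefZ coefXn eqxx mulr1.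
rewrite big_seq_cond big1 ?addr0 // => m' /andP[m'p m'm].
rewrite coefZ coefXn; case: eqP => [e|_]; last by rewrite mulr0.
by rewrite (exI _ _ m'p mp (esym e)) eqxx in m'm.
Qed.

End PolynomialFunctions.

Section PolynomialAction.
Variables (K : fieldType) (d : nat).
Implicit Types (E : lmodType K) (p q : mpoly d K).

Lemma mpoly_linP E (f g : mpoly d K -> E) : linear f -> linear g ->
  (forall m, f 'X_[m] = g 'X_[m]) -> f =1 g.
Proof.
move=> hf hg fg; apply: mpolyind => [|c m p _ _ h].
  by rewrite (linf0 hf) (linf0 hg).
by rewrite hf hg fg h.
Qed.

Lemma mon_act0 E (X : 'I_d -> E -> E) x : mon_act X 0%MM x = x.
Proof. by rewrite /mon_act; elim: (enum _) => //= i s ->; rewrite mnm0E. Qed.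

Lemma mon_actS E (X : 'I_d -> E -> E) i m x :
  (forall i j x, X i (X j x) = X j (X i x)) ->
  mon_act X (U_(i) + m)%MM x = X i (mon_act X m x).
Proof.
move=> XC; rewrite /mon_act.
suff h s : uniq s -> foldr (fun j y => iter ((U_(i) + m)%MM j) (X j) y) x s =
    let y := foldr (fun j y => iter (m j) (X j) y) x s in
    if i \in s then X i y else y by rewrite h ?enum_uniq //= mem_enum.
elim: s => [//|j s IH] /= /andP[js us]; rewrite IH //= mnmDE mnm1E inE.
have [ij|ij] := eqVneq i j; first by rewrite ij (negPf js) add1n.
rewrite add0n /=; case: (i \in s) => //.
by elim: (m j) => //= k ->; rewrite XC.
Qed.

Lemma mon_act_map E (E' : lmodType K) (X : 'I_d -> E -> E) (X' : 'I_d -> E' -> E')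
  (f : E -> E') m x : (forall i x, f (X i x) = X' i (f x)) ->
  f (mon_act X m x) = mon_act X' m (f x).
Proof.
move=> fX; rewrite /mon_act; elim: (enum _) => //= i s <-.
by elim: (m i) => //= k <-; rewrite fX.
Qed.

Variables (E : lmodType K) (X : 'I_d -> E -> E).

Lemma poly_actEw p x (D : seq 'X_{1..d}) : uniq D -> {subset mpoly.msupp p <= D} ->
  poly_act X p x = \sum_(m <- D) mpoly.mcoeff m p *: mon_act X m x.
Proof.
move=> uD sD; rewrite [RHS](bigID (fun m => m \in mpoly.msupp p)) /=.
rewrite [X in _ + X]big1 ?addr0; last by move=> m /memN_msupp_eq0 ->; rewrite scale0r.
rewrite -big_filter /poly_act; apply: perm_big; apply: uniq_perm.
- exact: msupp_uniq.
- exact: filter_uniq.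
- by move=> m; rewrite mem_filter; case: (boolP (m \in _)) => //= /sD ->.
Qed.

Lemma poly_act_linl x : linear (fun p => poly_act X p x).
Proof.
move=> a p q.
pose D := undup (mpoly.msupp p ++ mpoly.msupp q ++ mpoly.msupp (a *: p + q)).
have uD : uniq D by apply: undup_uniq.
have sD (s : seq 'X_{1..d}) :
    {subset s <= mpoly.msupp p ++ mpoly.msupp q ++ mpoly.msupp (a *: p + q)} ->
    {subset s <= D} by move=> h m /h; rewrite mem_undup.
rewrite !(@poly_actEw _ x D) //; try by apply: sD => m; rewrite !mem_cat => ->; rewrite ?orbT.
rewrite scaler_sumr -big_split; apply: eq_bigr => m _ /=.
by rewrite mcoeffD mcoeffZ scalerDl scalerA.
Qed.

Lemma poly_actX m x : poly_act X 'X_[m] x = mon_act X m x.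
Proof. by rewrite /poly_act msuppX big_seq1 mcoeffX eqxx scale1r. Qed.

Lemma poly_act1 x : poly_act X 1 x = x.
Proof. by rewrite -mpolyX0 poly_actX mon_act0. Qed.

Lemma poly_actXM i p x : (forall i, linear (X i)) ->
  (forall i j x, X i (X j x) = X j (X i x)) ->
  poly_act X ('X_i * p) x = X i (poly_act X p x).
Proof.
move=> hX XC; move: p; apply: mpoly_linP.
- by move=> a p q; rewrite mulrDr -scalerAr poly_act_linl.
- by apply: lin_comp => //; apply: poly_act_linl.
by move=> m; rewrite -mpolyXD !poly_actX mon_actS.
Qed.

(** The polynomial ring is free of rank one over itself, so a map compatible with the variables is
    determined by the image of [1]. *)
Lemma poly_act_uniq (Phi : mpoly d K -> E) : linear Phi ->
  (forall i p, Phi ('X_i * p) = X i (Phi p)) ->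
  forall p, Phi p = poly_act X p (Phi 1).
Proof.
move=> hP PX; apply: mpoly_linP => // [|m]; first exact: poly_act_linl.
rewrite poly_actX mpolyXE_id -big_enum /mon_act /=.
elim: (enum _) => [|i s IH]; rewrite ?big_nil // big_cons /= -IH.
by elim: (m i) => [|k IHk]; rewrite ?expr0 ?mul1r //= exprS -mulrA PX IHk.
Qed.

Lemma poly_act_map (E' : lmodType K) (X' : 'I_d -> E' -> E') (f : E -> E') p x :
  linear f -> (forall i x, f (X i x) = X' i (f x)) ->
  f (poly_act X p x) = poly_act X' p (f x).
Proof.
move=> hf fX; rewrite (linf_sum hf); apply: eq_bigr => m _.
by rewrite (linfZ hf) (mon_act_map _ _ fX).
Qed.
End PolynomialAction.

(** Take rows in [W] of maximal rank: appending another vector of [W] cannot raise the rank, hence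
    it already lies in the row space. *)
Lemma lspan_row_space (K : fieldType) d (W : set 'rV[K]_d) : lspan W `<=` W ->
  exists k (M : 'M[K]_(k, d)), forall w, W w <-> (w <= M)%MS.
Proof.
move=> WW.
have W0 : W 0 by apply: WW; apply: lspan0.
pose P r := `[< exists k (M : 'M[K]_(k, d)), (forall i, W (row i M)) /\ \rank M = r >].
have P0 : exists r, P r.
  exists 0%N; apply/asboolP; exists 0%N, 0; split; first by case.
  by rewrite mxrank0.
have Pub r : P r -> (r <= d)%N by move=> /asboolP [k [M [_ <-]]]; apply: rank_leq_col.
case: (ex_maxnP P0 Pub) => r /asboolP [k [M [WM rM]]] rmax.
exists k, M => w; split=> [Ww|/submxP[a ->]]; last first.
  apply: WW; rewrite mulmx_sum_row; apply: lspan_sum => i _ _.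
  by apply/lspanZ/lspan_gen.
have : P (\rank (col_mx M w)).
  apply/asboolP; exists (k + 1)%N, (col_mx M w); split=> // i.
  rewrite -(splitK i); case: (fintype.split i) => j /=.
    by rewrite rowKu.
  by rewrite rowKd (ord1 j); have -> : row 0 w = w by apply/rowP => l; rewrite mxE.
move=> /rmax; rewrite -rM => le.
have sM : (M <= col_mx M w)%MS by rewrite -addsmxE addsmxSl.
have := mxrank_leqif_sup sM; move=> [_ /esym]; rewrite eqn_leq le mxrankS // => h.
by apply: submx_trans h; rewrite -addsmxE addsmxSr.
Qed.

Lemma poly_act_vanish (K : numFieldType) d (E : lmodType K) (X : 'I_d -> E -> E)
    (W : set 'rV[K]_d) (p : mpoly d K) : lspan W `<=` W ->
  (forall i, linear (X i)) -> (forall i j x, X i (X j x) = X j (X i x)) ->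
  (forall l : 'rV[K]_d, (forall y, W y -> dot l y = 0) ->
     forall x, \sum_i l 0 i *: X i x = 0) ->
  (forall y : 'rV[K]_d, W y -> p.@[fun j => y 0 j] = 0) ->
  forall x, poly_act X p x = 0.
Proof.
move=> WW hX XC Xvan pvan x.
have [k [M WM]] := lspan_row_space WW.
pose Pr := pinvmx M *m M.
pose lq : d.-tuple (mpoly d K) := [tuple \sum_i Pr i j *: 'X_i | j < d].
have XE j y : X j y = \sum_i Pr i j *: X i y.
  pose l : 'rV[K]_d := \row_i ((i == j)%:R - Pr i j).
  have /Xvan/(_ y) : forall y, W y -> dot l y = 0.
    move=> z /WM zM; rewrite /dot.
    under eq_bigr => i _ do rewrite mxE mulrBl.
    rewrite sumrB (bigD1 j) //= eqxx mul1r big1 ?addr0; last first.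
      by move=> i /negPf ->; rewrite mul0r.
    have := mulmxKpV zM; rewrite -mulmxA -/Pr => /rowP/(_ j).
    rewrite mxE => <-; apply/eqP; rewrite subr_eq0; apply/eqP.
    by apply: eq_bigr => i _; rewrite mulrC.
  under eq_bigr => i _ do rewrite mxE scalerBl.
  rewrite sumrB (bigD1 j) //= eqxx scale1r big1 ?addr0; last first.
    by move=> i /negPf ->; rewrite scale0r.
  by move/eqP; rewrite subr_eq0 => /eqP.
have -> : poly_act X p x = poly_act X (p \mPo lq) x.
  have h : linear (fun p => poly_act X (p \mPo lq) x).
    by move=> a q q'; rewrite comp_mpolyD comp_mpolyZ poly_act_linl.
  rewrite (poly_act_uniq (X := X) h) ?comp_mpoly1 ?poly_act1 // => i q.
  rewrite rmorphM /= comp_mpolyXU -tnth_nth tnth_mktuple XE mulr_suml.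
  have hl := poly_act_linl X x; rewrite (linf_sum hl); apply: eq_bigr => j _.
  by rewrite -scalerAl (linfZ hl) poly_actXM.
suff -> : p \mPo lq = 0 by rewrite (linf0 (poly_act_linl X x)).
apply: mpoly_eq0_fun => v; rewrite comp_mpoly_meval.
have := pvan ((\row_i v i) *m Pr); rewrite WM => <-; last by rewrite mulmxA submxMl.
apply: meval_eq => j; rewrite tnth_mktuple raddf_sum /= mxE.
apply: eq_bigr => i _; rewrite mevalZ mevalXU mulrC; congr (_ * _).
by rewrite mxE.
Qed.

Section Gradings.
Variables (K : fieldType) (E : lmodType K) (T : eqType) (H : T -> set E).

Definition pickable := forall (I : eqType) (r : seq I) (z : I -> E) (e : I -> T) t x,
  (forall i, i \in r -> H (e i) (z i)) -> H t x -> x = \sum_(i <- r) z i ->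
  x = \sum_(i <- r | e i == t) z i.

Hypothesis gH : is_grading H.

Lemma hom_lin t a x y : H t x -> H t y -> H t (a *: x + y).
Proof.
case: gH => h _ _ hx hy; apply: h; apply: lspan_lin; exact: lspan_gen.
Qed.
Lemma hom0 t : H t 0. Proof. by case: gH => h _ _; apply: h; apply: lspan0. Qed.
Lemma hom_sum (I : eqType) (r : seq I) (P : pred I) (F : I -> E) t :
  (forall i, i \in r -> P i -> H t (F i)) -> H t (\sum_(i <- r | P i) F i).
Proof.
case: gH => h _ _ hF; apply: h; apply: lspan_sum => i ir Pi.
by apply: lspan_gen; apply: hF.
Qed.

(** The terms are grouped by degree and [x] is subtracted in degree [t]; the groups sum to zero, so
    each of them vanishes. The degree [t] is put into the list [D] because no term need have it. *)
Lemma grading_pickable : pickable.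
Proof.
move=> I r z e t x hz hx xE.
pose D := undup (t :: map e r).
pose y s := \sum_(i <- r | e i == s) z i - (if s == t then x else 0).
have hy s : H s (y s).
  rewrite /y addrC -scaleN1r; apply: hom_lin; first by case: eqP => [->|_] //; apply: hom0.
  by apply: hom_sum => i /hz + /eqP <-.
case: gH => _ _ /(_ D y (undup_uniq _) hy) h.
have tD : t \in D by rewrite mem_undup inE eqxx.
have /h/(_ t tD) : \sum_(s <- D) y s = 0.
  rewrite sumrB [X in _ - X](bigD1_seq t) ?undup_uniq //= eqxx.
  rewrite [X in _ - (_ + X)]big1 ?addr0 => [|s /negPf -> //].
  rewrite (exchange_big_dep predT) //= xE; apply/eqP; rewrite subr_eq0; apply/eqP.
  apply: eq_big_seq => i ir; under eq_bigl => s do rewrite eq_sym.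
  rewrite big_mkcond (bigD1_seq (e i)) ?undup_uniq //=; last first.
    by rewrite mem_undup inE map_f ?orbT.
  by rewrite eqxx big1 ?addr0 // => s /negPf ->.
by rewrite /y eqxx => /eqP; rewrite subr_eq0 => /eqP ->.
Qed.

Lemma homog_decomp x : exists (D : seq T) (y : T -> E),
  (forall t, H t (y t)) /\ x = \sum_(t <- D) y t.
Proof. by case: gH => _ h _; apply: h. Qed.

End Gradings.

(** * Rational cones *)

Section Dot.
Variables (K : fieldType) (d : nat).
Implicit Types x y : 'rV[K]_d.

Lemma dotC x y : dot x y = dot y x.
Proof. by apply: eq_bigr => i _; rewrite mulrC. Qed.
Lemma dot_linr x : linear (dot x : 'rV[K]_d -> K^o).
Proof.
move=> a y z; rewrite /dot scaler_sumr -big_split; apply: eq_bigr => i _ /=.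
by rewrite !mxE mulrDr mulrCA.
Qed.
Lemma dotDr x y z : dot x (y + z) = dot x y + dot x z.
Proof. exact: (linfD (dot_linr x)). Qed.
Lemma dotZr a x y : dot x (a *: y) = a * dot x y.
Proof. exact: (linfZ (dot_linr x)). Qed.
Lemma dotNr x y : dot x (- y) = - dot x y.
Proof. exact: (linfN (dot_linr x)). Qed.
Lemma dotBr x y z : dot x (y - z) = dot x y - dot x z.
Proof. exact: (linfB (dot_linr x)). Qed.
Lemma dot0r x : dot x 0 = 0. Proof. exact: (linf0 (dot_linr x)). Qed.
Lemma dot_sumr x I (r : seq I) (P : pred I) (F : I -> 'rV[K]_d) :
  dot x (\sum_(i <- r | P i) F i) = \sum_(i <- r | P i) dot x (F i).
Proof. exact: (linf_sum (dot_linr x)). Qed.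
Lemma dotDl x y z : dot (x + y) z = dot x z + dot y z.
Proof. by rewrite ![dot _ z]dotC dotDr. Qed.
Lemma dotZl a x y : dot (a *: x) y = a * dot x y.
Proof. by rewrite ![dot _ y]dotC dotZr. Qed.
Lemma dotBl x y z : dot (x - y) z = dot x z - dot y z.
Proof. by rewrite ![dot _ z]dotC dotBr. Qed.
Lemma dot0l x : dot 0 x = 0. Proof. by rewrite dotC dot0r. Qed.
Lemma dot_suml y I (r : seq I) (P : pred I) (F : I -> 'rV[K]_d) :
  dot (\sum_(i <- r | P i) F i) y = \sum_(i <- r | P i) dot (F i) y.
Proof. by rewrite dotC dot_sumr; apply: eq_bigr => i _; rewrite dotC. Qed.
Lemma dot_delta i y : dot (delta_mx 0 i) y = y 0 i.
Proof.
rewrite /dot (bigD1 i) //= mxE !eqxx mul1r big1 ?addr0 // => j /negPf ji.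
by rewrite mxE ji andbF mul0r.
Qed.
End Dot.

Section ConvexCones.
Variables (R : realType) (d : nat).
Local Notation V := 'rV[R]_d.
Implicit Types (A sigma tau : set V) (s : seq V).

Lemma conic0 A : conic_hull A 0.
Proof. by exists 0%N, (fun=> 0), (fun=> 0); split=> [[]|[]|] //; rewrite big_ord0. Qed.

Lemma conicD A x y : conic_hull A x -> conic_hull A y -> conic_hull A (x + y).
Proof.
move=> [k [a [p [a0 Ap ->]]]] [l [b [q [b0 Aq ->]]]]; exists (k + l)%N.
exists (fun i => match fintype.split i with inl i => a i | inr j => b j end).
exists (fun i => match fintype.split i with inl i => p i | inr j => q j end).
split=> [i|i|]; try by case: (fintype.split i).
rewrite big_split_ord /=; congr (_ + _); apply: eq_bigr => i _.
  by have /= -> := unsplitK (inl i : 'I_k + 'I_l).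
by have /= -> := unsplitK (inr i : 'I_k + 'I_l).
Qed.

Lemma conicZ A a x : 0 <= a -> conic_hull A x -> conic_hull A (a *: x).
Proof.
move=> a0 [k [b [p [b0 Ap ->]]]]; exists k, (fun i => a * b i), p.
split=> // [i|]; first by apply: mulr_ge0.
by rewrite scaler_sumr; apply: eq_bigr => i _; rewrite scalerA.
Qed.

Lemma conic_gen A x : A x -> conic_hull A x.
Proof.
by move=> Ax; exists 1%N, (fun=> 1), (fun=> x); split=> //; rewrite big_ord1 scale1r.
Qed.

Lemma conic_sum A (I : eqType) (r : seq I) (F : I -> V) :
  (forall i, i \in r -> conic_hull A (F i)) -> conic_hull A (\sum_(i <- r) F i).
Proof.
move=> h; rewrite big_seq; elim/big_ind: _ => [|x y|i /h //].
  exact: conic0.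
exact: conicD.
Qed.

Lemma conic_ind A (P : V -> Prop) : P 0 -> (forall a x y, 0 <= a -> A x ->
  conic_hull A y -> P y -> P (a *: x + y)) -> forall x, conic_hull A x -> P x.
Proof.
move=> P0 PD x [k [a [v [a0 Av ->]]]].
elim: k a v a0 Av => [|k IH] a v a0 Av; first by rewrite big_ord0.
rewrite big_ord_recl; apply: PD => //; last by apply: IH.
by apply: conic_sum => i _; apply: conicZ => //; apply: conic_gen.
Qed.

Lemma conic_sub A (B : set V) : A `<=` conic_hull B -> conic_hull A `<=` conic_hull B.
Proof.
move=> AB; apply: conic_ind => [|a x y a0 /AB Bx _ By]; first exact: conic0.
by apply: conicD => //; apply: conicZ.
Qed.

Lemma conic_cons p s x : conic_hull [set` p :: s] x ->
  exists a z, [/\ 0 <= a, conic_hull [set` s] z & x = a *: p + z].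
Proof.
elim/conic_ind=> [|a y z a0 ys _ [b [w [b0 hw ->]]]].
  by exists 0, 0; split=> //; [apply: conic0 | rewrite scale0r addr0].
move: ys; rewrite /= inE => /orP[/eqP ->|ys].
  by exists (a + b), w; split=> //; [apply: addr_ge0 | rewrite scalerDl addrA].
exists b, (a *: y + w); split=> //; last by rewrite addrCA.
by apply: conicD => //; apply: conicZ => //; apply: conic_gen.
Qed.

Lemma conic_dot_ge0 A y x : (forall p, A p -> 0 <= dot y p) ->
  conic_hull A x -> 0 <= dot y x.
Proof.
move=> h; elim/conic_ind=> [|a p z a0 /h hp _ hz]; first by rewrite dot0r.
by rewrite dotDr dotZr addr_ge0 // mulr_ge0.
Qed.

(** Induction on the number of generators. A form [y] that separates [b] from [s] can only fail
    because it is negative on the new generator [p]; then everything is projected along [p] to the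
    hyperplane orthogonal to [y], which leaves one generator fewer. *)
Lemma farkas s b : conic_hull [set` s] b \/
  exists y : V, (forall p, p \in s -> 0 <= dot y p) /\ dot y b < 0.
Proof.
have [k] := ubnP (size s); elim: k s b => // k IH [|p s] b.
  move=> _; have [->|b0] := eqVneq b 0; first by left; apply: conic0.
  right; exists (- b); split=> //; rewrite dotC dotNr oppr_lt0.
  have [j bj] : exists j, b 0 j != 0.
    apply/existsP; apply: contraNT b0 => /existsPn h; apply/eqP/rowP => j.
    by rewrite mxE; apply/eqP/negPn/h.
  rewrite /dot (bigD1 j) //= ltr_pwDl //; last first.
    by apply: sumr_ge0 => i _; rewrite -expr2 sqr_ge0.
  by rewrite -expr2 lt_def sqrf_eq0 bj sqr_ge0.
rewrite /= ltnS => sk; have [hb|[y [ys yb]]] := IH s b sk.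
  by left; apply: conic_sub hb => q qs; apply: conic_gen; rewrite /= inE qs orbT.
have [yp|yp] := leP 0 (dot y p).
  by right; exists y; split=> // q; rewrite inE => /orP[/eqP ->|/ys].
(* Since [dot y p] and [dot y b] are negative and [dot y q] is nonnegative on [s], undoing the
   projection only adds nonnegative multiples of [p]. *)
pose hat (v : V) := v - (dot y v / dot y p) *: p.
have := IH (map hat s) (hat b); rewrite size_map => /(_ sk) [hb|[z [zs zb]]].
  left; rewrite -[b](subrK ((dot y b / dot y p) *: p)).
  apply: conicD; last first.
    apply: conicZ; last by apply: conic_gen; rewrite /= mem_head.
    by rewrite mulr_le0 ?invr_le0 ?ltW.
  apply: conic_sub hb => _ /= /mapP[q qs ->]; rewrite /hat -scaleNr.
  apply: conicD; first by apply: conic_gen; rewrite /= inE qs orbT.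
  apply: conicZ; last by apply: conic_gen; rewrite /= mem_head.
  by rewrite -mulrN mulr_ge0 ?ys // oppr_ge0 invr_le0 ltW.
right; exists (z - (dot z p / dot y p) *: y).
have zE v : dot (z - (dot z p / dot y p) *: y) v = dot z (hat v).
  by rewrite dotBl dotZl /hat dotBr dotZr; field; rewrite lt_eqF.
split=> [q|]; rewrite zE //; rewrite inE => /orP[/eqP ->|qs].
  by rewrite /hat divff ?lt_eqF // scale1r subrr dot0r.
by apply: zs; apply: map_f.
Qed.

Lemma face_sub tau sigma : is_face tau sigma -> tau `<=` sigma.
Proof. by move=> [y [_ ->]] x []. Qed.

(** From an interior point [x] one may move slightly in the direction [- z] for any [z] of the cone.
    If the supporting form [y] vanishes at [x], it is then at most zero at [z], hence zero. *)
Lemma relint_no_face sigma tau x : relint sigma x -> (forall z, sigma z -> sigma (x + z)) ->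
  is_face tau sigma -> tau x -> tau = sigma.
Proof.
move=> [sx [e e0 he]] sD [y [y0 tE]] tx; apply/seteqP; split.
  by rewrite tE => z [].
move=> z sz; rewrite tE; split=> //.
have yx : dot y x = 0 by move: tx; rewrite tE => -[].
pose B := 1 + \sum_i `|z 0 i|; have B0 : 0 < B by rewrite ltr_pwDl ?sumr_ge0.
have : sigma (x - (e / 2 / B) *: z).
  apply: he => [|i]; first by apply: lspanB; [|apply: lspanZ]; apply: lspan_gen.
  rewrite !mxE addrAC subrr add0r normrN normrM gtr0_norm ?divr_gt0 ?mulr_gt0 //.
  rewrite mulrAC ltr_pdivrMr //.
  have zB : `|z 0 i| <= B.
    by rewrite /B (bigD1 i) //= addrCA lerDl addr_ge0 // sumr_ge0.
  by have := ler_wpM2l (ltW e0) zB; nra.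
move=> /y0; rewrite dotBr yx sub0r dotZr oppr_ge0 pmulr_rle0 ?divr_gt0 ?mulr_gt0 // => h.
by apply/eqP; rewrite eq_le h y0.
Qed.

(** If [x] lies on no proper face, some positive multiple of each generator can be subtracted from
    [x] without leaving the cone. This leaves room for every small displacement in the span, written
    in the generators. *)
Lemma no_face_relint s x : let sigma := conic_hull [set` s] in sigma x ->
  (forall tau, is_face tau sigma -> tau x -> tau = sigma) -> relint sigma x.
Proof.
move=> sigma sx nf.
have step p : p \in s -> exists2 t, 0 < t & sigma (x - t *: p).
  move=> ps; have sp : sigma p by apply: conic_gen.
  (* A separating form here would be nonnegative on the cone, zero at [x] and positive at [p], and
     so would expose a proper face through [x]. *)
  have [h|[y [ys yp]]] := farkas (- x :: s) (- p).
    have [t [z [t0 sz /(canRL (@opprK _)) pE]]] := conic_cons h.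
    have [t00|tn0] := eqVneq t 0.
      exists 1 => //; rewrite scale1r pE t00 scale0r add0r opprK.
      exact: conicD.
    have tp : 0 < t by rewrite lt_def tn0.
    exists t^-1; rewrite ?invr_gt0 // pE opprD scalerDr scalerN !scalerN opprK.
    rewrite scalerA mulVf // scale1r opprD addrA subrr sub0r opprK.
    by apply: conicZ => //; rewrite invr_ge0.
  have yx : dot y x = 0.
    have := ys (- x); rewrite mem_head => /(_ isT); rewrite dotNr oppr_ge0 => h.
    apply/eqP; rewrite eq_le h /=; apply: conic_dot_ge0 sx => q qs.
    by apply: ys; rewrite inE qs orbT.
  have fy : is_face [set z | sigma z /\ dot y z = 0] sigma.
    exists y; split=> // z; apply: conic_dot_ge0 => q qs.
    by apply: ys; rewrite inE qs orbT.
  have E := nf _ fy (conj sx yx).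
  have [_ yp0] : [set z | sigma z /\ dot y z = 0] p by rewrite E.
  by move: yp; rewrite dotNr yp0 oppr0 ltxx.
have shrink t t' p : 0 < t -> 0 <= t' <= t -> sigma (x - t *: p) -> sigma (x - t' *: p).
  move=> t0 /andP[t'0 t't] h.
  have -> : x - t' *: p = (1 - t' / t) *: x + (t' / t) *: (x - t *: p).
    rewrite scalerBr scalerA divfK ?gt_eqF // scalerBl scale1r.
    by rewrite addrA subrK.
  apply: conicD; apply: conicZ => //; last by rewrite divr_ge0 // ltW.
  by rewrite subr_ge0 ler_pdivrMr // mul1r.
have [t t0 ht] : exists2 t, 0 < t & forall p, p \in s -> sigma (x - t *: p).
  have : forall p, p \in s -> p \in s by [].
  elim: {-2}s => [|p l IH] ls; first by exists 1.
  have [|t t0 ht] := IH; first by move=> q ql; apply: ls; rewrite inE ql orbT.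
  have [|t' t'0 ht'] := step p; first by apply: ls; apply: mem_head.
  exists (Num.min t t'); first by rewrite lt_min t0.
  move=> q; rewrite inE => /orP[/eqP ->|/ht h].
    by apply: shrink ht' => //; rewrite le_min ge_min (ltW t0) (ltW t'0) lexx orbT.
  by apply: shrink h => //; rewrite le_min ge_min (ltW t0) (ltW t'0) lexx.
split=> //; pose k := size s.
pose A : 'M[R]_(k, d) := \matrix_(i < k) s`_i.
have rA (i : 'I_k) : s`_i \in s by apply: mem_nth.
have sA y : lspan sigma y -> (y <= A)%MS.
  elim/lspan_ind=> [|a p z sp hz]; first exact: sub0mx.
  apply: addmx_sub => //; apply: scalemx_sub.
  elim/conic_ind: sp => [|b q w _ qs _ hw]; first exact: sub0mx.
  apply: addmx_sub => //; apply: scalemx_sub.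
  have iq : (index q s < k)%N by rewrite index_mem.
  have -> : q = row (Ordinal iq) A by rewrite rowK /= nth_index.
  exact: row_sub.
(* [B] bounds the coefficients, in the generators, of a displacement in terms of its coordinates;
   the [1] keeps it positive. *)
pose B := 1 + \sum_j \sum_i `|pinvmx A j i|.
have B0 : 0 < B by rewrite ltr_pwDl ?sumr_ge0 // => j _; apply: sumr_ge0.
exists (t / k.+1%:R / B); first by rewrite !divr_gt0.
move=> y /sA yA xy; pose w := y - x.
have wA : (w <= A)%MS by rewrite addmx_sub // eqmx_opp; apply/sA/lspan_gen.
pose c := w *m pinvmx A.
have wE : w = \sum_(i < k) c 0 i *: s`_i.
  by rewrite -(mulmxKpV wA) mulmx_sum_row; apply: eq_bigr => i _; rewrite rowK.
have cB i : `|c 0 i| <= t / k.+1%:R.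
  rewrite mxE (le_trans (ler_norm_sum _ _ _)) //.
  apply: (@le_trans _ _ (\sum_j t / k.+1%:R / B * `|pinvmx A j i|)).
    apply: ler_sum => j _; rewrite normrM ler_wpM2r //.
    by have := ltW (xy j); rewrite /w !mxE.
  rewrite -mulr_sumr -mulrA ler_piMr ?divr_ge0 ?ltW // mulrC ltr_pdivrMr // mul1r.
  apply: (@le_lt_trans _ _ (\sum_j \sum_i `|pinvmx A j i|)); last by rewrite /B ltrDr.
  by apply: ler_sum => j _; rewrite (bigD1 i) //= lerDl sumr_ge0.
(* The point [x] is shared equally among [k.+1] summands, one per generator and a spare one. Each
   generator then carries its coefficient times [k.+1], which is at most [t] in absolute value. *)
have -> : y = k.+1%:R^-1 *: x + \sum_(i < k) k.+1%:R^-1 *: (x + (k.+1%:R * c 0 i) *: s`_i).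
  under eq_bigr => i _ do rewrite scalerDr scalerA mulrA mulVf ?pnatr_eq0 // mul1r.
  rewrite big_split /= -wE sumr_const card_ord -scaler_nat scalerA addrA -scalerDl.
  have -> : k.+1%:R^-1 + k%:R * k.+1%:R^-1 = 1 :> R.
    by rewrite -{1}[_^-1]mul1r -mulrDl -(natrD _ 1 k) divff ?pnatr_eq0.
  by rewrite scale1r /w addrC subrK.
apply: conicD; first by apply: conicZ => //; rewrite invr_ge0.
apply: conic_sum => i _; apply: conicZ; first by rewrite invr_ge0.
have [c0|c0] := leP 0 (c 0 i).
  apply: conicD => //; apply: conicZ; first exact: mulr_ge0.
  by apply: conic_gen; apply: rA.
rewrite -[_ *: _]opprK -scaleNr; apply: (shrink t) => //; last exact: ht.
have := cB i; rewrite ltr0_norm // ler_pdivlMr // => h.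
by rewrite oppr_ge0 nmulr_lle0 // ler0n /= -mulrN mulrC.
Qed.

(* With a generating set of minimal size, no generator lies in the cone of the
   others, and Farkas' lemma then exposes each generator as a face. *)
Lemma cone_rays sigma : rational_cone sigma -> strongly_convex sigma ->
  exists s : seq 'rV[int]_d, sigma = conic_hull [set realpt R m | m in [set` s]] /\
    forall m, m \in s -> m != 0 /\ is_face (conic_hull [set realpt R m]) sigma.
Proof.
move=> rat sc.
pose P k := `[< exists s : seq 'rV[int]_d, size s = k /\
   sigma = conic_hull [set realpt R m | m in [set` s]] >].
have exP : exists k, P k by case: rat => s sE; exists (size s); apply/asboolP; exists s.
have [k /asboolP[s [sk sE]] kmin] := ex_minnP exP.
have imE (l : seq 'rV[int]_d) : [set realpt R m | m in [set` l]] = [set` map (@realpt R d) l].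
  by apply/seteqP; split=> [_ [m /= ml <-]|x /= /mapP[m ml ->]]; [apply: map_f|exists m].
have sE' m : m \in s -> sigma = conic_hull [set` realpt R m :: map (@realpt R d) (rem m s)].
  move=> ms; rewrite sE imE; congr conic_hull; apply/seteqP.
  have E := perm_mem (perm_to_rem ms).
  split=> x /= => [/mapP[u]|]; first rewrite E => um ->.
    by rewrite -[_ :: _]/(map (@realpt R d) (m :: rem m s)) map_f.
  rewrite -[_ :: _]/(map (@realpt R d) (m :: rem m s)) => /mapP[u um ->].
  by rewrite map_f // E.
have pnot m : m \in s -> ~ conic_hull [set` map (@realpt R d) (rem m s)] (realpt R m).
  move=> ms hp; have /kmin : P (size (rem m s)).
    apply/asboolP; exists (rem m s); split=> //; rewrite imE (sE' _ ms).
    apply/seteqP; split; apply: conic_sub => x /=; last first.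
      by move=> xs; apply: conic_gen; rewrite /= inE xs orbT.
    by rewrite inE => /orP[/eqP ->//|xs]; apply: conic_gen.
  by rewrite size_rem // -sk; case: (s) ms => //= a l _; rewrite ltnn.
have pn0 m : m \in s -> realpt R m != 0.
  by move=> /pnot h; apply/eqP => m0; apply: h; rewrite m0; apply: conic0.
exists s; split=> // m ms; pose p := realpt R m.
pose s' := map (@realpt R d) (rem m s); have {}sE' := sE' _ ms; have {}pnot := pnot _ ms.
have ss x : conic_hull [set` s'] x -> sigma x.
  by rewrite sE'; apply: conic_sub => q qs; apply: conic_gen; rewrite /= inE qs orbT.
have sp : sigma p by rewrite sE'; apply: conic_gen; rewrite /= mem_head.
split.
  apply: contraNneq (pn0 _ ms) => ->; apply/eqP.
  by apply/rowP => i; rewrite !mxE.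
(* Otherwise Farkas' lemma gives a relation [(t - a) *: p = q + w] with [w] in the cone of the other
   generators. If [t - a] is positive, [p] is redundant, against minimality; if not, [- q] lies in
   the cone, against strong convexity. *)
have expose q : q \in s' -> exists y, [/\ forall r, r \in p :: s' -> 0 <= dot y r,
    dot y p = 0 & 0 < dot y q].
  move=> qs; have [h|[y [ys yq]]] := farkas (- p :: p :: s') (- q); last first.
    exists y; split; last by move: yq; rewrite dotNr oppr_lt0.
      by move=> r rs; apply: ys; rewrite inE rs orbT.
    have := ys (- p); rewrite mem_head => /(_ isT); rewrite dotNr oppr_ge0 => h.
    by apply/eqP; rewrite eq_le h ys // !inE eqxx orbT.
  have [t [z [t0 hz qE]]] := conic_cons h; have [a [w [a0 hw zE]]] := conic_cons hz.
  have E : (t - a) *: p = q + w.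
    have -> : q = t *: p - z by rewrite -[q]opprK qE opprD scalerN opprK.
    by rewrite zE opprD addrA subrK scalerBl.
  have hqw : conic_hull [set` s'] (q + w) by apply: conicD => //; apply: conic_gen.
  have [ta|ta] := ltP 0 (t - a).
    case: pnot; suff : conic_hull [set` s'] ((t - a)^-1 *: (q + w)).
      by rewrite -E scalerA mulVf ?gt_eqF // scale1r.
    by apply: conicZ => //; rewrite invr_ge0 ltW.
  have /mapP[u /mem_rem us qu] := qs; have /eqP := pn0 _ us; rewrite -qu; case.
  apply: sc; first by apply/ss/conic_gen.
  have -> : - q = (a - t) *: p + w by rewrite -opprB scaleNr E opprD subrK.
  rewrite sE'; apply: conicD; last by rewrite -sE'; apply: ss.
  by apply: conicZ; [rewrite subr_ge0 -subr_le0 | apply: conic_gen; rewrite /= mem_head].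
(* Summing the forms found for the single [q] gives one form that vanishes at [p] and is positive at
   all other generators. *)
have [Y [Y0 Yp Yq]] : exists Y, [/\ forall r, r \in p :: s' -> 0 <= dot Y r,
    dot Y p = 0 & forall q, q \in s' -> 0 < dot Y q].
  have : {subset s' <= s'} by [].
  elim: {1 4}s' => [|q l IH] ls.
    by exists 0; split=> // [r _|]; rewrite dot0l.
  have [|Y [Y0 Yp Yq]] := IH; first by move=> r rl; apply: ls; rewrite inE rl orbT.
  have [|y [y0 yp yq]] := expose q; first by apply: ls; apply: mem_head.
  exists (y + Y); split=> [r rs||r]; rewrite dotDl.
  - by rewrite addr_ge0 ?y0 ?Y0.
  - by rewrite yp Yp addr0.
  - rewrite inE => /orP[/eqP ->|rl].
      by rewrite ltr_pwDl // Y0 // inE ls ?mem_head ?orbT.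
    rewrite ltr_wpDl ?Yq // y0 // inE ls ?orbT // inE rl orbT //.
exists Y; split=> [x|]; first by rewrite sE'; apply: conic_dot_ge0.
apply/seteqP; split=> x.
  elim/conic_ind=> [|a _ y a0 -> _ [sy Yy]].
    by split; [rewrite sE'; apply: conic0 | rewrite dot0r].
  split; last by rewrite dotDr dotZr Yp Yy mulr0 addr0.
  by rewrite sE'; apply: conicD; [apply: conicZ; rewrite -?sE' | rewrite -sE'].
move=> [sx Yx]; move: sx Yx; rewrite sE' => /conic_cons[a [z [a0 hz ->]]].
rewrite dotDr dotZr Yp mulr0 add0r => Yz.
suff -> : z = 0 by rewrite addr0; apply: conicZ => //; apply: conic_gen.
move: Yz; elim/conic_ind: hz => // b q w b0 qs hw IH.
rewrite dotDr dotZr => /eqP; rewrite paddr_eq0; last 2 first.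
- by rewrite mulr_ge0 // ltW // Yq.
- by apply: conic_dot_ge0 hw => r rs; apply: ltW; apply: Yq.
rewrite mulf_eq0 (gt_eqF (Yq _ qs)) orbF => /andP[/eqP -> /eqP /IH ->].
by rewrite scale0r addr0.
Qed.
End ConvexCones.

(** * Fans and heights *)

Section Faces.
Variables (R : realType) (d : nat).
Implicit Types (sigma tau : set 'rV[R]_d) (F : cone_family R d).

Lemma realptD (m m' : 'rV[int]_d) : realpt R (m + m') = realpt R m + realpt R m'.
Proof. by apply/rowP => i; rewrite !mxE intrD. Qed.

Lemma rat_cone0 sigma : rational_cone sigma -> sigma 0.
Proof. by move=> [s ->]; apply: conic0. Qed.
Lemma rat_coneD sigma x y : rational_cone sigma -> sigma x -> sigma y -> sigma (x + y).
Proof. by move=> [s ->]; apply: conicD. Qed.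

Lemma face_addl tau sigma x y : is_face tau sigma -> sigma x -> sigma y ->
  tau (x + y) -> tau x.
Proof.
move=> [v [v0 ->]] sx sy [_]; rewrite dotDr => /eqP.
by rewrite paddr_eq0 ?v0 // => /andP[/eqP vx _]; split.
Qed.

Lemma fan_rat F (c : F) : is_fan F -> rational_cone (cone c).
Proof. by case=> _ h _ _; case: (h c). Qed.
Lemma fan_cone0 F (c : F) : is_fan F -> cone c 0.
Proof. by move=> fF; apply: rat_cone0 (fan_rat c fF). Qed.
Lemma fan_coneD F (c : F) x y : is_fan F -> cone c x -> cone c y -> cone c (x + y).
Proof. by move=> fF; apply: rat_coneD (fan_rat c fF). Qed.

Lemma fan_leP F (i j : F) : is_fan F -> face_le i j <-> cone i `<=` cone j.
Proof.
move=> [_ _ _ h]; split; first exact: face_sub.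
by move=> /setIidl E; have [_] := h i j; rewrite E.
Qed.

Lemma fan_inj F (i j : F) : is_fan F -> cone i `<=` cone j -> cone j `<=` cone i -> i = j.
Proof. by move=> [inj _ _ _] ij ji; apply/inj/seteqP. Qed.

Lemma fan_relintP F (c : F) x : is_fan F -> relint (cone c) x <->
  cone c x /\ forall tau, is_face tau (cone c) -> tau x -> tau = cone c.
Proof.
move=> fF; have [s cE] := fan_rat c fF; split=> [rx|[cx h]].
  have cx : cone c x by case: rx.
  split=> // tau ft tx.
  by apply: (relint_no_face rx _ ft tx) => z cz; apply: fan_coneD.
have sE : [set realpt R m | m in [set` s]] = [set` map (@realpt R d) s].
  by apply/seteqP; split=> [_ [m /= ml <-]|y /= /mapP[m ml ->]]; [apply: map_f|exists m].
by move: cx h; rewrite cE sE; apply: no_face_relint.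
Qed.

Section Height.
Variables (S : stacky_fan R d) (psi : 'rV[R]_d -> R).
Hypotheses (sS : is_stacky_fan S) (hpsi : is_height S psi).

Lemma heightD (c : S) x y : cone c x -> cone c y -> psi (x + y) = psi x + psi y.
Proof.
have [fS _] := sS; have [hl _] := hpsi; have [q hq] := hl c.
by move=> cx cy; rewrite !hq // ?dotDr //; apply: fan_coneD.
Qed.

(** The cone is generated by its rays, on which the height is linear and equals one at the stacky
    vector, a nonnegative multiple of the ray generator. *)
Lemma height_ge0 (c : S) x : cone c x -> 0 <= psi x.
Proof.
have [fS raysP] := sS; have [hl hr] := hpsi; have [q hq] := hl c.
case: (fS) => _ /(_ c)[rc sc] facesP _.
have [s [cE hs]] := cone_rays rc sc => cx; rewrite hq //.
move: cx; rewrite cE; apply: conic_dot_ge0 => _ [m /= ms <-].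
have [m0 /facesP [rho rhoE]] := hs m ms.
have ray : is_ray (cone rho) by exists m.
have [b0] := raysP _ ray; rewrite {1}rhoE => bm.
have [a [a0 bE]] : exists a, 0 <= a /\ realpt R (svec rho) = a *: realpt R m.
  elim/conic_ind: bm => [|a _ y a0 -> _ [b [b0' ->]]]; first by exists 0; rewrite scale0r.
  by exists (a + b); rewrite addr_ge0 // scalerDl.
have cm : cone c (realpt R m) by rewrite cE; apply: conic_gen; exists m.
have cb : cone c (realpt R (svec rho)).
  rewrite bE; rewrite cE; apply: conicZ => //; rewrite -cE //.
have := hr _ ray; rewrite hq // bE dotZr => e.
by rewrite leNgt; apply/negP => lt; have := mulr_ge0_le0 a0 (ltW lt); rewrite e ler10.
Qed.

(* On a face of the stacky polytope avoiding the origin every point is a convex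
   combination of stacky vectors alone, hence has height one. *)
Lemma height_one (g : {malg R[i]['rV[int]_d]}) u :
  height_one_rep (stacky_poly S) g -> u \in monalg.msupp g -> psi (realpt R u) = 1.
Proof.
have [fS raysP] := sS; have [hl hr] := hpsi.
move=> [h _] /h[F [y [t [yP FE F0]]]]; rewrite FE => -[[c uP] yu].
have [q hq] := hl c.
have P0 : stacky_poly S 0.
  exists c; exists 1%N, (fun=> 1), (fun=> 0); split=> //; rewrite ?big_ord1 ?scaler0 //.
  by move=> _; left.
have tn0 : t != 0.
  by apply/eqP => t0; apply: F0; rewrite FE; split; rewrite // dot0r t0.
have t0 : 0 < t by rewrite lt_def tn0 -(dot0r y) yP.
case: uP => k [a [p [a0 a1 pP pu]]].
have cp i : cone c (p i).
  case: (pP i) => [->|[rho [ray le] <-]]; first exact: fan_cone0.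
  by apply: (face_sub le); case: (raysP _ ray).
have pt i : dot y (p i) <= t.
  apply: yP; exists c, 1%N, (fun=> 1), (fun=> p i); split=> //.
  - by rewrite big_ord1.
  - by rewrite big_ord1 scale1r.
(* The form [y] is at most [t] at each [p i] and its weighted mean is [t], so every [p i] of nonzero
   weight attains [t]. The origin does not, since [t] is positive. *)
have e0 : \sum_(i < k) a i * (t - dot y (p i)) = 0.
  under eq_bigr => i _ do rewrite mulrBr.
  rewrite sumrB -mulr_suml a1 mul1r -{1}yu pu dot_sumr.
  by under eq_bigr => i _ do rewrite dotZr; rewrite subrr.
have ai i : a i * (t - dot y (p i)) = 0.
  apply/eqP; move/eqP: e0; rewrite psumr_eq0 => [/allP/(_ i)|j _].
    by rewrite mem_index_enum => /(_ isT).
  by rewrite mulr_ge0 ?subr_ge0.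
rewrite hq; last first.
  rewrite pu; elim/big_ind: _ => [|v w|i _]; first exact: fan_cone0.
    exact: fan_coneD.
  by have [s cE] := fan_rat c fS; move: (cp i); rewrite cE; apply: conicZ.
rewrite pu dot_sumr -[RHS]a1; apply: eq_bigr => i _; rewrite dotZr.
have [->|ain0] := eqVneq (a i) 0; first by rewrite mul0r.
have /eqP := ai i; rewrite mulf_eq0 (negPf ain0) /= subr_eq0 => /eqP pit.
case: (pP i) => [pi0|[rho [ray le] pE]].
  by move: t0; rewrite pit pi0 dot0r ltxx.
by rewrite -pE -hq ?hr ?mulr1 // pE.
Qed.
End Height.
End Faces.

Section ProductFan.
Variables (R : realType) (n : nat) (S S' : cone_family R n).
Hypotheses (fS : is_fan S) (fS' : is_fan S').
Implicit Types (eta gamma beta : Phi S S').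

Lemma Phi_coneE eta x y : cone eta (row_mx x y) <-> lcone eta x /\ rcone eta y.
Proof.
split=> [[x' [y' [hx hy /eq_row_mx[-> ->]]]] //|[hx hy]]; by exists x, y.
Qed.

Lemma lcone0 eta : lcone eta 0. Proof. exact: fan_cone0. Qed.
Lemma rcone0 eta : rcone eta 0. Proof. exact: fan_cone0. Qed.

Lemma dot_row (K : fieldType) k l (x x' : 'rV[K]_k) (y y' : 'rV[K]_l) :
  dot (row_mx x y) (row_mx x' y') = dot x x' + dot y y'.
Proof.
rewrite /dot big_split_ord /=; congr (_ + _); apply: eq_bigr => i _.
  by rewrite !row_mxEl.
by rewrite !row_mxEr.
Qed.

(** In a fan an inclusion of cones is already a face relation; supporting forms of the two factors
    add up to one of the product. *)
Lemma Phi_leP gamma eta :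
  face_le gamma eta <-> lcone gamma `<=` lcone eta /\ rcone gamma `<=` rcone eta.
Proof.
split=> [/face_sub sub|[/(fan_leP _ _ fS)[x [x0 xE]] /(fan_leP _ _ fS')[y [y0 yE]]]].
  split=> x gx.
    by case/Phi_coneE: (sub (row_mx x 0) (proj2 (Phi_coneE _ _ _) (conj gx (rcone0 _)))).
  by case/Phi_coneE: (sub (row_mx 0 x) (proj2 (Phi_coneE _ _ _) (conj (lcone0 _) gx))).
exists (row_mx x y); split=> [_ [u [v [hu hv ->]]]|].
  by rewrite dot_row addr_ge0 ?x0 ?y0.
apply/seteqP; split=> [_ [u [v [+ + ->]]]|z [[u [v [hu hv ->]]]]].
  rewrite xE yE => -[hu xu] [hv yv]; split; first by apply/Phi_coneE.
  by rewrite dot_row xu yv addr0.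
rewrite dot_row => /eqP; rewrite paddr_eq0 ?x0 ?y0 // => /andP[/eqP xu /eqP yv].
by apply/Phi_coneE; rewrite /lcone /rcone xE yE.
Qed.

Lemma Phi_refl eta : face_le eta eta.
Proof. by apply/Phi_leP; split=> x. Qed.

Lemma Phi_trans beta gamma eta : face_le beta gamma -> face_le gamma eta -> face_le beta eta.
Proof.
move=> /Phi_leP[l1 r1] /Phi_leP[l2 r2]; apply/Phi_leP.
by split=> x; [move/l1/l2 | move/r1/r2].
Qed.

Lemma Phi_anti gamma eta : face_le gamma eta -> face_le eta gamma -> gamma = eta.
Proof.
move=> /Phi_leP[l1 r1] /Phi_leP[l2 r2]; apply: val_inj.
move: l1 r1 l2 r2; rewrite /lcone /rcone.
case: (val gamma) (val eta) => [a b] [a' b'] /= l1 r1 l2 r2.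
by rewrite (fan_inj fS l1 l2) (fan_inj fS' r1 r2).
Qed.

Lemma lcone_face gamma eta : face_le gamma eta -> is_face (lcone gamma) (lcone eta).
Proof. by move=> /Phi_leP[h _]; apply/(fan_leP _ _ fS). Qed.
Lemma rcone_face gamma eta : face_le gamma eta -> is_face (rcone gamma) (rcone eta).
Proof. by move=> /Phi_leP[_ h]; apply/(fan_leP _ _ fS'). Qed.

Lemma Phi_face eta sigma sigma' : is_face sigma (lcone eta) ->
  is_face sigma' (rcone eta) ->
  exists gamma, [/\ lcone gamma = sigma, rcone gamma = sigma' & face_le gamma eta].
Proof.
move=> fs fs'; have [_ _ /(_ _ _ fs)[c cE] _] := fS; have [_ _ /(_ _ _ fs')[c' cE'] _] := fS'.
have /asboolP h : `[< forall x y, cone (c, c').1 x -> cone (c, c').2 y -> dot x y = 0 >].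
  apply/asboolP => x y /=; rewrite cE cE' => /(face_sub fs) hx /(face_sub fs') hy.
  by have /asboolP := valP eta; apply.
have h' : (fun p : S * S' => `[< forall x y, cone p.1 x -> cone p.2 y -> dot x y = 0 >]) (c, c').
  exact/asboolP.
exists (exist _ (c, c') h'); split=> //; apply/Phi_leP.
by split; rewrite /lcone /rcone /= ?cE ?cE'; apply: face_sub.
Qed.

Lemma Phi_meet gamma1 gamma2 eta : face_le gamma1 eta -> face_le gamma2 eta ->
  exists beta, [/\ face_le beta gamma1, face_le beta gamma2,
    lcone beta = lcone gamma1 `&` lcone gamma2 & rcone beta = rcone gamma1 `&` rcone gamma2].
Proof.
move=> g1 g2; have [_ _ _ h] := fS; have [_ _ _ h'] := fS'.
have [f1 _] := h (val gamma1).1 (val gamma2).1.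
have [f1' _] := h' (val gamma1).2 (val gamma2).2.
have [beta [lE rE le]] := Phi_face f1 f1'.
exists beta; rewrite lE rE; split=> //; apply/Phi_leP.
by rewrite lE rE; split=> x [].
Qed.

(** A proper face of one factor, paired with the whole other factor, is a proper face of the
    product. This is what makes the kernel of the boundary map the span of products of interior
    monomials. *)
Lemma Phi_relintP eta x y : lcone eta x -> rcone eta y ->
  (forall gamma, face_lt gamma eta -> ~ (lcone gamma x /\ rcone gamma y)) <->
  relint (lcone eta) x /\ relint (rcone eta) y.
Proof.
move=> ex ey; split=> [h|[/(fan_relintP _ _ fS)[_ hx] /(fan_relintP _ _ fS')[_ hy]]].
  split.
    apply/(fan_relintP _ _ fS); split=> // tau ft tx; apply: contrapT => ne.
    have [g [gl gr le]] := Phi_face ft (rcone_face (Phi_refl eta)).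
    by apply: (h g); rewrite ?gl ?gr //; split=> // ge; apply: ne; rewrite -gl ge.
  apply/(fan_relintP _ _ fS'); split=> // tau ft tx; apply: contrapT => ne.
  have [g [gl gr le]] := Phi_face (lcone_face (Phi_refl eta)) ft.
  by apply: (h g); rewrite ?gl ?gr //; split=> // ge; apply: ne; rewrite -gr ge.
move=> gamma [le ne] [gx gy]; apply: ne; apply: Phi_anti => //; apply/Phi_leP.
by rewrite (hx _ (lcone_face le) gx) (hy _ (rcone_face le) gy); split=> z.
Qed.
End ProductFan.

(** * Regular sequences *)

Section FreeTensor.
Variables (K : fieldType) (Y Y' : choiceType).
Implicit Types (a : {malg K[Y]}) (b : {malg K[Y']}) (z : {malg K[(Y * Y')%type]}).

(* Locked, as unification would otherwise unfold failed matches down to finite sums. *)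
Fact mtens_key : unit. Proof. by []. Qed.
Definition mtens := locked_with mtens_key (fun a b =>
  mext (fun y => mext (fun y' => << (y, y') >> : {malg K[(Y * Y')%type]}) b) a).

Lemma mtensE a b : mtens a b = mext (fun y => mext (fun y' => << (y, y') >>) b) a.
Proof. by rewrite /mtens locked_withE. Qed.
Lemma mtens_linl b : linear (mtens ^~ b).
Proof. by move=> c u v; rewrite !mtensE mext_lin. Qed.
Lemma mtens_linr a : linear (mtens a).
Proof.
move=> c u v; rewrite !mtensE.
by apply: (mext_linp (h := fun b y => mext (fun y' => << (y, y') >>) b)) => y; apply: mext_lin.
Qed.
Lemma mtensU y y' : mtens << y >> << y' >> = << (y, y') >>.
Proof. by rewrite mtensE !mextU. Qed.

Lemma mtens_linP (E : lmodType K) (f g : {malg K[(Y * Y')%type]} -> E) :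
  linear f -> linear g -> (forall a b, f (mtens a b) = g (mtens a b)) -> f =1 g.
Proof. by move=> hf hg fg; apply: malg_linP => // -[y y']; rewrite -mtensU fg. Qed.

Lemma bilin_malgP (E : lmodType K) (f g : {malg K[Y]} -> {malg K[Y']} -> E) :
  (forall b, linear (f ^~ b)) -> (forall a, linear (f a)) ->
  (forall b, linear (g ^~ b)) -> (forall a, linear (g a)) ->
  (forall y y', f << y >> << y' >> = g << y >> << y' >>) -> forall a b, f a b = g a b.
Proof.
move=> fl fr gl gr fg a b; move: a; apply: malg_linP => // y.
by move: b; apply: malg_linP => // y'.
Qed.

Lemma mcoeff_lin (X : choiceType) (x : X) :
  linear (fun a : {malg K[X]} => monalg.mcoeff x a : K^o).
Proof. by move=> c a b; rewrite monalg.mcoeffD monalg.mcoeffZ. Qed.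

Lemma mcoeff_mtens y y' a b :
  monalg.mcoeff (y, y') (mtens a b) = monalg.mcoeff y a * monalg.mcoeff y' b.
Proof.
have hc := mcoeff_lin (y, y').
apply: (@bilin_malgP K^o (fun a b => monalg.mcoeff (y, y') (mtens a b))
  (fun a b => monalg.mcoeff y a * monalg.mcoeff y' b)).
- by move=> b0; apply: (lin_comp hc); apply: mtens_linl.
- by move=> a0; apply: (lin_comp hc); apply: mtens_linr.
- by move=> b0 c u v; rewrite monalg.mcoeffD monalg.mcoeffZ mulrDl scalerAl.
- by move=> a0 c u v; rewrite monalg.mcoeffD monalg.mcoeffZ mulrDr [_ *: _]mulrCA.
by move=> u u'; rewrite mtensU !monalg.mcoeffU xpair_eqE -mulnb natrM.
Qed.

(** The partial contraction $\phi\otimes\mathrm{id}$. It turns a relation in the tensor product into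
    one relation in a single factor for each functional $\phi$. *)
Definition contrl (phi : {malg K[Y]} -> K) z : {malg K[Y']} :=
  mext (fun p => phi << p.1 >> *: << p.2 >>) z.
Definition contrr (phi : {malg K[Y']} -> K) z : {malg K[Y]} :=
  mext (fun p => phi << p.2 >> *: << p.1 >>) z.

Lemma contrl_lin phi : linear (contrl phi). Proof. exact: mext_lin. Qed.
Lemma contrr_lin phi : linear (contrr phi). Proof. exact: mext_lin. Qed.

Lemma contrl_mtens (phi : {malg K[Y]} -> K^o) a b : linear phi ->
  contrl phi (mtens a b) = phi a *: b.
Proof.
move=> hp; apply: (@bilin_malgP _ (fun a b => contrl phi (mtens a b)) (fun a b => phi a *: b)).
- by move=> b0; apply: (lin_comp (contrl_lin _)); apply: mtens_linl.
- by move=> a0; apply: (lin_comp (contrl_lin _)); apply: mtens_linr.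
- by move=> b0 c u v; rewrite hp scalerDl scalerA.
- by move=> a0 c u v; rewrite scalerDr !scalerA mulrC.
- by move=> y y'; rewrite mtensU /contrl mextU.
Qed.
Lemma contrr_mtens (phi : {malg K[Y']} -> K^o) a b : linear phi ->
  contrr phi (mtens a b) = phi b *: a.
Proof.
move=> hp; apply: (@bilin_malgP _ (fun a b => contrr phi (mtens a b)) (fun a b => phi b *: a)).
- by move=> b0; apply: (lin_comp (contrr_lin _)); apply: mtens_linl.
- by move=> a0; apply: (lin_comp (contrr_lin _)); apply: mtens_linr.
- by move=> b0 c u v; rewrite scalerDr !scalerA mulrC.
- by move=> a0 c u v; rewrite hp scalerDl scalerA.
- by move=> y y'; rewrite mtensU /contrr mextU.
Qed.

Lemma mcoeff_contrl y y' z :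
  monalg.mcoeff y' (contrl (monalg.mcoeff y) z) = monalg.mcoeff (y, y') z.
Proof.
apply: (@mtens_linP K^o (fun z => monalg.mcoeff y' (contrl (monalg.mcoeff y) z))
  (monalg.mcoeff (y, y'))).
- by apply: (lin_comp (mcoeff_lin y')); apply: contrl_lin.
- exact: mcoeff_lin.
move=> a b; rewrite (contrl_mtens _ _ (mcoeff_lin y)) monalg.mcoeffZ.
by rewrite mcoeff_mtens.
Qed.
Lemma mcoeff_contrr y y' z :
  monalg.mcoeff y (contrr (monalg.mcoeff y') z) = monalg.mcoeff (y, y') z.
Proof.
apply: (@mtens_linP K^o (fun z => monalg.mcoeff y (contrr (monalg.mcoeff y') z))
  (monalg.mcoeff (y, y'))).
- by apply: (lin_comp (mcoeff_lin y)); apply: contrr_lin.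
- exact: mcoeff_lin.
move=> a b; rewrite (contrr_mtens _ _ (mcoeff_lin y')) monalg.mcoeffZ.
by rewrite mcoeff_mtens mulrC.
Qed.

Lemma contrl_sum z : exists D : {fset Y},
  z = \sum_(y <- D) mtens << y >> (contrl (monalg.mcoeff y) z).
Proof.
exists [fset p.1 | p in monalg.msupp z]%fset; apply/monalg.malgP => -[y y'].
rewrite (linf_sum (mcoeff_lin _)).
under eq_bigr => u _ do rewrite mcoeff_mtens monalg.mcoeffU mcoeff_contrl.
have [yD|yD] := boolP (y \in [fset p.1 | p in monalg.msupp z]%fset).
  rewrite (bigD1_seq y) //= eqxx mul1r big1 ?addr0 // => u /negPf ->.
  by rewrite mul0r.
rewrite big_seq big1 => [|u uD]; last first.
  by case: eqP => [uy|_]; [rewrite uy (negPf yD) in uD | rewrite mul0r].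
apply/eqP; rewrite monalg.mcoeff_eq0; apply: contra yD => h.
by apply/imfsetP; exists (y, y').
Qed.
Lemma contrr_sum z : exists D : {fset Y'},
  z = \sum_(y' <- D) mtens (contrr (monalg.mcoeff y') z) << y' >>.
Proof.
exists [fset p.2 | p in monalg.msupp z]%fset; apply/monalg.malgP => -[y y'].
rewrite (linf_sum (mcoeff_lin _)).
under eq_bigr => u _ do rewrite mcoeff_mtens monalg.mcoeffU mcoeff_contrr.
have [yD|yD] := boolP (y' \in [fset p.2 | p in monalg.msupp z]%fset).
  rewrite (bigD1_seq y') //= eqxx mulr1 big1 ?addr0 // => u /negPf ->.
  by rewrite mulr0.
rewrite big_seq big1 => [|u uD]; last first.
  by case: eqP => [uy|_]; [rewrite uy (negPf yD) in uD | rewrite mulr0].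
apply/eqP; rewrite monalg.mcoeff_eq0; apply: contra yD => h.
by apply/imfsetP; exists (y, y').
Qed.

Section TensorBasis.
Variables (V V' : lmodType K) (w : Y -> V) (w' : Y' -> V') (T : set Y) (T' : set Y').
Variables (c : V -> {malg K[Y]}) (c' : V' -> {malg K[Y']}).
Hypotheses (hc : coordinates w T c) (hc' : coordinates w' T' c').

Definition tensor_crd : tensor V V' -> {malg K[(Y * Y')%type]} :=
  tlift (fun v v' => mtens (c v) (c' v')).

Lemma tensor_crd_bilin : bilin (fun v v' => mtens (c v) (c' v')).
Proof.
split=> [v'|v]; first exact: (lin_comp (mtens_linl _) (crd_lin hc)).
exact: (lin_comp (mtens_linr _) (crd_lin hc')).
Qed.

Lemma tensor_crd_pure v v' : tensor_crd (tpure v v') = mtens (c v) (c' v').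
Proof. exact: (tlift_pure tensor_crd_bilin). Qed.

Lemma tensor_coordinates : coordinates (fun p : (Y * Y')%type => tpure (w p.1) (w' p.2))
  [set p | T p.1 /\ T' p.2] tensor_crd.
Proof.
have hl : linear tensor_crd by apply: tlift_lin tensor_crd_bilin.
split=> //.
- move=> x; elim/lspan_ind: {x}(tensor_span x) => [|k _ x [v [v' ->]] hx].
    by rewrite (linf0 hl) => y; rewrite monalg.mcoeff0 eqxx.
  rewrite hl; apply: supported_lin => // -[y y'].
  rewrite tensor_crd_pure mcoeff_mtens mulf_eq0 negb_or => /andP[h h'].
  by split; [apply: (crd_supp hc) h | apply: (crd_supp hc') h'].
- apply: tensor_linP => [||v v']; last rewrite tensor_crd_pure -{2}(crdK hc v) -{2}(crdK hc' v').
  + exact: (lin_comp (mext_lin _) hl).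
  + exact: lin_id.
  move: (c v) (c' v'); apply: bilin_malgP.
  + by move=> b; apply: (lin_comp (mext_lin _)); apply: mtens_linl.
  + by move=> a; apply: (lin_comp (mext_lin _)); apply: mtens_linr.
  + by move=> b; apply: (lin_comp (tpure_linl _)); apply: mext_lin.
  + by move=> a; apply: (lin_comp (tpure_linr _)); apply: mext_lin.
  + by move=> y y'; rewrite mtensU !mextU.
- by move=> [y y'] /= [Ty Ty']; rewrite tensor_crd_pure (crd_gen hc) // (crd_gen hc') // mtensU.
Qed.
End TensorBasis.
End FreeTensor.

Section RegularSequences.
Variables (K : fieldType) (I : Type) (E : lmodType K) (o : I -> E -> E).
Hypothesis olin : forall i, linear (o i).

(** The sums of [o i (y i)] over the list with all [y i] in [P]: the ideal times the module for
    [P = setT], the ideal times a submodule in general. The recursion matches the induction along a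
    regular sequence. *)
Fixpoint inideal (P : set E) (s : seq I) (x : E) : Prop :=
  if s is i :: s' then exists y z, [/\ P y, inideal P s' z & x = o i y + z] else x = 0.

(* The sequence is listed in reverse order. *)
Fixpoint regseq (s : seq I) : Prop :=
  if s is i :: s' then regseq s' /\
    forall z, inideal setT s' (o i z) -> inideal setT s' z
  else True.

Lemma inideal_lin (P : set E) s a x y : (forall a x y, P x -> P y -> P (a *: x + y)) ->
  inideal P s x -> inideal P s y -> inideal P s (a *: x + y).
Proof.
move=> PD; elim: s x y => [|i s IH] x y /=; first by move=> -> ->; rewrite scaler0 addr0.
move=> [x1 [x2 [P1 h1 ->]]] [y1 [y2 [P2 h2 ->]]].
exists (a *: x1 + y1), (a *: x2 + y2); split; [exact: PD | exact: IH |].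
by rewrite olin scalerDr addrACA.
Qed.

Lemma inideal_linT s a x y :
  inideal setT s x -> inideal setT s y -> inideal setT s (a *: x + y).
Proof. exact: inideal_lin. Qed.

Lemma inideal0 s : inideal setT s 0.
Proof.
elim: s => //= i s IH; exists 0, 0; split=> //.
by rewrite (linf0 (olin i)) addr0.
Qed.
Lemma inidealD s x y : inideal setT s x -> inideal setT s y -> inideal setT s (x + y).
Proof. by rewrite -{2}[x]scale1r; apply: inideal_linT. Qed.
Lemma inideal_sum s (J : Type) (r : seq J) (F : J -> E) :
  (forall j, inideal setT s (F j)) -> inideal setT s (\sum_(j <- r) F j).
Proof. by move=> h; elim/big_ind: _ => //; [apply: inideal0 | apply: inidealD]. Qed.
Lemma inidealZ s a x : inideal setT s x -> inideal setT s (a *: x).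
Proof. by move=> h; rewrite -[_ *: _]addr0; apply: inideal_linT => //; apply: inideal0. Qed.

Lemma inideal_cat s s' x : inideal setT (s ++ s') x <->
  exists y z, [/\ inideal setT s y, inideal setT s' z & x = y + z].
Proof.
elim: s x => [|i s IH] x /=; split.
- by move=> h; exists 0, x; rewrite add0r.
- by move=> [y [z [-> h ->]]]; rewrite add0r.
- move=> [u [v [_ /IH[y [z [hy hz ->]]] ->]]].
  by exists (o i u + y), z; rewrite addrA; split=> //; exists u, y.
move=> [_ [z [[u [v [_ hv ->]]] hz ->]]]; exists u, (v + z); rewrite addrA; split=> //.
by apply/IH; exists v, z.
Qed.
End RegularSequences.

Lemma inideal_gen (K : fieldType) (I : eqType) (E : lmodType K) (o : I -> E -> E) s i y :
  (forall i, linear (o i)) -> i \in s -> inideal o setT s (o i y).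
Proof.
move=> olin; elim: s => [|j s IH] //=; rewrite inE => /orP[/eqP <-|/IH h].
  by exists y, 0; rewrite addr0; split=> //; apply: inideal0.
by exists 0, (o i y); rewrite (linf0 (olin j)) add0r.
Qed.

Lemma inidealP (K : fieldType) (I : eqType) (E : lmodType K) (o : I -> E -> E) s x :
  (forall i, linear (o i)) -> uniq s ->
  inideal o setT s x <-> exists a : I -> E, x = \sum_(i <- s) o i (a i).
Proof.
move=> olin us; split=> [|[a ->]]; last first.
  elim: s {us} => [|i s IH] /=; first by rewrite big_nil.
  by rewrite big_cons; exists (a i), (\sum_(j <- s) o j (a j)).
elim: s us x => [_ x -> |i s IH] /=; first by exists (fun=> 0); rewrite big_nil.
move=> /andP[is_ us] x [y [z [_ /(IH us)[a ->] ->]]].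
exists (fun j => if j == i then y else a j); rewrite big_cons eqxx; congr (_ + _).
by apply: eq_big_seq => j js; case: eqP => // ji; rewrite -ji js in is_.
Qed.

Section Syzygies.
Variables (K : fieldType) (I : Type) (E B : lmodType K).
Variables (o : I -> E -> E) (o' : I -> B -> B) (Psi : E -> B).
Hypotheses (olin : forall i, linear (o i)) (olin' : forall i, linear (o' i)).
Hypothesis oC : forall i j x, o i (o j x) = o j (o i x).
Hypotheses (Plin : linear Psi) (Po : forall i x, Psi (o i x) = o' i (Psi x)).
Hypothesis Psurj : forall b, exists x, Psi x = b.

Lemma inideal_map s x : inideal o setT s x -> inideal o' setT s (Psi x).
Proof.
elim: s x => [|i s IH] x /=; first by move=> ->; apply: linf0.
move=> [y [z [_ /IH h ->]]]; exists (Psi y), (Psi z).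
by rewrite (linfD Plin) Po.
Qed.

Lemma inideal_lift s b : inideal o' setT s b -> exists2 x, inideal o setT s x & Psi x = b.
Proof.
elim: s b => [|i s IH] b /=; first by move=> ->; exists 0 => //; apply: linf0.
move=> [y [z [_ /IH[x hx <-] ->]]]; have [u <-] := Psurj y.
by exists (o i u + x); [exists u, x | rewrite (linfD Plin) Po].
Qed.

Lemma inideal_op s i x : inideal o setT s x -> inideal o setT s (o i x).
Proof.
elim: s x => [|j s IH] x /=; first by move=> ->; apply: linf0.
move=> [y [z [_ /IH h ->]]]; exists (o i y), (o i z); split=> //.
by rewrite (linfD (olin i)) oC.
Qed.

(* A regular sequence on [B] kills [Tor_1(B, -)]: the kernel of [Psi] meets the
   ideal times [E] in the ideal times the kernel. *)
Lemma regular_kernel s x : regseq o' s -> inideal o setT s x -> Psi x = 0 ->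
  inideal o [set y | Psi y = 0] s x.
Proof.
elim: s x => [|i s IH] x //= [rs ri] [y [z [_ hz ->]]] P0.
have : inideal o' setT s (o' i (Psi y)).
  have -> : o' i (Psi y) = Psi (- z).
    by apply/eqP; rewrite (linfN Plin) -addr_eq0 -Po -(linfD Plin) P0.
  by apply: inideal_map; rewrite -scaleN1r; apply: inidealZ.
move=> /ri/inideal_lift[g hg Pg].
(* Replacing [y] by [y - g] puts the coefficient of [o i] in the kernel. The correction [o i g]
   stays in the ideal of the shorter sequence because the operators commute, so the induction
   hypothesis covers the rest. *)
exists (y - g), (o i g + z); split=> /=.
- by rewrite (linfB Plin) Pg subrr.
- apply: IH => //; first by apply: inidealD => //; apply: inideal_op.
  move: P0; rewrite !(linfD Plin) !Po Pg //.
- by rewrite (linfB (olin i)) addrA subrK.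
Qed.
End Syzygies.

(** * Toric face algebras *)

Section FaceAlgebras.
Variables (R : realType) (d : nat) (G : cone_family R d).
Local Notation C := (complex R).
Local Notation lattice := 'rV[int]_d.
Variables (g : {malg C[lattice]}) (sigma : set 'rV[R]_d).

Lemma mono_val (k : latpt sigma) : mono sigma (val k) = << k >>.
Proof. by rewrite /mono valK. Qed.

Lemma mono_out m : ~ sigma (realpt R m) -> mono sigma m = 0.
Proof. by move=> h; rewrite /mono insubN //; apply/asboolP. Qed.

Lemma latptP (k : latpt sigma) : sigma (realpt R (val k)).
Proof. exact: (asboolW (svalP k)). Qed.

Lemma mono_in m (h : sigma (realpt R m)) : exists2 k : latpt sigma, val k = m & mono sigma m = << k >>.
Proof.
have h' : (fun m => `[< sigma (realpt R m) >]) m by apply/asboolP.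
by exists (exist _ m h'); rewrite // -mono_val.
Qed.

Lemma shareC m m' : share G sigma m m' = share G sigma m' m.
Proof.
by rewrite /share; congr asbool; apply/propext; split=> -[c [h1 h2 h3]]; exists c.
Qed.
Lemma share_inl m m' : share G sigma m m' -> sigma (realpt R m).
Proof. by move=> /asboolP[c [h h1 _]]; apply: h. Qed.
Lemma share_inr m m' : share G sigma m m' -> sigma (realpt R m').
Proof. by rewrite shareC; apply: share_inl. Qed.

Lemma star_linl b : linear (fun a : falg sigma => star G a b).
Proof. exact: mext_lin. Qed.
Lemma star_linr a : linear (fun b : falg sigma => star G a b).
Proof. by apply: mext_linp => k; apply: mext_lin. Qed.

Lemma star_mono m m' : star G (mono sigma m) (mono sigma m') =
  if share G sigma m m' then mono sigma (m + m') else 0.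
Proof.
have [hm|hm] := pselect (sigma (realpt R m)); last first.
  by rewrite (mono_out hm) (linf0 (star_linl _)); case: ifP => [/share_inl|].
have [hm'|hm'] := pselect (sigma (realpt R m')); last first.
  by rewrite (mono_out hm') (linf0 (star_linr _)); case: ifP => [/share_inr|].
have [k <- ->] := mono_in hm; have [k' <- ->] := mono_in hm'.
by rewrite /star !mextU.
Qed.

Lemma star_bilinP (E : lmodType C) (f h : falg sigma -> falg sigma -> E) :
  (forall b, linear (f ^~ b)) -> (forall a, linear (f a)) ->
  (forall b, linear (h ^~ b)) -> (forall a, linear (h a)) ->
  (forall m m', f (mono sigma m) (mono sigma m') = h (mono sigma m) (mono sigma m')) ->
  forall a b, f a b = h a b.
Proof.
move=> fl fr hl hr fh; apply: bilin_malgP => // y y'.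
by rewrite -!mono_val; apply: fh.
Qed.

Lemma starC (a b : falg sigma) : star G a b = star G b a.
Proof.
apply: (star_bilinP (f := fun a b => star G a b) (h := fun a b => star G b a)).
- exact: star_linl.
- exact: star_linr.
- exact: star_linr.
- exact: star_linl.
- by move=> m m'; rewrite !star_mono shareC addrC.
Qed.

Lemma dlog_lin : linear (dlog g sigma).
Proof.
move=> a l l'; rewrite /dlog -mext_scale -mextD; apply: eq_in_mext => u _.
by rewrite dotDl dotZl scalerDl scalerA.
Qed.

Lemma dlog_sumE x : dlog g sigma x = \sum_i x 0 i *: dlog g sigma (delta_mx 0 i).
Proof.
rewrite {1}[x]row_sum_delta (linf_sum dlog_lin).
by apply: eq_bigr => i _; rewrite (linfZ dlog_lin).
Qed.

Lemma clattice_in (m : lattice) : sigma (realpt R m) -> cspan sigma (clattice R m).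
Proof.
move=> h; apply: lspan_gen; exists (realpt R m) => //.
by apply/rowP => i; rewrite !mxE rmorph_int.
Qed.

Lemma eq_dlog l l' : (forall x, cspan sigma x -> dot l x = dot l' x) ->
  dlog g sigma l = dlog g sigma l'.
Proof.
move=> h; apply: eq_in_mext => u _.
have [hu|hu] := pselect (sigma (realpt R u)); last by rewrite (mono_out hu) !scaler0.
by rewrite (h _ (clattice_in hu)).
Qed.

Lemma jac_decomp k (l : 'I_k -> 'rV[C]_d) x : form_basis sigma l ->
  lspan (jac G g (sigma := sigma)) x ->
  exists a : 'I_k -> falg sigma, x = \sum_i star G (a i) (dlog g sigma (l i)).
Proof.
move=> [_ bl]; elim/lspan_ind=> [|c _ y [l0 [a ->]] [b ->]].
  by exists (fun=> 0); rewrite big1 // => i _; apply: (linf0 (star_linl _)).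
have [e eP] := bl l0; exists (fun i => (c * e i) *: a + b i).
have -> : dlog g sigma l0 = \sum_i e i *: dlog g sigma (l i).
  under eq_bigr => i _ do rewrite -(linfZ dlog_lin).
  rewrite -(linf_sum dlog_lin); apply: eq_dlog => z hz; rewrite eP // dot_suml.
  by apply: eq_bigr => i _; rewrite dotZl.
rewrite (linf_sum (star_linr a)) scaler_sumr -big_split; apply: eq_bigr => i _ /=.
by rewrite (star_linl (dlog g sigma (l i))) (linfZ (star_linr a)) scalerA.
Qed.

Definition relpt : set (latpt sigma) := [set k | relint sigma (realpt R (val k))].

(** A projection along the Jacobian ideal onto the span of the monomials in [T]. By [nf_rel] it
    preserves the span of interior monomials, so it computes both the quotient [R0] and its interior
    part [R1]. *)
Record normal_form (T : set (latpt sigma)) (nf : falg sigma -> falg sigma) : Prop :=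
  NormalForm {
  nf_lin : linear nf;
  nf_jac : forall x, lspan (jac G g (sigma := sigma)) x -> nf x = 0;
  nf_mod : forall x, lspan (jac G g (sigma := sigma)) (x - nf x);
  nf_supp : forall x, supported T (nf x);
  nf_id : forall t, T t -> nf << t >> = << t >>;
  nf_rel : forall k, relpt k -> supported relpt (nf << k >>) }.

(** The basis is extended twice: first within the classes of interior monomials, then within all
    classes. The class of an interior monomial is therefore a combination of interior basis
    monomials only. *)
Lemma normal_form_exists : exists T nf, normal_form T nf.
Proof.
pose w (k : latpt sigma) : R0 G g sigma := quo_pi (jac G g (sigma := sigma)) << k >>.
have wE (z : falg sigma) : mext w z = quo_pi (jac G g (sigma := sigma)) z.
  apply: (malg_linP (mext_lin _) (@quo_pi_lin _ _ _)) => k; exact: mextU.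
have i0 : indep w set0.
  move=> z sz _; apply/monalg.malgP => k; rewrite monalg.mcoeff0.
  by apply/eqP/negPn/negP => /sz.
have [T1 [_ T1r i1 g1]] := basis_extension i0 (@sub0set _ relpt).
have [T [T1T _ iT gT]] := basis_extension i1 (@subsetT _ T1).
have [c hc] : exists c, coordinates w T c.
  apply: coordinates_exist => // x; apply/generated_lspan.
  rewrite -[x]quo_piK -wE; apply: lspan_sum => k _ _; apply: lspanZ.
  by apply/generated_lspan/gT.
exists T, (fun a => c (quo_pi (jac G g (sigma := sigma)) a)); split.
- exact: (lin_comp (crd_lin hc) (@quo_pi_lin _ _ _)).
- by move=> x /quo_pi_eq0 ->; apply: (linf0 (crd_lin hc)).
- move=> x; apply/quo_pi_eq0; rewrite (linfB (@quo_pi_lin _ _ _)).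
  by apply/eqP; rewrite subr_eq0 -(wE (c _)) (crdK hc).
- by move=> x; apply: (crd_supp hc).
- by move=> t Tt; apply: (crd_gen hc).
- move=> k rk; have [z sz zE] := g1 k rk.
  have -> : c (quo_pi (jac G g (sigma := sigma)) << k >>) = z.
    apply: (indep_inj iT); first exact: (crd_supp hc).
      by move=> y /sz /T1T.
    by rewrite (crdK hc) zE.
  by move=> y /sz /T1r.
Qed.

Section Homogeneity.
Variable psi : 'rV[R]_d -> R.

Hypothesis psiD : forall x y, sigma x -> sigma y -> psi (x + y) = psi x + psi y.
Hypothesis psi1 : forall u, u \in monalg.msupp g -> sigma (realpt R u) ->
  psi (realpt R u) = 1.

Definition degpart (s : R) (a : falg sigma) : falg sigma :=
  mext (fun k : latpt sigma => if psi (realpt R (val k)) == s then << k >> else 0) a.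

Lemma degpart_lin s : linear (degpart s). Proof. exact: mext_lin. Qed.

Lemma degpart_mono s m : degpart s (mono sigma m) =
  if psi (realpt R m) == s then mono sigma m else 0.
Proof.
have [hm|hm] := pselect (sigma (realpt R m)); last first.
  by rewrite (mono_out hm) (linf0 (degpart_lin s)) if_same.
by have [k <- ->] := mono_in hm; rewrite /degpart mextU.
Qed.

Lemma mcoeff_degpart s a k : monalg.mcoeff k (degpart s a) =
  if psi (realpt R (val k)) == s then monalg.mcoeff k a else 0.
Proof.
pose f (a : falg sigma) : C^o := if psi (realpt R (val k)) == s then monalg.mcoeff k a else 0.
move: a; apply: (@malg_linP _ _ C^o (fun a => monalg.mcoeff k (degpart s a)) f) => [||k'].
- exact: (lin_comp (mcoeff_lin k) (degpart_lin s)).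
- by rewrite /f; case: eqP => _; [apply: mcoeff_lin | apply: lin_0].
rewrite /degpart mextU /f monalg.mcoeffU.
have [->|nk] := eqVneq k' k.
  by case: ifP => _; rewrite ?monalg.mcoeff0 ?monalg.mcoeffU ?eqxx.
by rewrite if_same; case: ifP => _; rewrite ?monalg.mcoeff0 ?monalg.mcoeffU ?(negPf nk).
Qed.

(** The monomials of [g] have height one, hence the shift [s - 1]. Consequently the Jacobian ideal
    is homogeneous. *)
Lemma degpart_star s (a : falg sigma) l :
  degpart s (star G a (dlog g sigma l)) = star G (degpart (s - 1) a) (dlog g sigma l).
Proof.
move: a; apply: malg_linP => [||k].
- exact: (lin_comp (degpart_lin s) (star_linl _)).
- exact: (lin_comp (star_linl _) (degpart_lin _)).
rewrite -mono_val degpart_mono /dlog.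
set e : falg sigma := if _ then _ else _.
rewrite (mext_comp _ _ (star_linr _)) (mext_comp _ _ (degpart_lin s)).
rewrite (mext_comp _ _ (star_linr _)); apply: eq_in_mext => u ug.
rewrite (linfZ (star_linr (mono sigma (val k)))) (linfZ (star_linr e)).
rewrite (linfZ (degpart_lin s)) star_mono.
suff -> : degpart s (if share G sigma (val k) u then mono sigma (val k + u) else 0) =
  star G e (mono sigma u) by [].
rewrite /e {e}.
case sh: (share G sigma (val k) u); last first.
  rewrite (linf0 (degpart_lin s)); case: ifP => _.
    by rewrite star_mono sh.
  by rewrite (linf0 (star_linl _)).
have uin := share_inr sh; rewrite degpart_mono realptD (psiD (latptP k) uin) (psi1 ug uin).
have -> : (psi (realpt R (val k)) + 1 == s) = (psi (realpt R (val k)) == s - 1).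
  by rewrite [RHS]eq_sym subr_eq eq_sym.
by case: ifP => _; rewrite ?(linf0 (star_linl _)) ?star_mono ?sh.
Qed.

Lemma degpart_jac s x : lspan (jac G g (sigma := sigma)) x ->
  lspan (jac G g (sigma := sigma)) (degpart s x).
Proof.
apply: lspan_img => [|_ [l [a ->]]]; first exact: degpart_lin.
by rewrite degpart_star; apply: lspan_gen; exists l, (degpart (s - 1) a).
Qed.

(** [T] is chosen without regard to the grading, but it consists of monomials, so a homogeneous
    component of a normal form is again a normal form. The Jacobian ideal being homogeneous,
    uniqueness leaves only the component of the right height. *)
Lemma nf_homog T nf k k' : normal_form T nf ->
  monalg.mcoeff k' (nf << k >>) != 0 -> psi (realpt R (val k')) = psi (realpt R (val k)).
Proof.
move=> h; set s := psi (realpt R (val k)).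
have nfT (x : falg sigma) : supported T x -> nf x = x.
  move=> sx; rewrite [RHS]malg_sumE {1}[x]malg_sumE (linf_sum (nf_lin h)).
  apply: eq_big_seq => y; rewrite -monalg.mcoeff_neq0 => /sx Ty.
  by rewrite (linfZ (nf_lin h)) (nf_id h).
have := degpart_jac s (nf_mod h << k >>).
rewrite (linfB (degpart_lin s)) -{1}mono_val degpart_mono eqxx mono_val => /(nf_jac h).
rewrite (linfB (nf_lin h)) (nfT (degpart _ _)) => [/eqP|y]; last first.
  by rewrite mcoeff_degpart; case: ifP => _; [apply: (nf_supp h) | rewrite eqxx].
rewrite subr_eq0 => /eqP ->; rewrite mcoeff_degpart.
by case: (psi (realpt R (val k')) =P s) => // _; rewrite eqxx.
Qed.
End Homogeneity.

Section InteriorPart.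
Variables (T : set (latpt sigma)) (nf : falg sigma -> falg sigma).
Hypothesis hnf : normal_form T nf.

Definition R1_crd (v : R1 G g sigma) : falg sigma := nf (quo_repr (val v)).

Definition R1_gen (k : latpt sigma) : R1 G g sigma :=
  insubd 0 (quo_pi (jac G g (sigma := sigma)) << k >>).

Lemma R1_genE k : relpt k -> val (R1_gen k) = quo_pi (jac G g (sigma := sigma)) << k >>.
Proof.
move=> rk; rewrite /R1_gen val_insubd ifT //; apply/asboolP/lspan_gen.
by exists (val k) => //; rewrite mono_val.
Qed.

Let nf_quo (x : falg sigma) :
  nf (quo_repr (quo_pi (jac G g (sigma := sigma)) x)) = nf x.
Proof.
by apply: quo_lift (nf_lin hnf) _ _ => y hy; apply: (nf_jac hnf); apply: lspan_gen.
Qed.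

Lemma val_lin : linear (val : R1 G g sigma -> R0 G g sigma).
Proof. by []. Qed.

Lemma R1_coordinates : coordinates R1_gen (T `&` relpt) R1_crd.
Proof.
have hl : linear (fun x : R0 G g sigma => nf (quo_repr x)).
  by apply: quo_lift_lin (nf_lin hnf) _ => y hy; apply: (nf_jac hnf); apply: lspan_gen.
have c_lin : linear R1_crd by apply: (lin_comp hl val_lin).
have c_supp v : supported (T `&` relpt) (R1_crd v).
  move=> k kv; split; first exact: (nf_supp hnf) kv.
  move: kv; rewrite /R1_crd; have := asboolW (valP v); move: (val v) => y hy.
  elim/lspan_ind: {y}hy => [|a _ x [m rm <-] IH].
    by rewrite (linf0 hl) monalg.mcoeff0 eqxx.
  rewrite hl nf_quo monalg.mcoeffD monalg.mcoeffZ.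
  have [x0|/IH //] := eqVneq (monalg.mcoeff k (nf (quo_repr x))) 0.
  rewrite x0 addr0 mulf_eq0 negb_or => /andP[_].
  have sm : sigma (realpt R m) by case: rm.
  have [j jm ->] := mono_in sm; apply: (nf_rel hnf); by rewrite /relpt /= jm.
split=> // [v|k [Tk rk]]; last by rewrite /R1_crd R1_genE // nf_quo (nf_id hnf).
apply: val_inj; rewrite /mext (linf_sum val_lin).
under eq_big_seq => k.
  rewrite -monalg.mcoeff_neq0 => /c_supp[_ rk].
  rewrite (linfZ val_lin) R1_genE // -(linfZ (@quo_pi_lin _ _ _)).
  over.
rewrite -(linf_sum (@quo_pi_lin _ _ _)) -malg_sumE /R1_crd -[RHS]quo_piK.
apply/eqP; rewrite eq_sym -subr_eq0 -(linfB (@quo_pi_lin _ _ _)); apply/eqP.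
by apply/quo_pi_eq0; apply: (nf_mod hnf).
Qed.

Lemma R1_crd_homog psi t (v : R1 G g sigma) k :
  (forall k k', monalg.mcoeff k' (nf << k >>) != 0 ->
     psi (realpt R (val k')) = psi (realpt R (val k))) ->
  R1_homog psi t v -> monalg.mcoeff k (R1_crd v) != 0 -> psi (realpt R (val k)) = t.
Proof.
have hl : linear (fun x : R0 G g sigma => nf (quo_repr x)).
  by apply: quo_lift_lin (nf_lin hnf) _ => y hy; apply: (nf_jac hnf); apply: lspan_gen.
move=> hom; rewrite /R1_homog /R1_crd /=; elim/lspan_ind=> [|a _ x [m [rm mt] <-] IH].
  by rewrite (linf0 hl) monalg.mcoeff0 eqxx.
rewrite hl nf_quo monalg.mcoeffD monalg.mcoeffZ.
have [x0|/IH //] := eqVneq (monalg.mcoeff k (nf (quo_repr x))) 0.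
rewrite x0 addr0 mulf_eq0 negb_or => /andP[_].
have sm : sigma (realpt R m) by case: rm.
by have [j jm ->] := mono_in sm; rewrite -mt -jm; apply: hom.
Qed.

Lemma R1_gen_homog psi k : relpt k -> R1_homog psi (psi (realpt R (val k))) (R1_gen k).
Proof.
move=> rk; rewrite /R1_homog /= R1_genE //; apply: lspan_gen.
by exists (val k); rewrite ?mono_val.
Qed.
End InteriorPart.
End FaceAlgebras.

Section FaceRestriction.
Variables (R : realType) (d : nat) (G : cone_family R d).
Hypothesis fG : is_fan G.
Local Notation C := (complex R).
Local Notation lattice := 'rV[int]_d.
Implicit Types (sigma tau : set 'rV[R]_d) (m : lattice).

(** The form that cuts [tau] out of [sigma] also cuts a face out of the common cone of [G], and that
    face belongs to the fan. *)
Lemma share_face sigma tau m m' : is_face tau sigma -> share G sigma m m' ->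
  tau (realpt R m) -> tau (realpt R m') -> share G tau m m'.
Proof.
move=> [y [y0 tE]] /asboolP[c [cs cm cm']] tm tm'.
have fc : is_face [set x | cone c x /\ dot y x = 0] (cone c).
  by exists y; split=> // x /cs; apply: y0.
have [_ _ /(_ _ _ fc)[c' cE] _] := fG; apply/asboolP; exists c'.
rewrite cE; split=> [x [/cs sx yx]||].
- by rewrite tE.
- by split=> //; move: tm; rewrite tE => -[].
- by split=> //; move: tm'; rewrite tE => -[].
Qed.

Lemma share_sub sigma tau m m' : tau `<=` sigma -> share G tau m m' -> share G sigma m m'.
Proof.
move=> ts /asboolP[c [ct cm cm']]; apply/asboolP; exists c; split=> // x /ct; exact: ts.
Qed.

(** If a sum of two points of [c1] lies in the face common to [c1] and [c2], both summands do. The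
    condition becomes symmetric in the three points, which is the associativity of the truncated
    product. *)
Lemma share3 sigma m1 m2 m3 : share G sigma m2 m3 && share G sigma m1 (m2 + m3) =
  `[< exists c : G, [/\ cone c `<=` sigma, cone c (realpt R m1), cone c (realpt R m2) &
        cone c (realpt R m3)] >].
Proof.
apply/andP/asboolP=> [[/asboolP[c1 [s1 c12 c13]] /asboolP[c2 [s2 c21 c223]]]|].
  have [_ _ _ h] := fG; have [f1 _] := h c1 c2.
  rewrite realptD in c223.
  have [_ h2] : (cone c1 `&` cone c2) (realpt R m2).
    by apply: (face_addl f1 c12 c13); split=> //; apply: fan_coneD.
  have [_ h3] : (cone c1 `&` cone c2) (realpt R m3).
    by apply: (face_addl f1 c13 c12); rewrite addrC; split=> //; apply: fan_coneD.
  by exists c2.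
move=> [c [cs c1 c2 c3]]; split; apply/asboolP; exists c; split=> //.
by rewrite realptD; apply: fan_coneD.
Qed.

Lemma starCA sigma (a b c : falg sigma) : star G a (star G b c) = star G b (star G a c).
Proof.
move: c; apply: malg_linP => [||k].
- exact: (lin_comp (star_linr _ a) (star_linr _ b)).
- exact: (lin_comp (star_linr _ b) (star_linr _ a)).
rewrite -mono_val.
apply: (star_bilinP (f := fun a b => star G a (star G b (mono sigma (val k))))
  (h := fun a b => star G b (star G a (mono sigma (val k))))).
- by move=> b0; apply: star_linl.
- by move=> a0; apply: (lin_comp (star_linr _ a0) (star_linl _ _)).
- by move=> b0; apply: (lin_comp (star_linr _ b0) (star_linl _ _)).
- by move=> a0; apply: star_linl.
move=> m m'; rewrite !star_mono.
have E : share G sigma m' (val k) && share G sigma m (m' + val k) =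
         share G sigma m (val k) && share G sigma m' (m + val k).
  rewrite !share3; congr asbool; apply/propext.
  by split=> -[c [h1 h2 h3 h4]]; exists c.
have fE (t : bool) m0 m1 : star G (mono sigma m0) (if t then mono sigma m1 else 0) =
    if t && share G sigma m0 m1 then mono sigma (m0 + m1) else 0.
  case: t; first by rewrite star_mono.
  exact: (linf0 (star_linr _ _)).
by rewrite !fE E addrCA.
Qed.

Definition rst sigma tau : falg sigma -> falg tau :=
  mext (fun k : latpt sigma => mono tau (val k)).

Lemma rst_lin sigma tau : linear (@rst sigma tau). Proof. exact: mext_lin. Qed.

Lemma rst_mono sigma tau m : tau `<=` sigma -> rst tau (mono sigma m) = mono tau m.
Proof.
move=> ts; have [hm|hm] := pselect (sigma (realpt R m)).
  by have [k <- ->] := mono_in hm; rewrite /rst mextU.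
by rewrite (mono_out hm) (linf0 (@rst_lin _ _)) mono_out // => /ts.
Qed.

Lemma rst_id sigma (a : falg sigma) : rst sigma a = a.
Proof.
move: a; apply: malg_linP => [||k]; [exact: rst_lin | exact: lin_id |].
by rewrite /rst mextU mono_val.
Qed.

Lemma rst_comp sigma tau rho (a : falg sigma) : tau `<=` sigma -> rho `<=` tau ->
  rst rho (rst tau a) = rst rho a.
Proof.
move=> ts rt; move: a; apply: malg_linP => [||k].
- exact: (lin_comp (@rst_lin _ _) (@rst_lin _ _)).
- exact: rst_lin.
by rewrite -mono_val !rst_mono // => x /rt/ts.
Qed.

(** A sum of two points of [sigma] lies in the face [tau] only if both do, so killing the monomials
    off [tau] is multiplicative. *)
Lemma rst_star sigma tau (a b : falg sigma) : is_face tau sigma ->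
  rst tau (star G a b) = star G (rst tau a) (rst tau b).
Proof.
move=> ft; have ts := face_sub ft.
apply: (star_bilinP (f := fun a b => rst tau (star G a b))
  (h := fun a b => star G (rst tau a) (rst tau b))).
- by move=> b0; apply: (lin_comp (@rst_lin _ _) (star_linl _ _)).
- by move=> a0; apply: (lin_comp (@rst_lin _ _) (star_linr _ _)).
- by move=> b0; apply: (lin_comp (star_linl _ _) (@rst_lin _ _)).
- by move=> a0; apply: (lin_comp (star_linr _ _) (@rst_lin _ _)).
move=> m m'; rewrite star_mono !rst_mono // star_mono.
case st: (share G tau m m'); first by rewrite (share_sub ts st) rst_mono.
case ss: (share G sigma m m'); last exact: (linf0 (@rst_lin _ _)).
rewrite rst_mono // mono_out // realptD => h.
have hm := share_inl ss; have hm' := share_inr ss.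
suff : share G tau m m' by rewrite st.
apply: (share_face ft ss); first exact: face_addl ft hm hm' h.
by apply: (face_addl ft hm' hm); rewrite addrC.
Qed.

Lemma rst_dlog sigma tau g l : tau `<=` sigma ->
  rst tau (dlog g sigma l) = dlog g tau l.
Proof.
move=> ts; rewrite /dlog (mext_comp _ _ (@rst_lin _ _)); apply: eq_in_mext => u _.
by rewrite (linfZ (@rst_lin _ _)) rst_mono.
Qed.
End FaceRestriction.

Section MonomialGrading.
Variables (K : fieldType) (Y : choiceType) (T : eqType) (deg : Y -> T).

Definition malg_hom (t : T) : set {malg K[Y]} :=
  [set b | forall p, p \in monalg.msupp b -> t = deg p].

Lemma malg_homP t b : malg_hom t b <-> forall p, monalg.mcoeff p b != 0 -> t = deg p.
Proof. by split=> h p; [rewrite monalg.mcoeff_neq0 => /h | rewrite -monalg.mcoeff_neq0 => /h]. Qed.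

Lemma malg_hom_lin t a x y : malg_hom t x -> malg_hom t y -> malg_hom t (a *: x + y).
Proof.
move=> /malg_homP hx /malg_homP hy; apply/malg_homP.
by apply: (@supported_lin K Y [set p | t = deg p]).
Qed.

Lemma malg_hom0 t : malg_hom t 0.
Proof. by apply/malg_homP => p; rewrite monalg.mcoeff0 eqxx. Qed.

Lemma malg_homU p : malg_hom (deg p) << p >>.
Proof. by apply/malg_homP; apply: (@supportedU K Y [set q | deg p = deg q]). Qed.

Lemma malg_grading : is_grading malg_hom.
Proof.
have hc := @mcoeff_lin K Y; split.
- by move=> t x; elim/lspan_ind=> [|a u v hu hv]; [apply: malg_hom0 | apply: malg_hom_lin].
- move=> x; pose y t := mext (fun p => if deg p == t then << p >> else 0 : {malg K[Y]}) x.
  exists (undup (map deg (monalg.msupp x))), y; split=> [t|].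
    rewrite /y /mext; elim/big_ind: _ => [|u v hu hv|p _]; first exact: malg_hom0.
      by rewrite -[u]scale1r; apply: malg_hom_lin.
    rewrite -[_ *: _]addr0; apply: malg_hom_lin; last exact: malg_hom0.
    by case: eqP => [<-|_]; [apply: malg_homU | apply: malg_hom0].
  rewrite {1}[x]malg_sumE /y /mext exchange_big; apply: eq_big_seq => p px /=.
  rewrite -scaler_sumr; congr (_ *: _).
  rewrite (bigD1_seq (deg p)) ?undup_uniq ?mem_undup ?map_f //= eqxx.
  by rewrite big1 ?addr0 // => t /negPf; rewrite eq_sym => ->.
move=> D y uD hy s0 t tD; apply/monalg.malgP => p; rewrite monalg.mcoeff0.
have yE t' : t' != deg p -> monalg.mcoeff p (y t') = 0.
  move=> ne; apply/eqP/negPn/negP => h; have /malg_homP/(_ p h) e := hy t'.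
  by rewrite e eqxx in ne.
have [tp|/yE //] := eqVneq t (deg p).
have : monalg.mcoeff p (\sum_(t <- D) y t) = 0 by rewrite s0 monalg.mcoeff0.
rewrite (linf_sum (hc p)) (bigD1_seq t) //= big1 ?addr0 // => t' ne.
by apply: yE; rewrite -tp.
Qed.

Lemma malg_hom_img (E : lmodType K) (H : set E) (f : {malg K[Y]} -> E) t b :
  linear f -> lspan H `<=` H -> (forall p, t = deg p -> H (f << p >>)) ->
  malg_hom t b -> H (f b).
Proof.
move=> hf HH h hb; apply: HH; rewrite [b]malg_sumE (linf_sum hf).
apply: lspan_sum => p pb _; rewrite (linfZ hf); apply/lspanZ/lspan_gen.
by apply: h; apply: hb.
Qed.
End MonomialGrading.

(** * The coefficient sheaf *)

Definition form_act (R : realType) n (Psi : cone_family R (n + n)) (F : gsheaf Psi)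
    (eta : Psi) (l : 'rV[complex R]_(n + n)) (x : stalk F eta) : stalk F eta :=
  \sum_i l 0 i *: act i x.

Definition maximal_ideal (R : realType) n (Psi : cone_family R (n + n)) (F : gsheaf Psi)
    (eta : Psi) : set (stalk F eta) :=
  [set x | exists z : 'I_(n + n) -> stalk F eta, x = \sum_i act i (z i)].

(** The lift is also required to be homogeneous whenever the boundary section is; the extended sheaf
    maps then respect the grading. *)
Definition boundary_onto_hom (R : realType) n (Psi : cone_family R (n + n)) (F : gsheaf Psi) :=
  forall (eta : Psi) (s : forall gamma, stalk F gamma), boundary_section eta s ->
  exists x : stalk F eta, (forall gamma, face_lt gamma eta -> res gamma x = s gamma) /\
    forall t, (forall gamma, face_lt gamma eta -> hpart t (s gamma)) -> hpart t x.

(* [V], with its homogeneous parts [HV], is a complement [sigma @ T] of the maximal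
   ideal in the kernel of the boundary map at [theta]. *)
Record primitive_part (R : realType) n (Psi : cone_family R (n + n)) (F : gsheaf Psi)
    (theta : Psi) (V : lmodType (complex R)) (HV : R * R -> set V) (Y : choiceType)
    (w : Y -> V) (T : set Y) (c : V -> {malg (complex R)[Y]}) (deg : Y -> R * R)
    (sigma : Y -> stalk F theta) : Prop := PrimitivePart {
  prim_crd : coordinates w T c;
  prim_hom : forall y, T y -> hpart (deg y) (sigma y);
  prim_res : forall y gamma, T y -> face_lt gamma theta -> res gamma (sigma y) = 0;
  prim_crd_hom : forall t v y, HV t v -> monalg.mcoeff y (c v) != 0 -> deg y = t;
  prim_gen_hom : forall y, T y -> HV (deg y) (w y);
  prim_span : forall x, (forall gamma, face_lt gamma theta -> res gamma x = 0) ->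
    exists2 z, supported T z & maximal_ideal (x - mext sigma z);
  prim_free : forall z, supported T z -> maximal_ideal (mext sigma z) -> z = 0 }.

Record primitive_data (R : realType) n (Psi : cone_family R (n + n)) (F : gsheaf Psi)
    (theta : Psi) (V : lmodType (complex R)) (HV : R * R -> set V) := PrimitiveData {
  prim_gens : choiceType;
  prim_vec : prim_gens -> V;
  prim_set : set prim_gens;
  prim_coord : V -> {malg (complex R)[prim_gens]};
  prim_deg : prim_gens -> R * R;
  prim_sec : prim_gens -> stalk F theta;
  primP : primitive_part HV prim_vec prim_set prim_coord prim_deg prim_sec }.

(** The forms of [s] span the coordinate forms on the cone, so the ideal of the sequence is the
    whole maximal ideal. *)
Definition regular_at (R : realType) n (Psi : cone_family R (n + n)) (F : gsheaf Psi)
    (eta : Psi) := exists (I : eqType) (l : I -> 'rV[complex R]_(n + n)) (s : seq I),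
  regseq (fun i => form_act (F := F) (eta := eta) (l i)) s /\
  forall j, exists a : I -> complex R, forall y, cspan (cone eta) y ->
    y 0 j = \sum_(i <- s) a i * dot (l i) y.

Section MonomialSheaf.
Variables (R : realType) (n : nat).
Local Notation C := (complex R).
Local Notation lattice := 'rV[int]_n.
Variables (S S' G G' : cone_family R n) (psi psi' : 'rV[R]_n -> R).
Variables (g g' : {malg C[lattice]}).
Hypotheses (fS : is_fan S) (fS' : is_fan S') (fG : is_fan G) (fG' : is_fan G').
Hypothesis psiD : forall (c : S) x y, cone c x -> cone c y -> psi (x + y) = psi x + psi y.
Hypothesis psiD' : forall (c : S') x y, cone c x -> cone c y -> psi' (x + y) = psi' x + psi' y.
Hypothesis psi_ge0 : forall (c : S) x, cone c x -> 0 <= psi x.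
Hypothesis psi_ge0' : forall (c : S') x, cone c x -> 0 <= psi' x.
Hypothesis psi1 : forall u, u \in monalg.msupp g' -> psi (realpt R u) = 1.
Hypothesis psi1' : forall u, u \in monalg.msupp g -> psi' (realpt R u) = 1.
Local Notation B := (B_sheaf S S' G G' psi psi' g g').
Implicit Types (eta gamma beta theta : Phi S S').

Definition bideg eta (p : bimon eta) : R * R :=
  (psi (realpt R (val p.1)), psi' (realpt R (val p.2))).

(* The stalks, restrictions and actions of [B_sheaf], stated on the bare free
   modules so that unification does not have to unfold [B_sheaf]. *)
Local Notation BM eta := {malg C[(latpt (lcone eta) * latpt (rcone eta))%type]}.
Fact bmod_key : unit. Proof. by []. Qed.
Definition bres eta gamma : BM eta -> BM gamma :=
  locked_with bmod_key (mext (fun p => bimono gamma (val p.1) (val p.2) : BM gamma)).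
Definition bact eta (i : 'I_(n + n)) : BM eta -> BM eta :=
  locked_with bmod_key (@B_act _ _ S S' G G' g g' eta i : BM eta -> BM eta).
Lemma bresE eta gamma : @bres eta gamma = @res _ _ _ B eta gamma.
Proof. by rewrite /bres locked_withE. Qed.
Lemma bactE eta i : @bact eta i = @act _ _ _ B eta i.
Proof. by rewrite /bact locked_withE. Qed.
Definition bform eta (l : 'rV[C]_(n + n)) (x : BM eta) : BM eta :=
  \sum_i l 0 i *: bact i x.

Lemma bimonoE eta m l : bimono eta m l = mtens (mono (lcone eta) m) (mono (rcone eta) l).
Proof.
have [hm|hm] := pselect (lcone eta (realpt R m)); last first.
  rewrite (mono_out hm) (linf0 (mtens_linl _)) /bimono insubN //.
  exact/asboolP.
have [hl|hl] := pselect (rcone eta (realpt R l)); last first.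
  rewrite (mono_out hl) (linf0 (mtens_linr _)) /bimono.
  by case: insubP => // k _ _; rewrite insubN //; apply/asboolP.
have [k km ->] := mono_in hm; have [k' km' ->] := mono_in hl.
by rewrite mtensU /bimono -km -km' !valK.
Qed.

Lemma bimono_val eta (p : bimon eta) : bimono eta (val p.1) (val p.2) = << p >>.
Proof. by case: p => k k'; rewrite bimonoE !mono_val mtensU. Qed.

Lemma bimono_out eta m l : ~ (lcone eta (realpt R m) /\ rcone eta (realpt R l)) ->
  bimono eta m l = 0.
Proof.
rewrite bimonoE => h; have [hm|hm] := pselect (lcone eta (realpt R m)).
  by rewrite (@mono_out _ _ _ l) ?(linf0 (mtens_linr _)) // => hl; apply: h.
by rewrite mono_out // (linf0 (mtens_linl _)).
Qed.

Lemma mulx_lin eta u : linear (@mulx _ _ S S' G eta u : BM eta -> BM eta). Proof. exact: mext_lin. Qed.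
Lemma muly_lin eta u : linear (@muly _ _ S S' G' eta u : BM eta -> BM eta). Proof. exact: mext_lin. Qed.

Lemma mulxE eta u (a : falg (lcone eta)) (b : falg (rcone eta)) :
  (mulx G u : BM eta -> BM eta) (mtens a b) = mtens (star G (mono _ u) a) b.
Proof.
apply: (@bilin_malgP _ _ _ _ (fun a b => (mulx G u : BM eta -> BM eta) (mtens a b))
  (fun a b => mtens (star G (mono _ u) a) b)).
- by move=> b0; apply: (lin_comp (@mulx_lin eta u) (mtens_linl b0)).
- by move=> a0; apply: (lin_comp (@mulx_lin eta u) (mtens_linr a0)).
- by move=> b0; apply: (lin_comp (mtens_linl b0) (star_linr _ _)).
- by move=> a0; apply: mtens_linr.
move=> y y'; rewrite mtensU /mulx mextU /= bimonoE -[in RHS](mono_val y) star_mono mono_val.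
by case: ifP => _ //; rewrite (linf0 (mtens_linl _)).
Qed.

Lemma mulyE eta v (a : falg (lcone eta)) (b : falg (rcone eta)) :
  (muly G' v : BM eta -> BM eta) (mtens a b) = mtens a (star G' (mono _ v) b).
Proof.
apply: (@bilin_malgP _ _ _ _ (fun a b => (muly G' v : BM eta -> BM eta) (mtens a b))
  (fun a b => mtens a (star G' (mono _ v) b))).
- by move=> b0; apply: (lin_comp (@muly_lin eta v) (mtens_linl b0)).
- by move=> a0; apply: (lin_comp (@muly_lin eta v) (mtens_linr a0)).
- by move=> b0; apply: mtens_linl.
- by move=> a0; apply: (lin_comp (mtens_linr a0) (star_linr _ _)).
move=> y y'; rewrite mtensU /muly mextU /= bimonoE -[in RHS](mono_val y') star_mono mono_val.
by case: ifP => _ //; rewrite (linf0 (mtens_linr _)).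
Qed.

Lemma dot_clattice_delta (u : lattice) i : dot (delta_mx 0 i) (clattice R u) = (u 0 i)%:~R.
Proof. by rewrite dot_delta mxE. Qed.

Lemma B_act_lin eta i : linear (@bact eta i).
Proof.
rewrite bactE /= /B_act; case: (fintype.split i) => j; apply: mext_linp => u; apply: lin_scale.
  exact: mulx_lin.
exact: muly_lin.
Qed.

Lemma B_actl eta i (a : falg (lcone eta)) (b : falg (rcone eta)) :
  bact (lshift n i) (mtens a b) =
  mtens (star G (dlog g' (lcone eta) (delta_mx 0 i)) a) b.
Proof.
rewrite bactE /= /B_act; have /= -> := unsplitK (inl i : 'I_n + 'I_n).
rewrite /dlog (mext_comp _ _ (star_linl _ a)) (mext_comp _ _ (mtens_linl b)).
apply: eq_in_mext => u _; rewrite (linfZ (star_linl _ a)) (linfZ (mtens_linl b)).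
by rewrite mulxE dot_clattice_delta.
Qed.

Lemma B_actr eta i (a : falg (lcone eta)) (b : falg (rcone eta)) :
  bact (rshift n i) (mtens a b) =
  mtens a (star G' (dlog g (rcone eta) (delta_mx 0 i)) b).
Proof.
rewrite bactE /= /B_act; have /= -> := unsplitK (inr i : 'I_n + 'I_n).
rewrite /dlog (mext_comp _ _ (star_linl _ b)) (mext_comp _ _ (mtens_linr a)).
apply: eq_in_mext => u _; rewrite (linfZ (star_linl _ b)) (linfZ (mtens_linr a)).
by rewrite mulyE dot_clattice_delta.
Qed.

Lemma bform_mtens eta (l : 'rV[C]_(n + n)) (a : falg (lcone eta)) (b : falg (rcone eta)) :
  bform l (mtens a b) =
  mtens (star G (dlog g' (lcone eta) (lsubmx l)) a) b +
  mtens a (star G' (dlog g (rcone eta) (rsubmx l)) b).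
Proof.
rewrite /bform big_split_ord /=.
congr (_ + _).
  rewrite dlog_sumE (linf_sum (star_linl _ a)) (linf_sum (mtens_linl b)).
  apply: eq_bigr => i _; rewrite (linfZ (star_linl _ a)) (linfZ (mtens_linl b)) mxE.
  by rewrite -B_actl.
rewrite dlog_sumE (linf_sum (star_linl _ b)) (linf_sum (mtens_linr a)).
apply: eq_bigr => i _; rewrite (linfZ (star_linl _ b)) (linfZ (mtens_linr a)) mxE.
by rewrite -B_actr.
Qed.

Lemma bform_linr eta l : linear (@bform eta l).
Proof. by apply: lin_sum => i _; apply/lin_scale/B_act_lin. Qed.

Lemma B_res_lin eta gamma : linear (@bres eta gamma).
Proof. by rewrite bresE; apply: mext_lin. Qed.

Lemma B_res_bimono eta gamma m l : face_le gamma eta ->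
  bres gamma (bimono eta m l) = bimono gamma m l.
Proof.
move=> /(Phi_leP fS fS')[hl hr].
have [[hm hl']|h] := pselect (lcone eta (realpt R m) /\ rcone eta (realpt R l)).
  have [k <- kE] := mono_in hm; have [k' <- kE'] := mono_in hl'.
  by rewrite {1}bimonoE kE kE' mtensU bresE /= mextU.
rewrite !bimono_out ?(linf0 (@B_res_lin _ _)) // => -[h1 h2].
by apply: h; split; [apply: hl | apply: hr].
Qed.

Lemma B_resE eta gamma (a : falg (lcone eta)) (b : falg (rcone eta)) : face_le gamma eta ->
  bres gamma (mtens a b) = mtens (rst (lcone gamma) a) (rst (rcone gamma) b).
Proof.
move=> ge; have hr0 := @B_res_lin eta gamma.
apply: (@bilin_malgP _ _ _ _
  (fun (a : falg (lcone eta)) (b : falg (rcone eta)) => bres gamma (mtens a b))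
  (fun a b => mtens (rst (lcone gamma) a) (rst (rcone gamma) b))).
- by move=> b0; exact: (lin_comp hr0 (mtens_linl b0)).
- by move=> a0; exact: (lin_comp hr0 (mtens_linr a0)).
- by move=> b0; exact: (lin_comp (mtens_linl (rst (rcone gamma) b0))
    (@rst_lin _ _ (lcone eta) (lcone gamma))).
- by move=> a0; exact: (lin_comp (mtens_linr (rst (lcone gamma) a0))
    (@rst_lin _ _ (rcone eta) (rcone gamma))).
move=> y y'; have [hl hr] := proj1 (Phi_leP fS fS' _ _) ge.
by rewrite -(mono_val y) -(mono_val y') -bimonoE (B_res_bimono _ _ ge) bimonoE
  (rst_mono _ hl) (rst_mono _ hr).
Qed.

Lemma cspan_l eta (u : lattice) : lcone eta (realpt R u) ->
  cspan (cone eta) (row_mx (clattice R u) 0).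
Proof.
move=> h; apply: lspan_gen; exists (row_mx (realpt R u) 0).
  by apply: (proj2 (Phi_coneE _ _ _)); split=> //; apply: rcone0.
rewrite map_row_mx map_mx0; congr row_mx.
by apply/rowP => i; rewrite !mxE rmorph_int.
Qed.
Lemma cspan_r eta (u : lattice) : rcone eta (realpt R u) ->
  cspan (cone eta) (row_mx 0 (clattice R u)).
Proof.
move=> h; apply: lspan_gen; exists (row_mx 0 (realpt R u)).
  by apply: (proj2 (Phi_coneE _ _ _)); split=> //; apply: lcone0.
rewrite map_row_mx map_mx0; congr row_mx.
by apply/rowP => i; rewrite !mxE rmorph_int.
Qed.

Lemma mext_eq0 k (h : {malg C['rV[int]_k]}) (s : set 'rV[R]_k) l :
  (forall u, s (realpt R u) -> dot l (clattice R u) = 0) -> dlog h s l = 0.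
Proof.
move=> hl; apply: mext0 => u.
have [hu|hu] := pselect (s (realpt R u)); first by rewrite hl ?scale0r.
by rewrite (mono_out hu) scaler0.
Qed.

Lemma bres_id eta (x : BM eta) : bres eta x = x.
Proof.
move: x; apply: mtens_linP => [||a b]; [exact: B_res_lin | exact: lin_id |].
by rewrite (B_resE _ _ (Phi_refl fS fS' eta)) !rst_id.
Qed.

Lemma bres_comp eta gamma beta (x : BM eta) : face_le gamma eta -> face_le beta gamma ->
  bres beta (bres gamma x) = bres beta x.
Proof.
move=> ge bg; move: x; apply: mtens_linP => [||a b].
- exact: (lin_comp (@B_res_lin gamma beta) (@B_res_lin eta gamma)).
- exact: B_res_lin.
have be := Phi_trans fS fS' bg ge.
have [hl hr] := proj1 (Phi_leP fS fS' _ _) ge; have [hl' hr'] := proj1 (Phi_leP fS fS' _ _) bg.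
by rewrite (B_resE _ _ ge) (B_resE _ _ bg) (B_resE _ _ be) (rst_comp _ hl hl') (rst_comp _ hr hr').
Qed.

Lemma bact_comm eta i j (x : BM eta) : bact i (bact j x) = bact j (bact i x).
Proof.
move: x; apply: mtens_linP => [||a b].
- exact: (lin_comp (@B_act_lin eta i) (@B_act_lin eta j)).
- exact: (lin_comp (@B_act_lin eta j) (@B_act_lin eta i)).
rewrite -(splitK i) -(splitK j).
case: (fintype.split i) (fintype.split j) => i0 [] j0 /=.
- rewrite !B_actl; exact: (congr1 (fun z => mtens z b) (starCA fG _ _ a)).
- by rewrite B_actr !B_actl B_actr.
- by rewrite B_actl !B_actr B_actl.
- rewrite !B_actr; exact: (congr1 (fun z => mtens a z) (starCA fG' _ _ b)).
Qed.

Lemma bform_van eta (l : 'rV[C]_(n + n)) (x : BM eta) :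
  (forall y, cspan (cone eta) y -> dot l y = 0) -> bform l x = 0.
Proof.
move=> hl; move: x; apply: mtens_linP => [||a b]; [exact: bform_linr | exact: lin_0 |].
rewrite bform_mtens !mext_eq0 => [|u hu|u hu].
- by rewrite (linf0 (star_linl G a)) (linf0 (star_linl G' b))
    (linf0 (mtens_linl b)) (linf0 (mtens_linr a)) addr0.
- by have := hl _ (cspan_r hu); rewrite -{1}[l]hsubmxK dot_row dot0r add0r.
- by have := hl _ (cspan_l hu); rewrite -{1}[l]hsubmxK dot_row dot0r addr0.
Qed.

Lemma bres_act eta gamma i (x : BM eta) : face_le gamma eta ->
  bres gamma (bact i x) = bact i (bres gamma x).
Proof.
move=> ge; move: x; apply: mtens_linP => [||a b].
- exact: (lin_comp (@B_res_lin eta gamma) (@B_act_lin eta i)).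
- exact: (lin_comp (@B_act_lin gamma i) (@B_res_lin eta gamma)).
have [hl hr] := proj1 (Phi_leP fS fS' _ _) ge.
rewrite -(splitK i); case: (fintype.split i) => i0 /=.
  by rewrite B_actl !(B_resE _ _ ge) B_actl (rst_star fG _ _ (lcone_face fS fS' ge)) (rst_dlog _ _ hl).
by rewrite B_actr !(B_resE _ _ ge) B_actr (rst_star fG' _ _ (rcone_face fS fS' ge)) (rst_dlog _ _ hr).
Qed.

Lemma bideg_spanned eta t : lspan (malg_hom (@bideg eta) t : set (BM eta)) `<=` malg_hom (@bideg eta) t.
Proof. by case: (malg_grading C (@bideg eta)) => h _ _; apply: h. Qed.

Lemma bimono_hom eta m l :
  malg_hom (@bideg eta) (psi (realpt R m), psi' (realpt R l)) (bimono eta m l : BM eta).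
Proof.
have [[h1 h2]|h] := pselect (lcone eta (realpt R m) /\ rcone eta (realpt R l)).
  have [k kE k1] := mono_in h1; have [k' kE' k1'] := mono_in h2.
  rewrite bimonoE k1 k1' mtensU -kE -kE'; exact: (@malg_homU _ _ _ (@bideg eta) (k, k')).
by rewrite (bimono_out h); apply: malg_hom0.
Qed.

Lemma bres_hom eta gamma t (x : BM eta) : face_le gamma eta ->
  malg_hom (@bideg eta) t x -> malg_hom (@bideg gamma) t (bres gamma x).
Proof.
move=> ge; apply: malg_hom_img; [exact: B_res_lin | exact: bideg_spanned | move=> p ->].
by rewrite -bimono_val (B_res_bimono _ _ ge); apply: bimono_hom.
Qed.

Lemma bact_hom eta i t (x : BM eta) : malg_hom (@bideg eta) t x ->
  malg_hom (@bideg eta) (t + var_degree R i) (bact i x).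
Proof.
apply: malg_hom_img; [exact: B_act_lin | exact: bideg_spanned | move=> p ->].
have p1 := latptP p.1; have p2 := latptP p.2.
rewrite bactE /= /var_degree /B_act; case: (fintype.split i) => i0.
  apply: bideg_spanned; apply: lspan_sum => u ug _; apply/lspanZ/lspanZ/lspan_gen.
  rewrite /mulx mextU; case: ifP => [/share_inl hu|_]; last exact: malg_hom0.
  rewrite addrC; have -> : (1, 0) + bideg p = (psi (realpt R (u + val p.1)), psi' (realpt R (val p.2))).
    by rewrite realptD (psiD hu p1) (psi1 ug) -[psi' _ in RHS]add0r.
  exact: bimono_hom.
apply: bideg_spanned; apply: lspan_sum => u ug _; apply/lspanZ/lspanZ/lspan_gen.
rewrite /muly mextU; case: ifP => [/share_inl hu|_]; last exact: malg_hom0.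
rewrite addrC; have -> : (0, 1) + bideg p = (psi (realpt R (val p.1)), psi' (realpt R (u + val p.2))).
  by rewrite realptD (psiD' hu p2) (psi1' ug) -[psi _ in RHS]add0r.
exact: bimono_hom.
Qed.

Lemma bformE eta l : @bform eta l = @form_act _ _ _ B eta l.
Proof.
rewrite /bform; have -> // : @bact eta = @act _ _ _ B eta.
by apply: functional_extensionality_dep => i; apply: bactE.
Qed.

Lemma B_gsheaf : is_gsheaf B.
Proof.
split.
- by move=> eta gamma; rewrite -bresE; apply: B_res_lin.
- by move=> eta x; rewrite -bresE; apply: bres_id.
- by move=> eta gamma beta x; rewrite -!bresE; apply: bres_comp.
- by move=> eta i; rewrite -bactE; apply: B_act_lin.
- by move=> eta i j x; rewrite -!bactE; apply: bact_comm.
- move=> eta l hl x; have := bform_van x hl; rewrite bformE; exact.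
- by move=> eta gamma i x ge; rewrite -!bactE -!bresE; apply: bres_act.
- by move=> eta; apply: malg_grading.
- by move=> eta gamma t x ge; rewrite -bresE; apply: bres_hom.
- by move=> eta i t x; rewrite -bactE; apply: bact_hom.
Qed.

(** Coefficients are indexed by lattice points instead of points of one cone, so that stalks over
    different cones can be compared at the same index. *)
Definition bcof eta (m l : lattice) : BM eta -> C^o :=
  mext (fun p => ((val p.1 == m) && (val p.2 == l))%:R : C^o).

Lemma bcof_lin eta m l : linear (@bcof eta m l). Proof. exact: mext_lin. Qed.

Lemma bcof_bimono eta m l m' l' : lcone eta (realpt R m') -> rcone eta (realpt R l') ->
  bcof m l (bimono eta m' l') = ((m' == m) && (l' == l))%:R.
Proof.
move=> hm hl; have [k kE k1] := mono_in hm; have [k' kE' k1'] := mono_in hl.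
by rewrite bimonoE k1 k1' mtensU /bcof mextU /= kE kE'.
Qed.

Lemma bcofE eta (p : bimon eta) (x : BM eta) :
  bcof (val p.1) (val p.2) x = monalg.mcoeff p x.
Proof.
move: x; apply: (@malg_linP _ _ C^o); [exact: bcof_lin | exact: mcoeff_lin | move=> q].
rewrite /bcof mextU monalg.mcoeffU; by congr (nat_of_bool _)%:R.
Qed.

Lemma bcof_res eta gamma m l (x : BM eta) : face_le gamma eta ->
  lcone gamma (realpt R m) -> rcone gamma (realpt R l) -> bcof m l (bres gamma x) = bcof m l x.
Proof.
move=> ge hm hl; move: x; apply: (@malg_linP _ _ C^o) => [||q].
- exact: (lin_comp (@bcof_lin gamma m l) (@B_res_lin eta gamma)).
- exact: bcof_lin.
rewrite -bimono_val (B_res_bimono _ _ ge) (bcof_bimono _ _ (latptP q.1) (latptP q.2)).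
have [[h1 h2]|h] := pselect (lcone gamma (realpt R (val q.1)) /\ rcone gamma (realpt R (val q.2))).
  by rewrite bcof_bimono.
rewrite (bimono_out h) (linf0 (@bcof_lin gamma m l)).
by case: eqP => // e1; case: eqP => // e2; case: h; rewrite e1 e2.
Qed.

(** To each monomial on the boundary, [pk] assigns one proper face containing it. The lift takes its
    coefficient there from the section on that face and has no interior monomials; being built
    monomial by monomial, it stays in the degree of the section. *)
Lemma B_boundary_onto : boundary_onto_hom B.
Proof.
move=> eta s hs.
pose mem gamma (m l : lattice) := `[< lcone gamma (realpt R m) /\ rcone gamma (realpt R l) >].
pose pk m l := [pick gamma : Phi S S' | `[< face_lt gamma eta >] && mem gamma m l].
pose f gamma : BM gamma -> BM eta := mext (fun q : bimon gamma =>
  if pk (val q.1) (val q.2) == Some gamma then bimono eta (val q.1) (val q.2) else 0 : BM eta).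
have f_lin gamma : linear (@f gamma) by apply: mext_lin.
have fE gamma m l (y : BM gamma) : face_le gamma eta ->
    bcof m l (f gamma y) = if pk m l == Some gamma then bcof m l y else 0.
  move=> ge; have [hl hr] := proj1 (Phi_leP fS fS' _ _) ge.
  pose h (y : BM gamma) : C^o := if pk m l == Some gamma then bcof m l y else 0.
  move: y; apply: (@malg_linP _ _ C^o (fun y => bcof m l (f gamma y)) h) => [||q].
  - exact: (lin_comp (@bcof_lin eta m l) (f_lin gamma)).
  - by rewrite /h; case: (pk m l == Some gamma); [apply: bcof_lin | apply: lin_0].
  have q1 := latptP q.1; have q2 := latptP q.2.
  rewrite /f mextU /h -(bimono_val q) (bcof_bimono _ _ q1 q2).
  have [e|ne] := boolP ((val q.1 == m) && (val q.2 == l)).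
    have /andP[/eqP e1 /eqP e2] := e; rewrite e1 e2; case: ifP => _; last exact: (linf0 (@bcof_lin eta m l)).
    by rewrite bcof_bimono ?eqxx // -?e1 -?e2; [apply: hl | apply: hr].
  rewrite if_same; case: ifP => _; last exact: (linf0 (@bcof_lin eta m l)).
  by rewrite bcof_bimono ?(negPf ne) //; [apply: hl | apply: hr].
pose x : BM eta := \sum_(gamma | `[< face_lt gamma eta >]) f gamma (s gamma).
exists x; split=> [gamma lt_ge|t ht]; last first.
  apply: bideg_spanned; rewrite /x; apply: lspan_sum => gamma _ /asboolP lt_ge.
  apply: lspan_gen; have := ht _ lt_ge; apply: malg_hom_img; [exact: f_lin | exact: bideg_spanned |].
  move=> p ->; rewrite /f mextU; case: ifP => _; last exact: malg_hom0.
  exact: bimono_hom.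
rewrite -bresE; apply/monalg.malgP => p; rewrite -!bcofE.
have p1 := latptP p.1; have p2 := latptP p.2.
rewrite (bcof_res _ (proj1 lt_ge) p1 p2) /x (linf_sum (@bcof_lin _ _ _)).
move: (val p.1) (val p.2) p1 p2 => m l hm hl.
under eq_bigr => beta /asboolP[be _] do rewrite (fE beta m l (s beta) be).
case E: (pk m l) => [beta|]; last first.
  move: E; rewrite /pk; case: pickP => // /(_ gamma); rewrite /mem.
  by move/asboolP: lt_ge => -> /=; move/negbT/asboolP; case.
have [lt_be [bm bl]] : face_lt beta eta /\ (lcone beta (realpt R m) /\ rcone beta (realpt R l)).
  by move: E; rewrite /pk; case: pickP => // b /andP[/asboolP h1 /asboolP h2] [<-].
have lt_be' : `[< face_lt beta eta >] by apply/asboolP.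
rewrite (bigD1 beta) //= eqxx big1 ?addr0 => [|b /andP[_ /negPf nb]]; last first.
  by case: eqP => // -[bE]; rewrite bE eqxx in nb.
(* The chosen face and [gamma] both contain the monomial, so their intersection does, and there the
   two sections agree. *)
have [delta [d1 d2 dl dr]] := Phi_meet fS fS' (proj1 lt_be) (proj1 lt_ge).
have dm : lcone delta (realpt R m) by rewrite dl.
have dl' : rcone delta (realpt R l) by rewrite dr.
rewrite -(bcof_res (s beta) d1 dm dl') -(bcof_res (s gamma) d2 dm dl') !bresE.
by rewrite (hs _ _ lt_be d1) (hs _ _ lt_ge d2).
Qed.

Lemma B_nonneg eta t (x : stalk B eta) : hpart t x -> x <> 0 -> 0 <= t.1 + t.2.
Proof.
move=> hx x0; have [p px] : exists p, monalg.mcoeff p (x : BM eta) != 0.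
  apply: contrapT => h; apply: x0; apply/monalg.malgP => p; rewrite monalg.mcoeff0.
  by apply/eqP/negPn/negP => px; apply: h; exists p.
rewrite monalg.mcoeff_neq0 in px; rewrite (hx p px) /=; apply: addr_ge0;
  first exact: (psi_ge0 (latptP p.1)).
exact: (psi_ge0' (latptP p.2)).
Qed.

Lemma interior_supp eta (x : BM eta) : (forall gamma, face_lt gamma eta -> bres gamma x = 0) ->
  supported [set p | relpt p.1 /\ relpt p.2] x.
Proof.
move=> hx p px; apply/(Phi_relintP fS fS' (latptP p.1) (latptP p.2)) => gamma lt [h1 h2].
have := bcof_res x (proj1 lt) h1 h2; rewrite hx // (linf0 (@bcof_lin _ _ _)) bcofE => e.
by rewrite -e eqxx in px.
Qed.

Lemma interior_res eta gamma (p : bimon eta) : face_lt gamma eta ->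
  relpt p.1 -> relpt p.2 -> bres gamma (<< p >> : BM eta) = 0.
Proof.
move=> lt h1 h2; rewrite -bimono_val (B_res_bimono _ _ (proj1 lt)) bimono_out //.
exact: (proj2 (Phi_relintP fS fS' (latptP p.1) (latptP p.2))).
Qed.

Section MaximalIdeal.
Variable eta : Phi S S'.
Let sg := lcone eta.
Let sg' := rcone eta.

Definition bmax : set (BM eta) :=
  [set x | exists z : 'I_(n + n) -> BM eta, x = \sum_i bact i (z i)].

Lemma bmaxE : bmax = @maximal_ideal _ _ _ B eta.
Proof.
rewrite /bmax; have -> // : @bact eta = @act _ _ _ B eta.
by apply: functional_extensionality_dep => i; apply: bactE.
Qed.

Lemma bmax_lin a x y : bmax x -> bmax y -> bmax (a *: x + y).
Proof.
move=> [z ->] [u ->]; exists (fun i => a *: z i + u i).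
rewrite scaler_sumr -big_split; apply: eq_bigr => i _ /=.
by rewrite (@B_act_lin eta i).
Qed.
Lemma bmax0 : bmax 0.
Proof. by exists (fun=> 0); rewrite big1 // => i _; apply: (linf0 (@B_act_lin eta i)). Qed.

Lemma bmax_form l x : bmax (bform l x).
Proof. by exists (fun i => l 0 i *: x); apply: eq_bigr => i _; rewrite (linfZ (@B_act_lin eta i)). Qed.

Lemma bform_l l (a : falg sg) (b : falg sg') :
  bform (row_mx l 0) (mtens a b) = mtens (star G (dlog g' sg l) a) b.
Proof.
rewrite bform_mtens row_mxKl row_mxKr (linf0 (dlog_lin g sg')).
by rewrite (linf0 (star_linl G' b)) (linf0 (mtens_linr a)) addr0.
Qed.
Lemma bform_r l (a : falg sg) (b : falg sg') :
  bform (row_mx 0 l) (mtens a b) = mtens a (star G' (dlog g sg' l) b).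
Proof.
rewrite bform_mtens row_mxKl row_mxKr (linf0 (dlog_lin g' sg)).
by rewrite (linf0 (star_linl G a)) (linf0 (mtens_linl b)) add0r.
Qed.

Lemma bmax_jacl (a : falg sg) (b : falg sg') :
  lspan (jac G g' (sigma := sg)) a -> bmax (mtens a b).
Proof.
elim/lspan_ind=> [|c _ y [l [a0 ->]] hy]; first by rewrite (linf0 (mtens_linl b)); apply: bmax0.
rewrite (mtens_linl b); apply: bmax_lin => //.
by rewrite starC -bform_l; apply: bmax_form.
Qed.
Lemma bmax_jacr (a : falg sg) (b : falg sg') :
  lspan (jac G' g (sigma := sg')) b -> bmax (mtens a b).
Proof.
elim/lspan_ind=> [|c _ y [l [b0 ->]] hy]; first by rewrite (linf0 (mtens_linr a)); apply: bmax0.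
rewrite (mtens_linr a); apply: bmax_lin => //.
by rewrite starC -bform_r; apply: bmax_form.
Qed.

Variables (T : set (latpt sg)) (nf : falg sg -> falg sg).
Variables (T' : set (latpt sg')) (nf' : falg sg' -> falg sg').
Hypotheses (hnf : normal_form G g' T nf) (hnf' : normal_form G' g T' nf').

(** The normal form modulo the maximal ideal of the stalk, which is the sum of the two Jacobian
    ideals, each tensored with the other factor. *)
Definition binf : BM eta -> BM eta := mext (fun p => mtens (nf << p.1 >>) (nf' << p.2 >>)).

Lemma binf_lin : linear binf. Proof. exact: mext_lin. Qed.

Lemma binf_mtens (a : falg sg) (b : falg sg') : binf (mtens a b) = mtens (nf a) (nf' b).
Proof.
apply: (@bilin_malgP _ _ _ _ (fun a b => binf (mtens a b)) (fun a b => mtens (nf a) (nf' b))).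
- by move=> b0; exact: (lin_comp binf_lin (mtens_linl b0)).
- by move=> a0; exact: (lin_comp binf_lin (mtens_linr a0)).
- by move=> b0; exact: (lin_comp (mtens_linl (nf' b0)) (nf_lin hnf)).
- by move=> a0; exact: (lin_comp (mtens_linr (nf a0)) (nf_lin hnf')).
by move=> y y'; rewrite mtensU /binf mextU.
Qed.

Lemma binf_mod x : bmax (x - binf x).
Proof.
have hsub a b : bmax (mtens a b - binf (mtens a b)).
  rewrite binf_mtens.
  have -> : mtens a b - mtens (nf a) (nf' b) =
      1 *: mtens (a - nf a) b + mtens (nf a) (b - nf' b).
    rewrite scale1r (linfB (mtens_linl b)) (linfB (mtens_linr (nf a))).
    by rewrite addrA subrK.
  apply: bmax_lin; first by apply: bmax_jacl; apply: (nf_mod hnf).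
  by apply: bmax_jacr; apply: (nf_mod hnf').
rewrite {1}[x]malg_sumE [X in binf X]malg_sumE (linf_sum binf_lin) -sumrB.
elim/big_ind: _ => [|u v hu hv|[k k'] _]; first exact: bmax0.
  by rewrite -[u]scale1r; apply: bmax_lin.
rewrite (linfZ binf_lin) -scalerBr -[_ *: _]addr0; apply: bmax_lin; last exact: bmax0.
by rewrite -mtensU.
Qed.

Lemma binf_max x : bmax x -> binf x = 0.
Proof.
move=> [z ->]; rewrite (linf_sum binf_lin) big1 // => i _.
move: (z i); apply: mtens_linP => [||a b].
- exact: (lin_comp binf_lin (@B_act_lin eta i)).
- exact: lin_0.
rewrite -(splitK i); case: (fintype.split i) => i0 /=.
  rewrite B_actl starC binf_mtens (nf_jac hnf) ?(linf0 (mtens_linl _)) //.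
  by apply: lspan_gen; exists (delta_mx 0 i0), a.
rewrite B_actr starC binf_mtens (nf_jac hnf') ?(linf0 (mtens_linr _)) //.
by apply: lspan_gen; exists (delta_mx 0 i0), b.
Qed.

Definition primitive_gens : set (bimon eta) :=
  [set p | (T `&` relpt (sigma := sg)) p.1 /\ (T' `&` relpt (sigma := sg')) p.2].

Lemma binf_id z : supported primitive_gens z -> binf z = z.
Proof.
move=> hz; rewrite [RHS]malg_sumE /binf /mext; apply: eq_big_seq => -[k k'].
rewrite -monalg.mcoeff_neq0 => /hz [[Tk _] [Tk' _]].
by rewrite (nf_id hnf Tk) (nf_id hnf' Tk') mtensU.
Qed.

Lemma binf_interior x : supported [set p | relpt p.1 /\ relpt p.2] x ->
  supported primitive_gens (binf x).
Proof.
move=> hx; rewrite /binf /mext big_seq.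
elim/big_ind: _ => [|u v hu hv|[k k'] /=].
- by move=> y; rewrite monalg.mcoeff0 eqxx.
- by rewrite -[u]scale1r; apply: supported_lin.
rewrite -monalg.mcoeff_neq0 => /hx [rk rk'].
rewrite -[X in supported _ X]addr0; apply: supported_lin; last first.
  by move=> y; rewrite monalg.mcoeff0 eqxx.
move=> [y y']; rewrite mcoeff_mtens mulf_eq0 negb_or => /andP[h h'].
split; split.
- exact: (nf_supp hnf) h.
- exact: (nf_rel hnf rk) h.
- exact: (nf_supp hnf') h'.
- exact: (nf_rel hnf' rk') h'.
Qed.
End MaximalIdeal.

(** The sections are the basis monomials interior in both factors. A section vanishing on the
    boundary involves interior monomials only, and its normal form is its class modulo the maximal
    ideal. *)
Lemma B_primitive theta :
  inhabited (primitive_data B theta (fun t => @Vmult_homog _ _ S S' G G' psi psi' g g' theta t)).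
Proof.
have [T [nf hnf]] := normal_form_exists G g' (lcone theta).
have [T' [nf' hnf']] := normal_form_exists G' g (rcone theta).
have hc := tensor_coordinates (R1_coordinates hnf) (R1_coordinates hnf').
apply: (inhabits (@PrimitiveData _ _ _ B theta _ _ (bimon theta : choiceType)
  (fun p => tpure (R1_gen G g' p.1) (R1_gen G' g p.2)) (primitive_gens T T')
  (tensor_crd (R1_crd nf) (R1_crd nf')) (@bideg theta) (fun p => << p >> : BM theta) _)).
have sumE (z : BM theta) : mext (fun p => << p >> : BM theta) z = z by rewrite [RHS]malg_sumE.
have cl := crd_lin hc.
split=> //.
- by move=> p _; apply: (@malg_homU _ _ _ (@bideg theta)).
- by move=> p gamma [[_ h1] [_ h2]] lt; rewrite -bresE; apply: interior_res.
- move=> t v [p1 p2] hv; apply: contraNeq => ne; apply/eqP.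
  apply: (lspan_ker (lin_comp (mcoeff_lin (p1, p2)) cl) _ hv) => _ [a [b [ha hb ->]]].
  rewrite (tensor_crd_pure (R1_coordinates hnf) (R1_coordinates hnf')) mcoeff_mtens.
  apply/eqP/negPn; apply: contra ne.
  rewrite mulf_eq0 negb_or => /andP[h1 h2]; apply/eqP.
  rewrite [RHS]surjective_pairing; congr (_, _).
    apply: (R1_crd_homog hnf _ ha h1) => k1 k2.
    by apply: (nf_homog _ _ hnf); [apply: psiD | move=> u ug _; apply: psi1].
  apply: (R1_crd_homog hnf' _ hb h2) => k1 k2.
  by apply: (nf_homog _ _ hnf'); [apply: psiD' | move=> u ug _; apply: psi1'].
- move=> p [[_ h1] [_ h2]]; apply: lspan_gen; exists (R1_gen G g' p.1), (R1_gen G' g p.2).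
  by split=> //; apply: R1_gen_homog.
- move=> x hx; exists (binf nf nf' x).
    apply: (binf_interior hnf hnf'); apply: interior_supp => gamma lt.
    by rewrite bresE; apply: hx.
  by rewrite sumE -bmaxE; apply: (binf_mod hnf hnf').
- move=> z hz; rewrite sumE -bmaxE => /(binf_max hnf hnf') <-.
  by rewrite (binf_id hnf hnf').
Qed.

Section RegularData.
Variable eta : Phi S S'.
Let sg := lcone eta.
Let sg' := rcone eta.

Lemma contrr_bform (phi : falg sg' -> C^o) l (z : BM eta) : linear phi ->
  contrr phi (bform (row_mx l 0) z) = star G (dlog g' sg l) (contrr phi z).
Proof.
move=> hp; move: z; apply: mtens_linP => [||a b].
- exact: (lin_comp (contrr_lin phi) (@bform_linr eta _)).
- exact: (lin_comp (star_linr G _) (contrr_lin phi)).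
by rewrite bform_l !(contrr_mtens _ _ hp) (linfZ (star_linr G _)).
Qed.
Lemma contrl_bform (phi : falg sg -> C^o) l (z : BM eta) : linear phi ->
  contrl phi (bform (row_mx 0 l) z) = star G' (dlog g sg' l) (contrl phi z).
Proof.
move=> hp; move: z; apply: mtens_linP => [||a b].
- exact: (lin_comp (contrl_lin phi) (@bform_linr eta _)).
- exact: (lin_comp (star_linr G' _) (contrl_lin phi)).
by rewrite bform_r !(contrl_mtens _ _ hp) (linfZ (star_linr G' _)).
Qed.
Lemma contrl_bform0 (phi : falg sg -> C^o) l (z : BM eta) : linear phi ->
  (forall x, lspan (jac G g' (sigma := sg)) x -> phi x = 0) ->
  contrl phi (bform (row_mx l 0) z) = 0.
Proof.
move=> hp h0; move: z; apply: mtens_linP => [||a b].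
- exact: (lin_comp (contrl_lin phi) (@bform_linr eta _)).
- exact: lin_0.
rewrite bform_l (contrl_mtens _ _ hp) starC h0 ?scale0r //.
by apply: lspan_gen; exists l, a.
Qed.

(** The indices below [m] in decreasing order, since [regseq] lists a sequence in reverse. *)
Definition prefix k m : seq 'I_k := pmap insub (rev (iota 0 m)).

Lemma prefixS k m (mk : (m < k)%N) : prefix k m.+1 = Ordinal mk :: prefix k m.
Proof. by rewrite /prefix -addn1 iotaD rev_cat /= add0n insubT. Qed.
Lemma mem_prefix k m (i : 'I_k) : (i \in prefix k m) = (i < m)%N.
Proof. by rewrite /prefix mem_pmap_sub mem_rev mem_iota add0n. Qed.
Lemma prefix_uniq k m : uniq (prefix k m).
Proof. by rewrite /prefix pmap_sub_uniq // rev_uniq iota_uniq. Qed.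
Lemma big_prefix (E : nmodType) k m (F : 'I_k -> E) :
  \sum_(i <- prefix k m) F i = \sum_(i < k | (i < m)%N) F i.
Proof. by rewrite big_uniq ?prefix_uniq //; apply: eq_bigl => i; rewrite mem_prefix. Qed.
Lemma big_prefix_full (E : nmodType) k (F : 'I_k -> E) :
  \sum_(i <- prefix k k) F i = \sum_i F i.
Proof. by rewrite big_prefix; apply: eq_bigl => i; rewrite ltn_ord. Qed.

Variables (k k' : nat) (l : 'I_k -> 'rV[C]_n) (l' : 'I_k' -> 'rV[C]_n).
Hypotheses (bl : form_basis sg l) (bl' : form_basis sg' l').
Hypothesis reg : regular_sequence G (fun i => dlog g' sg (l i)).
Hypothesis reg' : regular_sequence G' (fun i => dlog g sg' (l' i)).

Definition join_form (i : 'I_k + 'I_k') : 'rV[C]_(n + n) :=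
  match i with inl i => row_mx (l i) 0 | inr j => row_mx 0 (l' j) end.
Let o i : BM eta -> BM eta := bform (join_form i).
Let olin i : linear (o i). Proof. exact: bform_linr. Qed.
Let sl m := map (@inl 'I_k 'I_k') (prefix k m).
Let sr m := map (@inr 'I_k 'I_k') (prefix k' m).

Let sl_uniq m : uniq (sl m).
Proof. by rewrite map_inj_uniq ?prefix_uniq // => i j []. Qed.
Let sr_uniq m : uniq (sr m).
Proof. by rewrite map_inj_uniq ?prefix_uniq // => i j []. Qed.

(** These forms act on the left factor alone. Contracting with a coefficient functional of the right
    factor reduces regularity to that in the left face algebra, one right monomial at a time. *)
Lemma regseq_left m : (m <= k)%N -> regseq o (sl m).
Proof.
elim: m => // m IH mk; rewrite /sl (prefixS mk) /=; split; first by apply: IH; apply: ltnW.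
move=> z /(inidealP _ olin (sl_uniq m))[a]; rewrite big_map big_prefix => e.
have zP (y : latpt sg') : fideal G (fun j : 'I_k => (j < m)%N)
    (fun i => dlog g' sg (l i)) (contrr (monalg.mcoeff y) z).
  have [r _] := reg; apply: (r (Ordinal mk)).
  exists (fun j => contrr (monalg.mcoeff y) (a (inl j))).
  rewrite -(contrr_bform _ _ (mcoeff_lin y)) -[bform _ z]/(o (inl (Ordinal mk)) z) e.
  rewrite (linf_sum (contrr_lin _)); apply: eq_bigr => j _.
  by rewrite /o (contrr_bform _ _ (mcoeff_lin y)) starC.
have [D ->] := contrr_sum z; apply: inideal_sum => // y.
have [b ->] := zP y; rewrite (linf_sum (mtens_linl _)) -big_prefix big_seq.
apply: (big_ind (inideal o setT (sl m))) => [|u v|j jm].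
- exact: inideal0.
- exact: inidealD.
rewrite starC -bform_l; apply: (@inideal_gen _ _ _ o (sl m) (inl j)) => //.
exact: map_f.
Qed.

(** Modulo the left sequence the stalk is the left Jacobian quotient tensored with the right face
    algebra. As the lists are reversed, the left sequence is the tail [sl k]. *)
Lemma regseq_right m : (m <= k')%N -> regseq o (sr m ++ sl k).
Proof.
elim: m => [_|m IH mk]; first exact: regseq_left.
rewrite /sr (prefixS mk) /=; split; first by apply: IH; apply: ltnW.
move=> z /inideal_cat[u [v [/(inidealP _ olin (sr_uniq m))[a ->]]]].
move=> /(inidealP _ olin (sl_uniq k))[b ->]; rewrite !big_map big_prefix => e.
have [T [nf hnf]] := normal_form_exists G g' sg.
(* The coordinates on the left Jacobian quotient: they kill the left part of the relation and leave
   a relation in the right face algebra. *)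
pose phi (t : latpt sg) (x : falg sg) : C^o := monalg.mcoeff t (nf x).
have phi_lin t : linear (phi t) by apply: (lin_comp (mcoeff_lin t) (nf_lin hnf)).
have phi0 t x : lspan (jac G g' (sigma := sg)) x -> phi t x = 0.
  by move=> hx; rewrite /phi (nf_jac hnf) // monalg.mcoeff0.
have zP t : fideal G' (fun j : 'I_k' => (j < m)%N)
    (fun i => dlog g sg' (l' i)) (contrl (phi t) z).
  have [r _] := reg'; apply: (r (Ordinal mk)).
  exists (fun j => contrl (phi t) (a (inr j))).
  rewrite -(contrl_bform _ _ (phi_lin t)) -[bform _ z]/(o (inr (Ordinal mk)) z) e.
  rewrite (linfD (contrl_lin _)) !(linf_sum (contrl_lin _)) [X in _ + X]big1 ?addr0.
    by apply: eq_bigr => j _; rewrite /o (contrl_bform _ _ (phi_lin t)) starC.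
  by move=> j _; rewrite /o (contrl_bform0 _ _ (phi_lin t) (phi0 t)).
(* The left normal form of [z]: its coordinates lie in the right ideal, and [z - nz] lies in the
   left one. *)
pose nz : BM eta := mext (fun p => mtens (nf << p.1 >>) << p.2 >>) z.
have nzE t : contrl (monalg.mcoeff t) nz = contrl (phi t) z.
  rewrite /nz (mext_comp _ _ (contrl_lin _)); apply: eq_in_mext => p _.
  by rewrite (contrl_mtens _ _ (mcoeff_lin t)).
rewrite -[z](subrK nz) addrC; apply/inideal_cat; exists nz, (z - nz); split=> //.
  have [D ->] := contrl_sum nz; apply: inideal_sum => // t; rewrite nzE.
  have [c ->] := zP t; rewrite (linf_sum (mtens_linr _)) -big_prefix big_seq.
  apply: (big_ind (inideal o setT (sr m))) => [|x y|j jm].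
  - exact: inideal0.
  - exact: inidealD.
  rewrite starC -bform_r; apply: (@inideal_gen _ _ _ o (sr m) (inr j)) => //.
  exact: map_f.
rewrite {1}[z]malg_sumE /nz /mext -sumrB.
apply: inideal_sum => // p; rewrite -scalerBr; apply: inidealZ => //.
rewrite {1}[p]surjective_pairing -mtensU -(linfB (mtens_linl << p.2 >>)).
have [c ->] := jac_decomp bl (nf_mod hnf << p.1 >>).
rewrite (linf_sum (mtens_linl _)); apply: inideal_sum => // j.
rewrite starC -bform_l; apply: (@inideal_gen _ _ _ o (sl k) (inl j)) => //.
by apply: map_f; rewrite mem_prefix ltn_ord.
Qed.

Lemma cspan_split y : cspan (cone eta) y -> cspan sg (lsubmx y) /\ cspan sg' (rsubmx y).
Proof.
move=> hy; split; move: y hy; apply: lspan_img.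
- by move=> a u v; apply/rowP => i; rewrite !mxE.
- move=> _ [_ [u [v [hu hv ->]]] <-]; apply: lspan_gen; exists u => //.
  by rewrite map_row_mx row_mxKl.
- by move=> a u v; apply/rowP => i; rewrite !mxE.
- move=> _ [_ [u [v [hu hv ->]]] <-]; apply: lspan_gen; exists v => //.
  by rewrite map_row_mx row_mxKr.
Qed.

Lemma join_form_span j : exists a : 'I_k + 'I_k' -> C, forall y, cspan (cone eta) y ->
  y 0 j = \sum_(i <- sr k' ++ sl k) a i * dot (join_form i) y.
Proof.
have dl (f : 'rV[C]_n) y : dot (row_mx f 0) y = dot f (lsubmx y).
  by rewrite -{1}[y]hsubmxK dot_row dot0l addr0.
have dr (f : 'rV[C]_n) y : dot (row_mx 0 f) y = dot f (rsubmx y).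
  by rewrite -{1}[y]hsubmxK dot_row dot0l add0r.
rewrite -(splitK j); case: (fintype.split j) => j0 /=.
  have [_ /(_ (delta_mx 0 j0))[a aP]] := bl.
  exists (fun i => match i with inl i => a i | inr _ => 0 end) => y /cspan_split[hy _].
  rewrite big_cat !big_map /= big1 ?add0r => [|i _]; last by rewrite mul0r.
  rewrite big_prefix_full; have := aP _ hy; rewrite dot_delta mxE => ->.
  by apply: eq_bigr => i _; rewrite dl.
have [_ /(_ (delta_mx 0 j0))[a aP]] := bl'.
exists (fun i => match i with inl _ => 0 | inr i => a i end) => y /cspan_split[_ hy].
rewrite big_cat !big_map /= [X in _ + X]big1 ?addr0 => [|i _]; last by rewrite mul0r.
rewrite big_prefix_full; have := aP _ hy; rewrite dot_delta mxE => ->.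
by apply: eq_bigr => i _; rewrite dr.
Qed.
End RegularData.

Lemma B_regular eta : facewise_regular G S g' -> facewise_regular G' S' g ->
  regular_at B eta.
Proof.
move=> /(_ (val eta).1)[k [l [bl rl]]] /(_ (val eta).2)[k' [l' [bl' rl']]].
exists ('I_k + 'I_k')%type, (join_form l l').
exists (map inr (prefix k' k') ++ map inl (prefix k k)); split; last exact: join_form_span.
have E : (fun i => @bform eta (join_form l l' i)) =
    fun i => @form_act _ _ _ B eta (join_form l l' i).
  by apply: functional_extensionality_dep => i; apply: bformE.
rewrite -E; exact: (regseq_right bl rl rl' (leqnn k')).
Qed.

End MonomialSheaf.

(** * Graded Nakayama lemma *)

Section GradedNakayama.
Variables (R : realType) (n : nat) (E : lmodType (complex R)).
Variables (X : 'I_(n + n) -> E -> E) (H : R * R -> set E).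
Hypotheses (Xlin : forall i, linear (X i)) (gH : is_grading H).
Hypothesis HX : forall i t x, H t x -> H (t + var_degree R i) (X i x).

(** The variables have bidegree $(1,0)$ or $(0,1)$, so each of them has total degree one. *)
Definition tdeg (t : R * R) : R := t.1 + t.2.

Lemma tdegD t t' : tdeg (t + t') = tdeg t + tdeg t'.
Proof. by rewrite /tdeg addrACA. Qed.
Lemma tdeg_var i : tdeg (@var_degree R n i) = 1.
Proof. by rewrite /tdeg /var_degree; case: (fintype.split i) => _ /=; rewrite ?addr0 ?add0r. Qed.

Lemma hom_spanned t : lspan (H t) `<=` H t. Proof. by case: gH. Qed.

(** For a submodule [W], the inclusion in [spanhom W (fun=> True)] says that [W] is a graded
    submodule. *)
Definition spanhom (A : set E) (P : R * R -> Prop) : set E :=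
  lspan [set u | A u /\ exists2 t, P t & H t u].

Lemma homog_spanhom x : spanhom setT (fun=> True) x.
Proof.
have [D [y [hy ->]]] := homog_decomp gH x; apply: lspan_sum => t _ _.
by apply: lspan_gen; split=> //; exists t.
Qed.

(** Degrees are real, so the induction is on an integer bound for the total degree: removing one
    variable lowers the total degree, hence the bound, by one. Below zero there is nothing left. *)
Lemma graded_nakayama (W : set E) :
  (forall t x, H t x -> x <> 0 -> 0 <= tdeg t) ->
  lspan W `<=` W -> (forall i x, W x -> W (X i x)) ->
  W `<=` spanhom W (fun=> True) ->
  (forall b, exists w z, W w /\ b = w + \sum_i X i (z i)) -> forall b, W b.
Proof.
move=> pos WW WX Wh Wb.
have step N : forall t b, H t b -> tdeg t < N%:R -> W b.
  elim: N => [|N IH] t b hb tN.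
    have [->|/eqP b0] := eqVneq b 0; first by apply: WW; apply: lspan0.
    by have := pos _ _ hb b0; rewrite leNgt tN.
  pose A := [set u | exists2 s, H s u & W u \/
    exists i z s', [/\ H s' z, s = s' + var_degree R i & u = X i z]].
  have hA : lspan A b.
    have [w [z [Ww ->]]] := Wb b; apply: lspanD.
      by apply: lspan_mono (Wh _ Ww) => u [Wu [s _ hs]]; exists s => //; left.
    apply: lspan_sum => i _ _; have := homog_spanhom (z i).
    apply: lspan_img => // u [_ [s _ hs]]; apply: lspan_gen.
    by exists (s + var_degree R i); [apply: HX | right; exists i, u, s].
  have [k [a [v [Av bE]]]] := hA.
  pose s i := projT1 (cid2 (Av i)).
  have hs i : H (s i) (v i) by rewrite /s; case: cid2.
  (* Only the terms of degree exactly [t] are kept: they lie in [W], or are [X j z] with [z] one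
     degree lower. *)
  have := grading_pickable gH (r := index_enum 'I_k) (z := fun i => a i *: v i) (e := s) _ hb bE.
  move=> -> => [|i _]; last by apply: hom_spanned; apply/lspanZ/lspan_gen.
  apply: WW; apply: lspan_sum => i _ /eqP st; apply/lspanZ/lspan_gen.
  rewrite /s in st; case: cid2 st => s0 hs0 /= [//|[j [z [s' [hz sE ->]]]]] st.
  apply: WX; apply: (IH s') => //.
  by move: tN; rewrite -st sE tdegD tdeg_var -natr1 ltrD2r.
move=> b; have [D [y [hy ->]]] := homog_decomp gH b.
apply: WW; apply: lspan_sum => t _ _; apply: lspan_gen.
have [N tN] : exists N, tdeg t < N%:R.
  exists (Num.bound `|tdeg t|); apply: le_lt_trans (ler_norm _) _.
  exact: archi_boundP.
exact: step tN.
Qed.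

Fixpoint idealpow (j : nat) (x : E) : Prop :=
  if j is j'.+1 then exists z : 'I_(n + n) -> E,
    (forall i, idealpow j' (z i)) /\ x = \sum_i X i (z i)
  else True.

(** The elements of the [j]-th power live in total degrees at least [N + j], whereas [x] has
    finitely many homogeneous components. For large [j] all of them must vanish. *)
Lemma idealpow_eq0 (N : R) x : (forall y, spanhom setT (fun t => N <= tdeg t) y) ->
  (forall j, idealpow j x) -> x = 0.
Proof.
move=> hN hx.
have lower j : forall y, idealpow j y -> spanhom setT (fun t => N + j%:R <= tdeg t) y.
  elim: j => [|j IH] y /=; first by rewrite addr0 => _; apply: hN.
  move=> [z [hz ->]]; apply: lspan_sum => i _ _.
  apply: lspan_img (IH _ (hz i)) => // u [_ [t ht hu]]; apply: lspan_gen; split=> //.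
  exists (t + var_degree R i); last exact: HX.
  by rewrite tdegD tdeg_var -natr1 addrA lerD2r.
have [D [y [hy xE]]] := homog_decomp gH x.
have [j hj] : exists j : nat, forall t, t \in D -> tdeg t < N + j%:R.
  elim: (D) => [|t D' [j hj]]; first by exists 0%N.
  exists (maxn j (Num.bound `|tdeg t - N|)) => t'; rewrite inE => /orP[/eqP ->|/hj h].
    rewrite -ltrBlDl; apply: le_lt_trans (ler_norm _) _.
    by apply: lt_le_trans (archi_boundP (normr_ge0 _)) _; rewrite ler_nat leq_maxr.
  by apply: lt_le_trans h _; rewrite lerD2l ler_nat leq_maxl.
have [k [a [v [Av xE']]]] := lower j x (hx j).
pose s i := let: conj _ h := Av i in projT1 (cid2 h).
have hs i : H (s i) (v i) /\ N + j%:R <= tdeg (s i).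
  by rewrite /s; case: (Av i) => _ h; case: cid2.
pose z (i : R * R + 'I_k) := match i with inl t => y t | inr i => - (a i *: v i) end.
pose e (i : R * R + 'I_k) := match i with inl t => t | inr i => s i end.
have E0 : 0 = \sum_(i <- map inl D ++ map inr (index_enum 'I_k)) z i.
  by rewrite big_cat !big_map /= -xE sumrN -xE' subrr.
have pick t : t \in D -> \sum_(t' <- D | t' == t) y t' = 0.
  move=> tD; have zP i : i \in map inl D ++ map inr (index_enum 'I_k) -> H (e i) (z i).
    case: i => [t' _|i _] /=; first exact: hy.
    by rewrite -scaleNr; apply: hom_spanned; apply/lspanZ/lspan_gen; case: (hs i).
  have := grading_pickable gH zP (hom0 gH t) E0.
  rewrite big_cat !big_map /= [X in _ + X]big1 ?addr0; first by move=> <-.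
  by move=> i /eqP si; have [_] := hs i; rewrite leNgt si hj.
rewrite xE; transitivity (\sum_(t <- undup D) \sum_(t' <- D | t' == t) y t').
  rewrite (exchange_big_dep predT) //=; apply: eq_big_seq => t' t'D.
  rewrite big_mkcond (bigD1_seq t') ?undup_uniq ?mem_undup //= eqxx big1 ?addr0 // => t.
  by rewrite eq_sym => /negPf ->.
by rewrite big_seq big1 // => t; rewrite mem_undup => /pick.
Qed.
End GradedNakayama.

(** * Maps out of free stalks *)

Section FreeStalks.
Variables (R : realType) (n : nat) (Psi : cone_family R (n + n)).
Local Notation C := (complex R).
Implicit Types (F L B : gsheaf Psi) (eta gamma : Psi).

Definition mon_degree (m : 'X_{1..(n + n)}) : R * R := \sum_i var_degree R i *+ m i.

Lemma mon_act_hom F eta t (x : stalk F eta) m : is_gsheaf F -> hpart t x ->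
  hpart (t + mon_degree m) (mon_act (@act _ _ _ F eta) m x).
Proof.
move=> hF hx; rewrite /mon_act /mon_degree -big_enum /=.
elim: (enum _) => [|i s IH] /=; first by rewrite big_nil addr0.
rewrite big_cons addrCA addrC; elim: (m i) => [|k IHk]; first by rewrite addr0.
by rewrite mulrSr addrA; apply: homog_act.
Qed.

Lemma tdeg_mon_ge0 m : 0 <= tdeg (mon_degree m).
Proof.
rewrite /mon_degree; elim/big_ind: _ => [|u v hu hv|i _].
- by rewrite /tdeg /= addr0.
- by rewrite tdegD addr_ge0.
elim: (m i) => [|k IHk]; first by rewrite mulr0n /tdeg /= addr0.
by rewrite mulrSr tdegD tdeg_var addr_ge0.
Qed.

Lemma free_stalk_bounded F eta : is_gsheaf F -> free_stalk F eta ->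
  exists N, forall y, spanhom (@hpart _ _ _ F eta) setT (fun t => N <= tdeg t) y.
Proof.
move=> hF [k [e [t [ht [gen _]]]]].
exists (- \sum_i `|tdeg (t i)|) => y; have [p ->] := gen y.
apply: lspan_sum => i _ _; rewrite /poly_act; apply: lspan_sum => m _ _; apply: lspanZ.
apply: lspan_gen; split=> //; exists (t i + mon_degree m); last exact: mon_act_hom.
rewrite tdegD -[X in X <= _]addr0 lerD ?tdeg_mon_ge0 // lerNl.
rewrite (bigD1 i) //= -[X in X <= _]addr0 lerD ?sumr_ge0 //.
by rewrite -normrN ler_norm.
Qed.

(** The coefficients [p x] are chosen, not canonical. Two choices differ by polynomials vanishing on
    the cone, and these act by zero on the stalk of [B] too, so the map is well defined. *)
Lemma free_stalk_extend L B eta k (e : 'I_k -> stalk L eta) (t : 'I_k -> R * R)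
    (d : R * R) (y : 'I_k -> stalk B eta) :
  is_gsheaf L -> is_gsheaf B -> is_basis e -> (forall i, hpart (t i) (e i)) ->
  (forall i, hpart (t i + d) (y i)) ->
  exists Lam : stalk L eta -> stalk B eta, [/\ linear Lam,
    forall i x, Lam (act i x) = act i (Lam x), forall i, Lam (e i) = y i &
    forall s x, hpart s x -> hpart (s + d) (Lam x)].
Proof.
move=> hL hB [gen free] he hy.
pose p x := projT1 (cid (gen x)).
have pE x : x = \sum_i poly_act (@act _ _ _ L eta) (p x i) (e i).
  by rewrite /p; case: cid.
pose ev (q : 'I_k -> mpoly (n + n) C) := \sum_i poly_act (@act _ _ _ B eta) (q i) (y i).
have LX := @act_lin _ _ _ _ hL eta; have BX := @act_lin _ _ _ _ hB eta.
have LC := @act_comm _ _ _ _ hL eta; have BC := @act_comm _ _ _ _ hB eta.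
pose Lam x := ev (p x).
have LamE q : Lam (\sum_i poly_act (@act _ _ _ L eta) (q i) (e i)) = ev q.
  set x := \sum_i _; apply/eqP; rewrite -subr_eq0 /Lam /ev -sumrB big1 // => i _.
  have hl := poly_act_linl (@act _ _ _ B eta) (y i); rewrite -(linfB hl).
  apply: (poly_act_vanish (W := cspan (cone eta))) => //.
  - exact: lspan_idem.
  - by move=> l /(act_van hB).
  move=> u hu; apply: (free (fun i => p x i - q i)) => //.
  under eq_bigr => j _ do rewrite (linfB (poly_act_linl (@act _ _ _ L eta) (e j))).
  by rewrite sumrB -pE subrr.
have Lam_lin : linear Lam.
  move=> a u v; rewrite {1}(pE u) {1}(pE v) scaler_sumr -big_split /=.
  under eq_bigr => i _ do rewrite -(poly_act_linl (@act _ _ _ L eta) (e i)).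
  rewrite LamE /ev scaler_sumr -big_split; apply: eq_bigr => i _ /=.
  exact: poly_act_linl.
have Lam_act i x : Lam (act i x) = act i (Lam x).
  rewrite {1}(pE x) (linf_sum (LX i)).
  under eq_bigr => j _ do rewrite -poly_actXM //.
  rewrite LamE /ev (linf_sum (BX i)); apply: eq_bigr => j _.
  by rewrite poly_actXM.
have Lam_e i : Lam (e i) = y i.
  have -> : e i = \sum_j poly_act (@act _ _ _ L eta) (if j == i then 1 else 0) (e j).
    rewrite (bigD1 i) //= eqxx poly_act1 big1 ?addr0 // => j /negPf ->.
    exact: (linf0 (poly_act_linl _ _)).
  rewrite LamE /ev (bigD1 i) //= eqxx poly_act1 big1 ?addr0 // => j /negPf ->.
  exact: (linf0 (poly_act_linl _ _)).
exists Lam; split=> // s x hx.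
(* The chosen coefficients of a homogeneous element need not be homogeneous. The expansion is split
   into monomials and only those of the right degree are kept. *)
pose r := [seq (i, m) | i <- index_enum 'I_k, m <- mpoly.msupp (p x i)].
pose z (im : 'I_k * 'X_{1..(n + n)}) :=
  mpoly.mcoeff im.2 (p x im.1) *: mon_act (@act _ _ _ L eta) im.2 (e im.1).
pose dg (im : 'I_k * 'X_{1..(n + n)}) := t im.1 + mon_degree im.2.
have xE : x = \sum_(im <- r) z im.
  by rewrite big_allpairs_dep /= {1}(pE x).
have hg := homog_grading hL eta.
rewrite (grading_pickable hg (e := dg) _ hx xE) => [|im _]; last first.
  by apply: (hom_spanned hg); apply/lspanZ/lspan_gen; apply: mon_act_hom.
have hg' := homog_grading hB eta.
rewrite (linf_sum Lam_lin); apply: (hom_spanned hg'); apply: lspan_sum => im _ /eqP <-.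
rewrite (linfZ Lam_lin); apply/lspanZ/lspan_gen.
by rewrite (mon_act_map _ _ Lam_act) Lam_e addrAC; apply: mon_act_hom.
Qed.

Lemma act_gen_ext L B eta k (e : 'I_k -> stalk L eta) gamma (f h : stalk L eta -> stalk B gamma) :
  is_basis e -> linear f -> linear h ->
  (forall i x, f (act i x) = act i (f x)) -> (forall i x, h (act i x) = act i (h x)) ->
  (forall i, f (e i) = h (e i)) -> f =1 h.
Proof.
move=> [gen _] fl hl fa ha fh x; have [p ->] := gen x.
rewrite (linf_sum fl) (linf_sum hl); apply: eq_bigr => i _.
by rewrite (poly_act_map _ _ fl fa) (poly_act_map _ _ hl ha) fh.
Qed.

Lemma poly_act_max F eta p (x : stalk F eta) : is_gsheaf F ->
  exists (a : C) z, poly_act (@act _ _ _ F eta) p x = a *: x + \sum_i act i (z i).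
Proof.
move=> hF; have al := @act_lin _ _ _ _ hF eta; elim/mpolyind: p => [|c m q _ _ [a [z IH]]].
  exists 0, (fun=> 0); rewrite (linf0 (poly_act_linl _ _)) scale0r big1 ?addr0 // => i _.
  exact: (linf0 (al i)).
have [b [u mE]] : exists (b : C) u,
    mon_act (@act _ _ _ F eta) m x = b *: x + \sum_i act i (u i).
  have [->|m0] := eqVneq m 0%MM.
    exists 1, (fun=> 0); rewrite mon_act0 scale1r big1 ?addr0 // => i _.
    exact: (linf0 (al i)).
  have [i mi] : exists i, m i != 0%N.
    apply/existsP; apply: contraNT m0 => /existsPn h; apply/eqP/mnmP => i.
    by rewrite mnm0E; apply/eqP/negPn/h.
  have mE : m = (U_(i) + (m - U_(i)))%MM.
    apply/mnmP => j; rewrite mnmDE mnmBE mnm1E.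
    by have [<-|_] := eqVneq i j; rewrite ?subn0 // subnKC // lt0n.
  exists 0, (fun j => if j == i then mon_act (@act _ _ _ F eta) (m - U_(i))%MM x else 0).
  rewrite scale0r add0r {1}mE mon_actS; last exact: act_comm.
  rewrite (bigD1 i) //= eqxx big1 ?addr0 // => j /negPf ->; exact: (linf0 (al j)).
exists (c * b + a), (fun i => c *: u i + z i).
rewrite poly_act_linl IH poly_actX mE scalerDr scalerA scalerDl addrACA; congr (_ + _).
rewrite scaler_sumr -big_split; apply: eq_bigr => i _ /=.
by rewrite al.
Qed.
End FreeStalks.

(** * Decomposition of the sheaf *)

Section PureDecomposition.
Variables (R : realType) (n : nat) (Psi : cone_family R (n + n)).
Local Notation C := (complex R).
Hypothesis le_refl : forall eta : Psi, face_le eta eta.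
Hypothesis le_trans' : forall eta gamma beta : Psi,
  face_le beta gamma -> face_le gamma eta -> face_le beta eta.
Hypothesis le_anti' : forall eta gamma : Psi,
  face_le eta gamma -> face_le gamma eta -> eta = gamma.
Implicit Types (eta gamma theta : Psi).

Lemma face_le_lt_trans beta gamma eta :
  face_le beta gamma -> face_lt gamma eta -> face_lt beta eta.
Proof.
move=> bg [ge gne]; split; first exact: le_trans' ge.
by move=> be; apply: gne; apply: le_anti' => //; rewrite -be.
Qed.

Definition face_rank eta := #|[pred gamma : Psi | `[< face_le gamma eta >]]|.

Lemma face_rank_lt gamma eta : face_lt gamma eta -> (face_rank gamma < face_rank eta)%N.
Proof.
move=> [le ne]; apply: proper_card; apply/properP; split.
  by apply/fintype.subsetP => b; rewrite !inE => /asboolP bg; apply/asboolP/(le_trans' bg).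
exists eta; rewrite inE; first exact/asboolP.
by apply/negP => /asboolP ge; apply: ne; apply: le_anti'.
Qed.

Lemma face_lt_ind (P : Psi -> Prop) :
  (forall eta, (forall gamma, face_lt gamma eta -> P gamma) -> P eta) -> forall eta, P eta.
Proof.
move=> h eta; have [k] := ubnP (face_rank eta); elim: k eta => // k IH eta ek.
by apply: h => gamma /face_rank_lt lt; apply: IH; apply: leq_trans lt _.
Qed.

Variable B : gsheaf Psi.
Hypotheses (hB : is_gsheaf B) (hBO : boundary_onto_hom B).

Section Lift.
Variables (L : gsheaf Psi) (theta : Psi) (e0 : 'I_1 -> stalk L theta).
Hypotheses (hL : is_minimal_sheaf theta L) (he0 : hpart (0, 0) (e0 ord0)) (be0 : is_basis e0).
Variables (d : R * R) (z : stalk B theta).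
Hypotheses (hz : hpart d z) (rz : forall gamma, face_lt gamma theta -> res gamma z = 0).

Let sL : is_gsheaf L := proj1 (min_pure hL).

Record good_at (Lam : forall eta, stalk L eta -> stalk B eta) eta : Prop := GoodAt {
  good_lin : linear (Lam eta);
  good_act : forall i x, Lam eta (act i x) = act i (Lam eta x);
  good_hom : forall s x, hpart s x -> hpart (s + d) (Lam eta x);
  good_res : forall gamma x, face_le gamma eta -> res gamma (Lam eta x) = Lam gamma (res gamma x) }.

(** At [theta] the generator goes to the prescribed section [z]; at any other cone a homogeneous
    basis goes to lifts of the boundary values. The value at [theta] is transported by [eq_rect]
    because [eta] is only propositionally equal to it. *)
Lemma lift_step eta (Lam : forall eta, stalk L eta -> stalk B eta) :
  (forall gamma, face_lt gamma eta -> good_at Lam gamma) ->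
  exists f : stalk L eta -> stalk B eta, [/\ linear f,
    forall i x, f (act i x) = act i (f x),
    forall s x, hpart s x -> hpart (s + d) (f x),
    forall gamma x, face_lt gamma eta -> res gamma (f x) = Lam gamma (res gamma x) &
    forall e : theta = eta, f (eq_rect theta (stalk L) (e0 ord0) eta e) = eq_rect theta (stalk B) z eta e].
Proof.
move=> hLam.
suff [k [e [t [y [he [be [hy [ry fy]]]]]]]] : exists k (e : 'I_k -> stalk L eta)
    (t : 'I_k -> R * R) (y : 'I_k -> stalk B eta),
    (forall i, hpart (t i) (e i)) /\ is_basis e /\ (forall i, hpart (t i + d) (y i)) /\
    (forall i gamma, face_lt gamma eta -> res gamma (y i) = Lam gamma (res gamma (e i))) /\
    forall f, (forall i, f (e i) = y i) -> forall ee : theta = eta,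
      f (eq_rect theta (stalk L) (e0 ord0) eta ee) = eq_rect theta (stalk B) z eta ee.
  have [f [fl fa fe fh]] := free_stalk_extend sL hB be he hy.
  exists f; split=> // [gamma x lt|]; last exact: fy.
  have [le _] := lt; move: x; apply: (act_gen_ext (e := e)) => //.
  - exact: (lin_comp (@res_lin _ _ _ _ hB eta gamma) fl).
  - exact: (lin_comp (good_lin (hLam _ lt)) (@res_lin _ _ _ _ sL eta gamma)).
  - by move=> i x; rewrite fa (res_act hB).
  - by move=> i x; rewrite (res_act sL) // (good_act (hLam _ lt)).
  - by move=> i; rewrite fe ry.
have [ee|ne] := pselect (theta = eta).
  case: eta / ee hLam => hLam; exists 1%N, e0, (fun=> (0, 0)), (fun=> z).
  split; first by move=> i; rewrite (ord1 i).
  split=> //; split; first by move=> i; rewrite add0r.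
  split=> [i gamma lt|f fe ee]; last by rewrite !eq_axiomK fe.
  (* [L] vanishes on the proper faces of [theta], where [z] restricts to zero by hypothesis, so the
     two sides agree. *)
  have nle : ~ face_le theta gamma.
    by case: lt => le ne tg; apply: ne; apply: le_anti'.
  have -> : res gamma (e0 i) = 0 := min_supp hL nle _.
  by rewrite rz // (linf0 (good_lin (hLam _ lt))).
have [k [e [t [he be]]]] := proj1 (proj2 (min_pure hL) eta).
have lift i : exists y : stalk B eta, hpart (t i + d) y /\
    forall gamma, face_lt gamma eta -> res gamma y = Lam gamma (res gamma (e i)).
  have [gamma beta lt bg|y [ry hy]] := hBO (eta := eta) (s := fun gamma => Lam gamma (res gamma (e i))).
    by rewrite (good_res (hLam _ lt)) // (res_comp sL) //; case: lt.
  exists y; split=> //; apply: hy => gamma lt.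
  by apply: (good_hom (hLam _ lt)); apply: (homog_res sL) => //; case: lt.
pose y i := projT1 (cid (lift i)).
have yP i : hpart (t i + d) (y i) /\
    forall gamma, face_lt gamma eta -> res gamma (y i) = Lam gamma (res gamma (e i)).
  by rewrite /y; case: cid.
exists k, e, t, y; do 3!split=> //; first by move=> i; case: (yP i).
split=> [i gamma lt|f _ ee]; last by case: ne.
by have [_] := yP i; apply.
Qed.

(** Induction on the number of cones in a set closed under faces; the empty set starts it and the
    whole fan ends it. *)
Lemma sheaf_lift : exists Lam : forall eta, stalk L eta -> stalk B eta,
  (forall eta, good_at Lam eta) /\ Lam theta (e0 ord0) = z.
Proof.
suff H : forall D : {set Psi}, (forall eta gamma, eta \in D -> face_le gamma eta -> gamma \in D) ->
    exists Lam : forall eta, stalk L eta -> stalk B eta,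
      (forall eta, eta \in D -> good_at Lam eta) /\ (theta \in D -> Lam theta (e0 ord0) = z).
  have [|Lam [h1 h2]] := H [set: Psi]%SET; first by move=> *; rewrite inE.
  by exists Lam; split=> [eta|]; [apply: h1 | apply: h2]; rewrite inE.
move=> D; have [k] := ubnP #|D|; elim: k D => // k IH D Dk down.
have [->|[eta0 eD0]] := set_0Vmem D.
  by exists (fun eta _ => 0); split=> [eta|]; rewrite inE.
(* A cone with the most faces is maximal in [D]. Removing it keeps the set closed under faces, and
   redefining the map at it affects no other cone of [D]. *)
have [eta eDm emax] := @arg_maxnP Psi eta0 (mem D) face_rank eD0.
have eD : eta \in D := eDm.
have maxi eta' : eta' \in D -> ~ face_lt eta eta'.
  by move=> /emax /= h /face_rank_lt; rewrite ltnNge => /negP; apply; exact: h.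
have lt_in gamma : face_lt gamma eta -> gamma \in D :\ eta.
  by move=> [le ne]; rewrite !inE (down eta) // andbT; apply/eqP.
have [||Lam [h1 h2]] := IH (D :\ eta).
- by rewrite -ltnS; apply: leq_trans Dk; rewrite ltnS [X in (_ < X)%N](cardsD1 eta) eD.
- move=> eta' gamma; rewrite !inE => /andP[ne e'D] le; rewrite (down eta') // andbT.
  apply/eqP => ge; subst gamma; apply: (maxi eta') => //; split=> // ee.
  by rewrite ee eqxx in ne.
have [f [fl fa fh fr fe]] := lift_step (fun gamma lt => h1 gamma (lt_in _ lt)).
exists (dfwith Lam f); split=> [eta' e'D|tD].
  have [ee|ne] := eqVneq eta eta'.
    case: eta' / ee e'D => _; split.
    - by rewrite dfwith_in.
    - by move=> i x; rewrite !dfwith_in fa.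
    - by move=> s x hx; rewrite dfwith_in; apply: fh.
    move=> gamma x le; rewrite dfwith_in.
    have [ge|ne] := eqVneq eta gamma.
      case: gamma / ge le => le; rewrite dfwith_in.
      by rewrite (res_id hB) (res_id sL).
    rewrite dfwith_out // fr //; split=> // ge; by rewrite ge eqxx in ne.
  have e'D' : eta' \in D :\ eta by rewrite !inE e'D eq_sym ne.
  have [hl ha hh hr] := h1 eta' e'D'.
  have E : dfwith Lam f eta' = Lam eta' by apply: dfwith_out.
  split; rewrite ?E // => gamma x le.
  have gne : eta != gamma.
    apply/eqP => ge; subst gamma.
    by apply: (maxi eta') => //; split=> //; apply/eqP.
  by rewrite dfwith_out // hr.
have [ee|ne] := eqVneq eta theta; last first.
  by rewrite dfwith_out // h2 // !inE tD eq_sym ne.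
move: (fe (esym ee)); case: theta / ee (e0) (z) => e1 z1 /=.
by rewrite dfwith_in.
Qed.
End Lift.

(** * The comparison map from the direct sum *)

Section Sum.
Variables (L : Psi -> gsheaf Psi) (hL : forall theta, is_minimal_sheaf theta (L theta)).
Hypothesis hpos : forall eta t (x : stalk B eta), hpart t x -> x <> 0 -> 0 <= tdeg t.
Hypothesis hreg : forall eta, regular_at B eta.
Variables (V : Psi -> lmodType C) (HV : forall theta, R * R -> set (V theta)).
Variables (Y : Psi -> choiceType) (w : forall theta, Y theta -> V theta).
Variables (T : forall theta, set (Y theta)) (c : forall theta, V theta -> {malg C[Y theta]}).
Variables (deg : forall theta, Y theta -> R * R) (sig : forall theta, Y theta -> stalk B theta).
Hypothesis hprim : forall theta,
  primitive_part (@HV theta) (@w theta) (@T theta) (@c theta) (@deg theta) (@sig theta).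
Variable e0 : forall theta, 'I_1 -> stalk (L theta) theta.
Hypothesis be0 : forall theta, is_basis (@e0 theta).
Variable Lam : forall theta (y : Y theta) eta, stalk (L theta) eta -> stalk B eta.
Hypothesis goodL : forall theta (y : Y theta), T y ->
  (forall eta, good_at (deg y) (Lam y) eta) /\ Lam y (e0 theta ord0) = sig y.
Hypothesis zeroL : forall theta (y : Y theta), ~ T y -> forall eta x, @Lam theta y eta x = 0.

Let sL theta : is_gsheaf (L theta) := proj1 (min_pure (hL theta)).
Let hc theta := prim_crd (hprim theta).
Local Notation E := (gsheaf_sum HV L).

Lemma Lam_lin theta (y : Y theta) eta : linear (@Lam theta y eta).
Proof.
have [Ty|nT] := pselect (T y); first exact: good_lin (proj1 (goodL Ty) eta).
by move=> a u v; rewrite !zeroL // scaler0 addr0.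
Qed.
Lemma Lam_act theta (y : Y theta) eta i x : @Lam theta y eta (act i x) = act i (Lam y x).
Proof.
have [Ty|nT] := pselect (T y); first exact: good_act (proj1 (goodL Ty) eta) i x.
by rewrite !zeroL // (linf0 (@act_lin _ _ _ _ hB eta i)).
Qed.
Lemma Lam_res theta (y : Y theta) eta gamma x : face_le gamma eta ->
  res gamma (@Lam theta y eta x) = Lam y (res gamma x).
Proof.
move=> le; have [Ty|nT] := pselect (T y); first exact: good_res (proj1 (goodL Ty) eta) _ _ le.
by rewrite !zeroL // (linf0 (@res_lin _ _ _ _ hB eta gamma)).
Qed.

Definition part_map theta eta : tensor (V theta) (stalk (L theta) eta) -> stalk B eta :=
  tlift (fun v x => mext (fun y => Lam y x) (c v)).

Lemma part_bilin theta eta :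
  bilin (fun (v : V theta) (x : stalk (L theta) eta) => mext (fun y => Lam y x) (c v)).
Proof.
split=> [x|v]; first exact: (lin_comp (mext_lin _) (crd_lin (hc theta))).
by apply: mext_linp => y; apply: Lam_lin.
Qed.
Lemma part_lin theta eta : linear (@part_map theta eta).
Proof. exact: tlift_lin (part_bilin theta eta). Qed.
Lemma part_pure theta eta v (x : stalk (L theta) eta) :
  part_map (tpure v x) = mext (fun y => Lam y x) (c v).
Proof. exact: (tlift_pure (part_bilin theta eta)). Qed.
Lemma part_gen theta eta (y : Y theta) (x : stalk (L theta) eta) : T y ->
  part_map (tpure (w y) x) = Lam y x.
Proof. by move=> Ty; rewrite part_pure (crd_gen (hc theta)) // mextU. Qed.

Lemma part_act theta eta i (t : tensor (V theta) (stalk (L theta) eta)) :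
  part_map (tmap (act i) t) = act i (part_map t).
Proof.
have al := @act_lin _ _ _ _ (sL theta) eta i; have bl := @act_lin _ _ _ _ hB eta i.
have pl := @part_lin theta eta.
move: t; apply: tensor_linP => [||v x].
- exact: (lin_comp pl (tmap_lin al)).
- exact: (lin_comp bl pl).
rewrite (tmap_pure al) !part_pure (mext_comp _ _ bl); apply: eq_in_mext => y _.
exact: Lam_act.
Qed.
Lemma part_res theta eta gamma (t : tensor (V theta) (stalk (L theta) eta)) :
  face_le gamma eta -> part_map (tmap (res gamma) t) = res gamma (part_map t).
Proof.
move=> le; have al := @res_lin _ _ _ _ (sL theta) eta gamma.
have bl := @res_lin _ _ _ _ hB eta gamma.
have pl := @part_lin theta eta; have pl' := @part_lin theta gamma.
move: t; apply: tensor_linP => [||v x].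
- exact: (lin_comp pl' (tmap_lin al)).
- exact: (lin_comp bl pl).
rewrite (tmap_pure al) !part_pure (mext_comp _ _ bl); apply: eq_in_mext => y _.
by rewrite Lam_res.
Qed.

Lemma part_hom theta eta s (t : tensor (V theta) (stalk (L theta) eta)) :
  lspan [set y | exists t1 t2 v x, [/\ s = t1 + t2, HV t1 v, hpart t2 x & y = tpure v x]] t ->
  hpart s (part_map t).
Proof.
have hs := hom_spanned (homog_grading hB eta).
move=> ht; apply: hs; move: t ht; apply: lspan_img; first exact: part_lin.
move=> _ [t1 [t2 [v [x [-> hv hx ->]]]]]; rewrite part_pure.
apply: lspan_sum => y; rewrite -monalg.mcoeff_neq0 => cy _; apply/lspanZ/lspan_gen.
have Ty := crd_supp (hc theta) cy.
rewrite -(prim_crd_hom (hprim theta) hv cy) addrC.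
exact: (good_hom (proj1 (goodL Ty) eta)).
Qed.

Definition sum_map eta (x : stalk E eta) : stalk B eta := \sum_theta part_map (x theta).

Lemma sum_lin eta : linear (@sum_map eta).
Proof.
move=> a x y; rewrite /sum_map scaler_sumr -big_split; apply: eq_bigr => theta _ /=.
exact: part_lin.
Qed.
Lemma sum_act eta i (x : stalk E eta) : sum_map (act i x) = act i (sum_map x).
Proof.
rewrite /sum_map (linf_sum (@act_lin _ _ _ _ hB eta i)); apply: eq_bigr => theta _.
exact: part_act.
Qed.
Lemma sum_res eta gamma (x : stalk E eta) : face_le gamma eta ->
  sum_map (res gamma x) = res gamma (sum_map x).
Proof.
move=> le; rewrite /sum_map (linf_sum (@res_lin _ _ _ _ hB eta gamma)).
by apply: eq_bigr => theta _; apply: part_res.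
Qed.
Lemma sum_hom eta s (x : stalk E eta) : hpart s x -> hpart s (sum_map x).
Proof.
move=> hx; apply: (hom_sum (homog_grading hB eta)) => theta _ _.
exact/part_hom/hx.
Qed.

Definition embed eta theta (t : tensor (V theta) (stalk (L theta) eta)) : stalk E eta :=
  @dinj _ _ (fun theta => tensor (V theta) (stalk (L theta) eta) : lmodType C) theta t.

Lemma embed_in eta theta (t : tensor (V theta) (stalk (L theta) eta)) : embed t theta = t.
Proof. exact: dinj_in. Qed.
Lemma embed_out eta theta theta' (t : tensor (V theta) (stalk (L theta) eta)) :
  theta != theta' -> embed t theta' = 0.
Proof. exact: dinj_out. Qed.
Lemma sum_embed eta theta (t : tensor (V theta) (stalk (L theta) eta)) :
  sum_map (embed t) = part_map t.
Proof.
rewrite /sum_map (bigD1 theta) //= embed_in big1 ?addr0 // => theta' ne.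
by rewrite embed_out 1?eq_sym // (linf0 (@part_lin _ _)).
Qed.

Lemma E_act_lin eta i : linear (@act _ _ _ E eta i).
Proof.
move=> a x y; apply: functional_extensionality_dep => theta /=.
exact: (tmap_lin (@act_lin _ _ _ _ (sL theta) eta i)).
Qed.
Lemma E_act_comm eta i j (x : stalk E eta) : act i (act j x) = act j (act i x).
Proof.
apply: functional_extensionality_dep => theta /=.
have al k := @act_lin _ _ _ _ (sL theta) eta k.
rewrite (tmap_comp (al i) (al j)) (tmap_comp (al j) (al i)).
by apply: eq_tmap => y; apply: (act_comm (sL theta)).
Qed.
Lemma E_form_van eta (l : 'rV[C]_(n + n)) (x : stalk E eta) :
  (forall y, cspan (cone eta) y -> dot l y = 0) -> form_act l x = 0.
Proof.
move=> hl; apply: functional_extensionality_dep => theta.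
have al k := @act_lin _ _ _ _ (sL theta) eta k.
rewrite /form_act big_dprod.
transitivity (tmap (fun y => \sum_i l 0 i *: act i y : stalk (L theta) eta) (x theta)).
  rewrite (tmap_sum _ _ (fun i => lin_scale (l 0 i) (al i))).
  by apply: eq_bigr => i _; rewrite (tmapZ _ (al i)).
rewrite -[RHS](tmap0 (stalk (L theta) eta) (x theta)); apply: eq_tmap => y.
exact: (act_van (sL theta)).
Qed.

(** Each coordinate in a basis of the multiplicity space is a boundary section of [L theta], which
    lifts by purity. *)
Lemma E_boundary eta (s : forall gamma, stalk E gamma) : boundary_section eta s ->
  exists x : stalk E eta, forall gamma, face_lt gamma eta -> res gamma x = s gamma.
Proof.
move=> hs.
suff H theta : exists t : tensor (V theta) (stalk (L theta) eta),
    forall gamma, face_lt gamma eta -> tmap (res gamma) t = s gamma theta.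
  exists (fun theta => projT1 (cid (H theta))) => gamma lt.
  by apply: functional_extensionality_dep => theta /=; case: cid => t /= ->.
pose tc gamma y := tcrd (@c theta) y (s gamma theta).
have rl gamma := @res_lin _ _ _ _ (sL theta) eta gamma.
(* The fan is finite, so one finite set of basis vectors serves all faces, and the lifted
   coordinates can be summed. *)
have [D [DT DE]] : exists D : {fset Y theta}, (forall y, y \in D -> T y) /\
    forall gamma, s gamma theta = \sum_(y <- D) tpure (w y) (tc gamma y).
  have H gamma := tcrd_sum (hc theta) (s gamma theta).
  pose Dg gamma := projT1 (cid (H gamma)).
  have DgP gamma : [/\ forall y, y \in Dg gamma -> T y,
      forall y, y \notin Dg gamma -> tc gamma y = 0 &
      s gamma theta = \sum_(y <- Dg gamma) tpure (w y) (tc gamma y)].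
    by rewrite /Dg; case: cid.
  exists (\bigcup_(gamma <- index_enum Psi) Dg gamma)%fset; split=> [y|gamma].
    by case/bigfcupP => gamma _ yD; have [h _ _] := DgP gamma; apply: h.
  have [_ h0 {1}->] := DgP gamma; apply: big_fset_incl => [|y _ /h0 ->].
    by apply: (bigfcup_sup (j := gamma)) => //; rewrite mem_index_enum.
  exact: (linf0 (tpure_linr _)).
have lift y : exists x : stalk (L theta) eta,
    forall gamma, face_lt gamma eta -> res gamma x = tc gamma y.
  apply: (proj2 (proj2 (min_pure (hL theta)) eta)) => gamma beta lt bg.
  rewrite /tc -(tcrd_map (hc theta) _ _ (@res_lin _ _ _ _ (sL theta) gamma beta)).
  by rewrite -(hs gamma beta).
exists (\sum_(y <- D) tpure (w y) (projT1 (cid (lift y)))) => gamma lt.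
rewrite (linf_sum (tmap_lin (rl gamma))) DE; apply: eq_bigr => y _.
by rewrite (tmap_pure (rl gamma)); case: cid => x /= ->.
Qed.

Lemma E_max_embed eta (x : stalk E eta) :
  (forall theta, exists z : 'I_(n + n) -> tensor (V theta) (stalk (L theta) eta),
     x theta = \sum_i tmap (act i) (z i)) -> maximal_ideal x.
Proof.
move=> H; exists (fun i theta => projT1 (cid (H theta)) i).
apply: functional_extensionality_dep => theta; rewrite big_dprod /=.
by case: cid => z /= ->.
Qed.

Lemma tensor_max theta eta (t : tensor (V theta) (stalk (L theta) eta)) :
  (forall y, exists z : 'I_(n + n) -> stalk (L theta) eta,
     tcrd (@c theta) y t = \sum_i act i (z i)) ->
  exists z : 'I_(n + n) -> tensor (V theta) (stalk (L theta) eta),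
    t = \sum_i tmap (act i) (z i).
Proof.
move=> H; have [D [_ _ ->]] := tcrd_sum (hc theta) t.
exists (fun i => \sum_(y <- D) tpure (w y) (projT1 (cid (H y)) i)).
have al i := @act_lin _ _ _ _ (sL theta) eta i.
under [RHS]eq_bigr => i _ do rewrite (linf_sum (tmap_lin (al i))).
rewrite exchange_big; apply: eq_bigr => y _ /=; case: cid => z /= ->.
rewrite (linf_sum (tpure_linr _)); apply: eq_bigr => i _.
by rewrite (tmap_pure (al i)).
Qed.

(* Up to the maximal ideal, an element of the sum restricting to zero on the boundary
   comes from the primitive part at [eta], since every other summand is a minimal cover. *)
Lemma E_kernel eta (x : stalk E eta) : (forall gamma, face_lt gamma eta -> res gamma x = 0) ->
  exists2 z, supported (@T eta) z &
    maximal_ideal (x - embed (mext (fun y => tpure (w y) (e0 eta ord0)) z)).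
Proof.
move=> hx; pose cx theta y := tcrd (@c theta) y (x theta).
have rx theta y gamma : face_lt gamma eta -> res gamma (cx theta y) = 0.
  move=> lt; rewrite /cx -(tcrd_map (hc theta) _ _ (@res_lin _ _ _ _ (sL theta) eta gamma)).
  have -> : tmap (res gamma) (x theta) = 0 by rewrite -[LHS]/(res gamma x theta) hx.
  exact: (linf0 (@tcrd_lin _ _ _ _ _ _ (hc theta) (stalk (L theta) gamma) y)).
(* At [eta] the stalk of [L eta] is generated by a single element, so each coordinate is a scalar
   multiple of it modulo the maximal ideal. *)
have main y : exists (a : C) z, cx eta y = a *: e0 eta ord0 + \sum_i act i (z i).
  have [p ->] := proj1 (be0 eta) (cx eta y); rewrite big_ord1.
  exact: poly_act_max (sL eta).
pose a y := projT1 (cid (main y)).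
have aP y : exists z, cx eta y - a y *: e0 eta ord0 = \sum_i act i (z i).
  by rewrite /a; case: cid => b /= [z ->]; exists z; rewrite addrC addKr.
have [D [DT D0 DE]] := tcrd_sum (hc eta) (x eta).
pose z : {malg C[Y eta]} := \sum_(y <- D) a y *: << y >>.
exists z.
  rewrite /z big_seq; elim/big_ind: _ => [y|u v hu hv|y yD].
  - by rewrite monalg.mcoeff0 eqxx.
  - by rewrite -[u]scale1r; apply: supported_lin.
  rewrite -[_ *: _]addr0; apply: supported_lin; first by apply: supportedU; apply: DT.
  by move=> y'; rewrite monalg.mcoeff0 eqxx.
apply: E_max_embed => theta.
have -> u : (x - embed u) theta = x theta - embed u theta by [].
have [<-|ne] := eqVneq eta theta.
  rewrite embed_in /z (linf_sum (mext_lin _)) DE -sumrB.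
  exists (fun i => \sum_(y <- D) tpure (w y) (projT1 (cid (aP y)) i)).
  have al i := @act_lin _ _ _ _ (sL eta) eta i.
  under [RHS]eq_bigr => i _ do rewrite (linf_sum (tmap_lin (al i))).
  rewrite exchange_big; apply: eq_bigr => y _ /=.
  rewrite (linfZ (mext_lin _)) mextU -tpureZr -(linfB (tpure_linr _)) -/(cx eta y).
  case: cid => u /= ->.
  rewrite (linf_sum (tpure_linr _)); apply: eq_bigr => i _.
  by rewrite (tmap_pure (al i)).
rewrite embed_out // subr0; apply: tensor_max => y.
have [le|nle] := pselect (face_le theta eta).
  apply: (min_cover (hL theta)); first by split=> // te; rewrite te eqxx in ne.
  by move=> gamma lt; apply: rx.
exists (fun=> 0); rewrite [LHS](min_supp (hL theta) nle) big1 // => i _.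
exact: (linf0 (@act_lin _ _ _ _ (sL theta) eta i)).
Qed.

Lemma form_act_delta (F : gsheaf Psi) eta j (x : stalk F eta) :
  form_act (delta_mx 0 j) x = act j x.
Proof.
rewrite /form_act (bigD1 j) //= mxE !eqxx scale1r big1 ?addr0 // => i /negPf ij.
by rewrite mxE ij andbF scale0r.
Qed.
Lemma form_act_linl (F : gsheaf Psi) eta (x : stalk F eta) : linear (fun l => form_act l x).
Proof.
move=> a l l'; rewrite /form_act scaler_sumr -big_split; apply: eq_bigr => i _ /=.
by rewrite !mxE scalerDl scalerA.
Qed.
Lemma form_act_linr (F : gsheaf Psi) eta l : (forall i, linear (@act _ _ _ F eta i)) ->
  linear (@form_act _ _ _ F eta l).
Proof. by move=> al; apply: lin_sum => i _; apply/lin_scale/al. Qed.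

Lemma form_act_comm (F : gsheaf Psi) eta l l' (x : stalk F eta) :
  (forall i, linear (@act _ _ _ F eta i)) ->
  (forall i j (x : stalk F eta), act i (act j x) = act j (act i x)) ->
  form_act l (form_act l' x) = form_act l' (form_act l x).
Proof.
move=> al ac; rewrite /form_act.
under eq_bigr => i _ do rewrite (linf_sum (al i)) scaler_sumr.
under [RHS]eq_bigr => i _ do rewrite (linf_sum (al i)) scaler_sumr.
rewrite exchange_big; apply: eq_bigr => j _; apply: eq_bigr => i _.
by rewrite (linfZ (al i)) (linfZ (al j)) !scalerA mulrC ac.
Qed.
Lemma sum_form eta l (x : stalk E eta) : sum_map (form_act l x) = form_act l (sum_map x).
Proof.
rewrite /form_act (linf_sum (@sum_lin eta)); apply: eq_bigr => i _.
by rewrite (linfZ (@sum_lin eta)) sum_act.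
Qed.

Lemma embed_lin eta theta : linear (@embed eta theta).
Proof. exact: (@dinj_lin _ _ (fun theta => tensor (V theta) (stalk (L theta) eta) : lmodType C)). Qed.
Lemma embed_sum eta (x : stalk E eta) : x = \sum_theta embed (x theta).
Proof. exact: (esym (sum_dinj (index_enum_uniq Psi) (@mem_index_enum Psi) x)). Qed.

Lemma embed_hom eta theta (y : Y theta) t (u : stalk (L theta) eta) : T y -> hpart t u ->
  @hpart _ _ _ E eta (t + deg y) (embed (tpure (w y) u)).
Proof.
move=> Ty hu theta'; have [<-|ne] := eqVneq theta theta'; last first.
  by rewrite embed_out //; apply: lspan0.
rewrite embed_in; apply: lspan_gen; exists (deg y), t, (w y), u; split=> //.
  by rewrite addrC.
exact: (prim_gen_hom (hprim theta)).
Qed.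

Lemma E_homog eta (x : stalk E eta) : spanhom (@hpart _ _ _ E eta) setT (fun=> True) x.
Proof.
rewrite [x]embed_sum; apply: lspan_sum => theta _ _.
have [D [DT _ ->]] := tcrd_sum (hc theta) (x theta).
rewrite (linf_sum (@embed_lin eta theta)); apply: lspan_sum => y yD _.
have := homog_spanhom (homog_grading (sL theta) eta) (tcrd (@c theta) y (x theta)).
apply: (lspan_img (lin_comp (@embed_lin eta theta) (tpure_linr (w y)))) => u [_ [t _ hu]].
apply: lspan_gen; split=> //; exists (t + deg y) => //.
by apply: embed_hom => //; apply: DT.
Qed.

Lemma sum_image_homog eta : [set b | exists x : stalk E eta, sum_map x = b] `<=`
  spanhom (@hpart _ _ _ B eta) [set b | exists x : stalk E eta, sum_map x = b] (fun=> True).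
Proof.
move=> _ [x <-]; apply: (lspan_img (@sum_lin eta)) (E_homog x) => u [_ [t _ hu]].
apply: lspan_gen; split; first by exists u.
by exists t => //; apply: sum_hom.
Qed.

Lemma sum_prim eta (z : {malg C[Y eta]}) : supported (@T eta) z ->
  sum_map (embed (mext (fun y => tpure (w y) (e0 eta ord0)) z)) = mext (@sig eta) z.
Proof.
move=> hz; rewrite sum_embed (mext_comp _ _ (@part_lin eta eta)); apply: eq_in_mext => y.
rewrite -monalg.mcoeff_neq0 => /hz Ty; rewrite part_gen //.
by have [_] := goodL Ty.
Qed.

Lemma sum_max eta (x : stalk E eta) : maximal_ideal x -> maximal_ideal (sum_map x).
Proof.
move=> [z ->]; exists (fun i => sum_map (z i)); rewrite (linf_sum (@sum_lin eta)).
by apply: eq_bigr => i _; rewrite sum_act.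
Qed.

(** By graded Nakayama it suffices to reach [b] modulo the maximal ideal. After subtracting the
    image of a lift of its boundary values, [b] restricts to zero on the boundary and is primitive
    modulo the maximal ideal. *)
Lemma sum_surj_step eta :
  (forall gamma, face_lt gamma eta -> (forall b, exists x : stalk E gamma, sum_map x = b) /\
     forall x : stalk E gamma, sum_map x = 0 -> x = 0) ->
  forall b, exists x : stalk E eta, sum_map x = b.
Proof.
move=> IH; have bl i := @act_lin _ _ _ _ hB eta i.
apply: (@graded_nakayama _ _ _ (@act _ _ _ B eta) (@hpart _ _ _ B eta) bl
  (homog_grading hB eta) (@homog_act _ _ _ _ hB eta)
  [set b | exists x : stalk E eta, sum_map x = b]).
- exact: hpos.
- move=> b; elim/lspan_ind=> [|a _ u [x <-] [y <-]].
    by exists 0; apply: (linf0 (@sum_lin eta)).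
  by exists (a *: x + y); apply: sum_lin.
- by move=> i _ [x <-]; exists (act i x); apply: sum_act.
- exact: sum_image_homog.
move=> b.
have H gamma : exists s : stalk E gamma, face_lt gamma eta -> sum_map s = res gamma b.
  have [lt|nlt] := pselect (face_lt gamma eta); last by exists 0.
  by have [/(_ (res gamma b))[s sE] _] := IH gamma lt; exists s.
pose s gamma := projT1 (cid (H gamma)).
have sP gamma : face_lt gamma eta -> sum_map (s gamma) = res gamma b.
  by rewrite /s; case: cid.
(* Injectivity on the smaller cones makes the preimages of the restrictions of [b] compatible. *)
have [|x hx] := @E_boundary eta s.
  move=> gamma beta lt bg; have lt' := face_le_lt_trans bg lt.
  apply/eqP; rewrite -subr_eq0; apply/eqP; apply: (proj2 (IH beta lt')).
  rewrite (linfB (@sum_lin beta)) (sum_res _ bg) !sP //.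
  by rewrite (res_comp hB) ?subrr //; case: lt.
have rb gamma : face_lt gamma eta -> res gamma (b - sum_map x) = 0.
  move=> lt; rewrite (linfB (@res_lin _ _ _ _ hB eta gamma)) -(sum_res _ (proj1 lt)) hx //.
  by rewrite sP // subrr.
have [z hz [u uE]] := prim_span (hprim eta) rb.
exists (sum_map x + mext (@sig eta) z), u; split.
  exists (x + embed (mext (fun y => tpure (w y) (e0 eta ord0)) z)).
  by rewrite (linfD (@sum_lin eta)) sum_prim.
by rewrite -uE [RHS]addrC -[b - _ - _]addrA -opprD subrK.
Qed.

(** A kernel element lies in every power of the maximal ideal. Its vanishing is then tested on
    coordinates, each of which lives in a single free stalk with degrees bounded below. *)
Lemma sum_inj_step eta :
  (forall gamma, face_lt gamma eta -> forall x : stalk E gamma, sum_map x = 0 -> x = 0) ->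
  (forall b, exists x : stalk E eta, sum_map x = b) ->
  forall x : stalk E eta, sum_map x = 0 -> x = 0.
Proof.
move=> IH surj; have bl i := @act_lin _ _ _ _ hB eta i; have el := @E_act_lin eta.
(* By injectivity on the faces, [x] vanishes on the boundary. It is thus primitive modulo the
   maximal ideal, and its primitive part maps to zero modulo that ideal, hence vanishes by
   freeness. *)
have kmax (x : stalk E eta) : sum_map x = 0 -> maximal_ideal x.
  move=> x0; have [gamma lt|z hz xz] := @E_kernel eta x.
    by apply: (IH gamma lt); rewrite (sum_res _ (proj1 lt)) x0 (linf0 (@res_lin _ _ _ _ hB eta gamma)).
  suff z0 : z = 0 by move: xz; rewrite z0 (linf0 (mext_lin _)) (linf0 (@embed_lin eta eta)) subr0.
  apply: (prim_free (hprim eta) hz); have := sum_max xz.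
  rewrite (linfB (@sum_lin eta)) x0 sum_prim // sub0r => -[u uE].
  exists (fun i => - u i); rewrite -[LHS]opprK uE -sumrN; apply: eq_bigr => i _.
  by rewrite (linfN (bl i)).
have [I [l [s [rs spn]]]] := hreg eta.
have ol i : linear (form_act (F := E) (eta := eta) (l i)) by apply: form_act_linr.
have ol' i : linear (form_act (F := B) (eta := eta) (l i)) by apply: form_act_linr.
(* Each coordinate form agrees on the cone with a combination of the forms in the sequence, and
   forms vanishing on the cone act by zero. *)
have maxs (x : stalk E eta) : maximal_ideal x ->
    inideal (fun i => form_act (F := E) (eta := eta) (l i)) setT s x.
  move=> [z ->]; apply: inideal_sum => // j; have [a aP] := spn j.
  have -> : act j (z j) = \sum_(i <- s) a i *: form_act (l i) (z j).
    apply/eqP; rewrite -subr_eq0 -form_act_delta; apply/eqP.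
    have fl := form_act_linl (z j).
    under eq_bigr => i _ do rewrite -(linfZ fl).
    rewrite -(linf_sum fl) -(linfB fl); apply: E_form_van => y /aP yE.
    rewrite dotBl dot_delta yE dot_suml -sumrB big1 // => i _.
    by rewrite dotZl subrr.
  rewrite big_seq.
  apply: (big_ind (inideal (fun i => form_act (F := E) (eta := eta) (l i)) setT s)) => [|u v|i is_].
  - exact: inideal0.
  - exact: inidealD.
  by apply: inidealZ => //; apply: (inideal_gen (o := fun i => form_act (F := E) (eta := eta) (l i))).
have smax s' (x : stalk E eta) : inideal (fun i => form_act (F := E) (eta := eta) (l i))
    [set y | sum_map y = 0] s' x ->
    exists z : 'I_(n + n) -> stalk E eta, (forall i, sum_map (z i) = 0) /\ x = \sum_i act i (z i).
  elim: s' x => [|i s' IHs] x /=.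
    move=> ->; exists (fun=> 0); split=> [_|]; first exact: (linf0 (@sum_lin eta)).
    by rewrite big1 // => i _; apply: (linf0 (el i)).
  move=> [y [u [y0 /IHs[z [z0 ->]] ->]]]; exists (fun j => l i 0 j *: y + z j); split=> [j|].
    by rewrite (@sum_lin eta) y0 z0 scaler0 addr0.
  rewrite /form_act -big_split; apply: eq_bigr => j _.
  exact: (esym (el j _ _ _)).
have step (x : stalk E eta) : sum_map x = 0 ->
    exists z : 'I_(n + n) -> stalk E eta, (forall i, sum_map (z i) = 0) /\ x = \sum_i act i (z i).
  move=> x0; apply: (smax s).
  exact: (@regular_kernel _ _ _ _ (fun i => form_act (F := E) (eta := eta) (l i))
    (fun i => form_act (F := B) (eta := eta) (l i)) (@sum_map eta) ol
    (fun i j y => form_act_comm (l i) (l j) y el (@E_act_comm eta)) (@sum_lin eta)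
    (fun i y => sum_form (l i) y) surj s x rs (maxs x (kmax x x0)) x0).
(* Iterating $K=\mathfrak mK$ places $K$ in all powers of the maximal ideal. *)
have pw j : forall x : stalk E eta, sum_map x = 0 -> idealpow (@act _ _ _ E eta) j x.
  elim: j => [//|j IHj] x /step[z [z0 ->]] /=; exists z; split=> // i; exact: IHj.
move=> x x0; apply: functional_extensionality_dep => theta.
have al i := @act_lin _ _ _ _ (sL theta) eta i.
have pwc j y : forall u : stalk E eta, idealpow (@act _ _ _ E eta) j u ->
    idealpow (@act _ _ _ (L theta) eta) j (tcrd (@c theta) y (u theta)).
  elim: j => [//|j IHj] u /= [z [hz ->]].
  exists (fun i => tcrd (@c theta) y (z i theta)); split=> [i|]; first exact: IHj.
  rewrite big_dprod (linf_sum (@tcrd_lin _ _ _ _ _ _ (hc theta) _ y)).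
  by apply: eq_bigr => i _; rewrite -(tcrd_map (hc theta) _ _ (al i)).
have [N hN] := free_stalk_bounded (sL theta) (proj1 (proj2 (min_pure (hL theta)) eta)).
have cz y : tcrd (@c theta) y (x theta) = 0.
  apply: (@idealpow_eq0 _ _ _ (@act _ _ _ (L theta) eta) (@hpart _ _ _ (L theta) eta) al
    (homog_grading (sL theta) eta) (@homog_act _ _ _ _ (sL theta) eta) N _ hN).
  by move=> j; apply: pwc; apply: pw.
have [D [_ _ ->]] := tcrd_sum (hc theta) (x theta).
by rewrite big1 // => y _; rewrite cz (linf0 (tpure_linr _)).
Qed.

Lemma sum_bij eta : (forall b, exists x : stalk E eta, sum_map x = b) /\
  forall x : stalk E eta, sum_map x = 0 -> x = 0.
Proof.
elim/face_lt_ind: eta => eta IH.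
have surj := sum_surj_step IH; split=> //.
by apply: sum_inj_step surj => gamma lt; case: (IH gamma lt).
Qed.

(** The comparison map goes from the sum to [B], and its inverse is the isomorphism sought. That the
    inverse is homogeneous still needs an argument. *)
Lemma sum_iso : gsheaf_iso B E.
Proof.
pose phi eta (b : stalk B eta) : stalk E eta := projT1 (cid (proj1 (sum_bij eta) b)).
have phiK eta (b : stalk B eta) : sum_map (phi eta b) = b by rewrite /phi; case: cid.
have sumI eta (x y : stalk E eta) : sum_map x = sum_map y -> x = y.
  move=> e; apply/eqP; rewrite -subr_eq0; apply/eqP; apply: (proj2 (sum_bij eta)).
  by rewrite (linfB (@sum_lin eta)) e subrr.
have sumK eta (x : stalk E eta) : phi eta (sum_map x) = x by apply: sumI; rewrite phiK.
exists phi; split; last by move=> eta; exists (@sum_map eta).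
split.
- by move=> eta; apply: (lin_can (@sum_lin eta)).
- by move=> eta gamma x le; apply: sumI; rewrite phiK sum_res // phiK.
- by move=> eta i x; apply: sumI; rewrite phiK sum_act phiK.
move=> eta t b; split=> [hb|]; last by move=> /sum_hom; rewrite phiK.
have [k [a [v [Av bE]]]] := E_homog (phi eta b).
pose s i := let: conj _ h := Av i in projT1 (cid2 h).
have hs i : @hpart _ _ _ E eta (s i) (v i) by rewrite /s; case: (Av i) => _ h; case: cid2.
have hg := homog_grading hB eta.
have bE' : b = \sum_(i < k) a i *: sum_map (v i).
  rewrite -{1}(phiK _ b) bE (linf_sum (@sum_lin eta)).
  by apply: eq_bigr => i _; rewrite (linfZ (@sum_lin eta)).
have zP i : i \in index_enum 'I_k -> hpart (s i) (a i *: sum_map (v i)).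
  by move=> _; apply: (hom_spanned hg); apply/lspanZ/lspan_gen/sum_hom.
(* Apply the comparison map to a homogeneous expansion of the preimage: the terms of degree [t]
   alone already sum to [b], so by injectivity they sum to the preimage. *)
have := grading_pickable hg zP hb bE' => bE2.
have -> : phi eta b = \sum_(i < k | s i == t) a i *: v i.
  apply: sumI; rewrite phiK {1}bE2 (linf_sum (@sum_lin eta)).
  by apply: eq_bigr => i _; rewrite (linfZ (@sum_lin eta)).
move=> theta; rewrite big_dprod; apply: lspan_sum => i _ /eqP <-.
by apply: lspanZ; apply: (hs i theta).
Qed.
End Sum.

Theorem pure_decomposition (L : Psi -> gsheaf Psi) (V : Psi -> lmodType C)
    (HV : forall theta, R * R -> set (V theta)) :
  (forall theta, is_minimal_sheaf theta (L theta)) ->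
  (forall eta t (x : stalk B eta), hpart t x -> x <> 0 -> 0 <= tdeg t) ->
  (forall eta, regular_at B eta) ->
  (forall theta, inhabited (primitive_data B theta (@HV theta))) ->
  gsheaf_iso B (gsheaf_sum HV L).
Proof.
move=> hL hpos hreg H.
have [D _] : exists D : forall theta, primitive_data B theta (@HV theta), True.
  have H' theta : exists D : primitive_data B theta (@HV theta), True by case: (H theta) => D; exists D.
  by exists (fun theta => projT1 (cid (H' theta))).
pose e0 theta := projT1 (cid (min_theta (hL theta))).
have [he0 be0] : (forall theta, hpart (0, 0) (e0 theta ord0)) /\ forall theta, is_basis (e0 theta).
  by split=> theta; rewrite /e0; case: cid => e [].
(* Indices outside the basis receive the zero map, so that the family is defined on the whole index
   type. *)
have HL theta (y : prim_gens (D theta)) : exists Lam : forall eta, stalk (L theta) eta -> stalk B eta,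
    (prim_set y -> (forall eta, good_at (prim_deg y) Lam eta) /\
       Lam theta (e0 theta ord0) = prim_sec y) /\
    (~ prim_set y -> forall eta x, Lam eta x = 0).
  have [Ty|nT] := pselect (prim_set y); last by exists (fun _ _ => 0).
  have [Lam hLam] := sheaf_lift (hL theta) (he0 theta) (be0 theta)
    (prim_hom (primP (D theta)) Ty)
    (fun gamma => @prim_res _ _ _ _ _ _ _ _ _ _ _ _ _ (primP (D theta)) y gamma Ty).
  by exists Lam.
pose Lam theta y := projT1 (cid (HL theta y)).
apply: (sum_iso hL hpos hreg (fun theta => primP (D theta)) be0 (Lam := Lam)) => theta y hT.
  by rewrite /Lam; case: cid => f [h _] /=; apply: h.
by rewrite /Lam; case: cid => f [_ h] /=; apply: h.
Qed.
End PureDecomposition.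

(** * Koszul complexes and the associated graded *)

Section Regrade.
Variable R : realType.

(** Solves $a=k+i-j$, $r=i+j$ for $(i,j)$: once the exterior degree is known, [(a, r)] carries the
    same information as the bidegree. *)
Definition unregrade (k : nat) (t : R * R) : R * R :=
  ((t.1 + t.2 - k%:R) / 2, (t.2 - t.1 + k%:R) / 2).

Lemma regradeK k : cancel (@regrade R k) (unregrade k).
Proof. by move=> [x y]; rewrite /regrade /unregrade /=; congr (_, _); field. Qed.
Lemma unregradeK k : cancel (unregrade k) (@regrade R k).
Proof. by move=> [x y]; rewrite /regrade /unregrade /=; congr (_, _); field. Qed.
Lemma regradeD k (s t : R * R) : regrade 0 s + regrade k t = regrade k (s + t).
Proof.
case: s t => [x y] [x' y']; rewrite /regrade /= -[LHS]/(_ + _, _ + _) /=.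
by congr (_, _); ring.
Qed.
End Regrade.

Section ExteriorPowers.
Variables (R : realType) (n : nat).
Local Notation C := (complex R).
Implicit Types (E : lmodType C) (I J : {set 'I_n}).

Definition ext_inj E I (e : E) : ext n E := [ffun J => if J == I then e else 0].

Lemma ext_sumE E (A : Type) (r : seq A) (P : pred A) (f : A -> ext n E) I :
  (\sum_(a <- r | P a) f a) I = \sum_(a <- r | P a) f a I.
Proof. by elim/big_rec2: _ => [|a _ y _ <-]; rewrite ffunE. Qed.

Lemma ext_inj_lin E I : linear (@ext_inj E I).
Proof.
move=> a x y; apply/ffunP => J; rewrite !ffunE.
by case: eqP => _; rewrite ?scaler0 ?addr0.
Qed.
Lemma ext_pr_lin E I : linear (fun w : ext n E => w I : E).
Proof. by move=> a x y; rewrite !ffunE. Qed.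
Lemma ext_sum_inj E (w : ext n E) : \sum_I ext_inj I (w I) = w.
Proof.
apply/ffunP => J; rewrite ext_sumE (bigD1 J) //= ffunE eqxx big1 ?addr0 // => I.
by rewrite ffunE eq_sym => /negPf ->.
Qed.
Lemma ext_map_inj E E' (f : E -> E') I e : linear f ->
  ext_map f (ext_inj I e) = ext_inj I (f e).
Proof. by move=> hf; apply/ffunP => J; rewrite !ffunE; case: eqP => // _; apply: linf0. Qed.
Lemma ext_map_lin E E' (f : E -> E') : linear f -> linear (ext_map f : ext n E -> ext n E').
Proof. by move=> hf a x y; apply/ffunP => J; rewrite !ffunE hf. Qed.
End ExteriorPowers.

Section KoszulSum.
Variables (R : realType) (n : nat) (Psi : cone_family R (n + n)).
Local Notation C := (complex R).
Implicit Types (eta gamma theta : Psi) (F : gsheaf Psi).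

(** Written on a plain family of coefficients, the entry at [I] can be carried through any linear
    map that commutes with the action. *)
Definition koszul_entry F eta (I : {set 'I_n}) (w : {set 'I_n} -> stalk F eta) : stalk F eta :=
  \sum_(i < n) (if i \in I then 0 else ext_sign R i I *: act (lshift n i) (w (i |: I)%SET)) +
  \sum_(i < n) (if i \in I then ext_sign R i I *: act (rshift n i) (w (I :\ i)%SET) else 0).

Lemma koszul_diffE F eta (w : ext n (stalk F eta)) I : koszul_diff w I = koszul_entry I w.
Proof.
rewrite /koszul_diff /koszul_entry ffunE !ext_sumE.
by congr (_ + _); apply: eq_bigr => i _; rewrite !ffunE.
Qed.

Lemma koszul_entry_map F F' eta (f : stalk F eta -> stalk F' eta) I w : linear f ->
  (forall i x, f (act i x) = act i (f x)) ->
  f (koszul_entry I w) = koszul_entry I (fun J => f (w J)).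
Proof.
move=> hf fa; rewrite /koszul_entry (linfD hf) !(linf_sum hf).
by congr (_ + _); apply: eq_bigr => i _; case: ifP => _; rewrite ?(linf0 hf) // (linfZ hf) fa.
Qed.

Lemma koszul_entry_lin F eta I (a : C) (x y : {set 'I_n} -> stalk F eta) :
  (forall i, linear (@act _ _ _ F eta i)) ->
  koszul_entry I (fun J => a *: x J + y J) = a *: koszul_entry I x + koszul_entry I y.
Proof.
move=> al; rewrite /koszul_entry scalerDr addrACA.
congr (_ + _); rewrite scaler_sumr -big_split; apply: eq_bigr => i _ /=; case: ifP => _.
- by rewrite scaler0 addr0.
- by rewrite al scalerDr !scalerA mulrC.
- by rewrite al scalerDr !scalerA mulrC.
- by rewrite scaler0 addr0.
Qed.

Lemma koszul_diff_lin F eta : (forall i, linear (@act _ _ _ F eta i)) ->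
  linear (@koszul_diff _ _ _ F eta).
Proof.
move=> al a x y; apply/ffunP => I; rewrite koszul_diffE.
rewrite [RHS]ffunE [X in _ = X + _]ffunE !koszul_diffE -(koszul_entry_lin _ _ _ _ al).
by rewrite /koszul_entry; congr (_ + _); apply: eq_bigr => i _; case: ifP => _;
  rewrite // !ffunE.
Qed.

Variables (B : gsheaf Psi) (L : Psi -> gsheaf Psi).
Variables (V : Psi -> lmodType C) (HV HV' : forall theta, R * R -> set (V theta)).
Hypotheses (hB : is_gsheaf B) (hL : forall theta, is_gsheaf (L theta)).
Hypothesis HVE : forall theta t v, HV' t v <-> exists2 ij, t = regrade 0 ij & @HV theta ij v.
Local Notation E := (gsheaf_sum HV L).
Local Notation X := (csheaf_sum HV' (fun theta => koszul (L theta))).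

(** The exterior algebra contributes a finite direct sum over the subsets [I], which commutes with
    the tensor products and with the sum over [theta]. *)
Lemma koszul_sum_iso : gsheaf_iso B E -> csheaf_iso (koszul B) X.
Proof.
move=> [phi [[phi_lin phi_res phi_act phi_hom] phi_bij]].
have [psi psiP] : exists psi : forall eta, stalk E eta -> stalk B eta,
    forall eta, cancel (phi eta) (psi eta) /\ cancel (psi eta) (phi eta).
  have H eta : exists g, cancel (phi eta) g /\ cancel g (phi eta).
    by have [g h1 h2] := phi_bij eta; exists g.
  by exists (fun eta => projT1 (cid (H eta))) => eta; case: cid.
have phiK eta := proj1 (psiP eta); have psiK eta := proj2 (psiP eta).
have psi_lin eta : linear (psi eta) := lin_can (phi_lin eta) (phiK eta) (psiK eta).
have psi_act eta i x : psi eta (act i x) = act i (psi eta x).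
  by apply: (can_inj (phiK eta)); rewrite phi_act !psiK.
have psi_hom eta t x : hpart t x -> hpart t (psi eta x).
  by move=> hx; apply/phi_hom; rewrite psiK.
have al theta eta i := @act_lin _ _ _ _ (hL theta) eta i.
have rl theta eta gamma := @res_lin _ _ _ _ (hL theta) eta gamma.
pose inj theta eta I := @ext_inj R n (stalk (L theta) eta) I.
pose pr theta eta I := fun w : ext n (stalk (L theta) eta) => w I.
have injl theta eta I : linear (inj theta eta I) by apply: ext_inj_lin.
have prl theta eta I : linear (pr theta eta I) by apply: ext_pr_lin.
pose Phi eta (w : stalk (koszul B) eta) : stalk X eta :=
  fun theta => \sum_I tmap (inj theta eta I) (phi eta (w I) theta).
pose proj eta I (x : stalk X eta) : stalk E eta := fun theta => tmap (pr theta eta I) (x theta).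
pose Chi eta (x : stalk X eta) : stalk (koszul B) eta := [ffun I => psi eta (proj eta I x)].
have Phi_lin eta : linear (Phi eta).
  move=> a u v; apply: functional_extensionality_dep => theta.
  rewrite -[RHS]/(a *: Phi eta u theta + Phi eta v theta) /Phi scaler_sumr -big_split.
  apply: eq_bigr => I _; have E : (a *: u + v) I = a *: u I + v I by exact: (ext_pr_lin I a u v).
  rewrite E (phi_lin eta).
  exact: (tmap_lin (injl theta eta I)).
have ChiK eta : cancel (Chi eta) (Phi eta).
  move=> x; apply: functional_extensionality_dep => theta; rewrite /Phi.
  under eq_bigr => I _ do rewrite ffunE psiK /proj (tmap_comp (injl theta eta I) (prl theta eta I)).
  have h I : linear (fun w => inj theta eta I (pr theta eta I w)) := lin_comp (injl _ _ _) (prl _ _ _).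
  rewrite -(tmap_sum _ _ h) -[RHS]tmap_id; apply: eq_tmap => w; exact: ext_sum_inj.
have PhiK eta : cancel (Phi eta) (Chi eta).
  move=> w; apply/ffunP => I; rewrite ffunE -[RHS]phiK; congr (psi eta _).
  apply: functional_extensionality_dep => theta; rewrite /proj /Phi.
  rewrite (linf_sum (tmap_lin (prl theta eta I))) (bigD1 I) //= big1 ?addr0 => [|J JI].
    rewrite (tmap_comp (prl theta eta I) (injl theta eta I)) -[RHS]tmap_id.
    by apply: eq_tmap => e; rewrite /pr ffunE eqxx.
  rewrite (tmap_comp (prl theta eta I) (injl theta eta J)).
  rewrite -(tmap0 (stalk (L theta) eta) (phi eta (w J) theta)).
  by apply: eq_tmap => e; rewrite /pr ffunE eq_sym (negPf JI).
exists Phi; split; last 2 first.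
- by move=> eta; exists (Chi eta).
(* The differential is checked after applying the inverse [Chi], each entry of which is a single
   projection, whereas [Phi] is a sum over all subsets. *)
- move=> eta w; apply: (can_inj (ChiK eta)); rewrite PhiK -{1}[w]PhiK.
  move: (Phi eta w) => x; apply/ffunP => I.
  transitivity (koszul_entry I (fun J => psi eta (proj eta J x))).
    rewrite koszul_diffE /koszul_entry.
    by congr (_ + _); apply: eq_bigr => i _; case: ifP => _; rewrite // ffunE.
  rewrite -(koszul_entry_map I (fun J => proj eta J x) (psi_lin eta) (psi_act eta)) [RHS]ffunE.
  congr (psi eta _); apply: functional_extensionality_dep => theta.
  have kl := koszul_diff_lin (al theta eta).
  rewrite /proj [RHS](tmap_comp (prl theta eta I) kl) /koszul_entry.
  rewrite -[LHS]/(_ + _) !big_dprod.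
  have tl i : linear (fun w : ext n (stalk (L theta) eta) =>
      if i \in I then 0 else ext_sign R i I *: act (lshift n i) (w (i |: I)%SET)).
    case: (i \in I); first exact: lin_0.
    exact: (lin_scale _ (lin_comp (al theta eta (lshift n i)) (prl theta eta (i |: I)%SET))).
  have tr i : linear (fun w : ext n (stalk (L theta) eta) =>
      if i \in I then ext_sign R i I *: act (rshift n i) (w (I :\ i)%SET) else 0).
    case: (i \in I); last exact: lin_0.
    exact: (lin_scale _ (lin_comp (al theta eta (rshift n i)) (prl theta eta (I :\ i)%SET))).
  transitivity (tmap (fun w : ext n (stalk (L theta) eta) => koszul_entry I (fun J => w J)) (x theta));
    last by apply: eq_tmap => u; rewrite -koszul_diffE.
  rewrite /koszul_entry.
  have TL := lin_sum (index_enum 'I_n) (fun i (_ : predT i) => tl i).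
  have TR := lin_sum (index_enum 'I_n) (fun i (_ : predT i) => tr i).
  rewrite [RHS](tmapD TL TR) (tmap_sum _ _ tl) (tmap_sum _ _ tr).
  congr (_ + _); apply: eq_bigr => i _; case: ifP => _.
  + by rewrite tmap0.
  + rewrite (tmapZ _ (lin_comp (al theta eta (lshift n i)) (prl theta eta (i |: I)%SET))).
    by rewrite -(tmap_comp (al theta eta (lshift n i)) (prl theta eta (i |: I)%SET)).
  + rewrite (tmapZ _ (lin_comp (al theta eta (rshift n i)) (prl theta eta (I :\ i)%SET))).
    by rewrite -(tmap_comp (al theta eta (rshift n i)) (prl theta eta (I :\ i)%SET)).
  + by rewrite tmap0.
split=> [eta|eta gamma w le_ge|eta i w|eta t w]; first exact: Phi_lin.
- apply: functional_extensionality_dep => theta.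
  have ml := @ext_map_lin R n _ _ _ (rl theta eta gamma).
  rewrite -[RHS]/(tmap (ext_map (res (g := L theta) gamma)) (Phi eta w theta)) /Phi.
  rewrite (linf_sum (tmap_lin ml)); apply: eq_bigr => I _.
  rewrite (tmap_comp ml (injl theta eta I)).
  rewrite (ffunE _ I) (phi_res eta gamma (w I) le_ge).
  rewrite -[phi eta (w I) theta in RHS]/(phi eta (w I) theta).
  rewrite -[X in tmap _ X]/(tmap (res (g := L theta) gamma) (phi eta (w I) theta)).
  rewrite (tmap_comp (injl theta gamma I) (rl theta eta gamma)).
  by apply: eq_tmap => e; rewrite /inj (ext_map_inj I e (rl theta eta gamma)).
- apply: functional_extensionality_dep => theta.
  have ml := @ext_map_lin R n _ _ _ (al theta eta i).
  rewrite -[RHS]/(tmap (ext_map (act (g := L theta) i)) (Phi eta w theta)) /Phi.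
  rewrite (linf_sum (tmap_lin ml)); apply: eq_bigr => I _.
  rewrite (tmap_comp ml (injl theta eta I)).
  rewrite (ffunE _ I) (phi_act eta i (w I)).
  rewrite -[X in tmap _ X]/(tmap (act (g := L theta) i) (phi eta (w I) theta)).
  rewrite (tmap_comp (injl theta eta I) (al theta eta i)).
  by apply: eq_tmap => e; rewrite /inj (ext_map_inj I e (al theta eta i)).
- split=> h.
  + move=> theta; apply: lspan_sum => I _ _.
    have [ij tE /phi_hom /(_ theta)] := h I.
    apply: lspan_img (tmap_lin (injl theta eta I)) _ _.
    move=> _ [t1 [t2 [v [e [tij hv he ->]]]]]; rewrite (tmap_pure (injl theta eta I)).
    apply: lspan_gen; exists (regrade 0 t1), (regrade #|I| t2), v, (inj theta eta I e).
    split=> //; first by rewrite tE tij regradeD.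
      by apply/HVE; exists t1.
    move=> J; rewrite ffunE; case: eqP => [->|_]; first by exists t2.
    exists (unregrade #|J| (regrade #|I| t2)); first by rewrite unregradeK.
    exact: (hom0 (homog_grading (hL theta) eta)).
  + move=> I; exists (unregrade #|I| t); first by rewrite unregradeK.
    rewrite -[w]PhiK ffunE; apply: psi_hom => theta; move: (h theta).
    apply: lspan_img (tmap_lin (prl theta eta I)) _ _.
    move=> _ [t1 [t2 [v [e [-> /HVE[s1 -> hv] he ->]]]]].
    rewrite (tmap_pure (prl theta eta I)); apply: lspan_gen.
    have [s2 -> hs2] := he I; exists s1, s2, v, (e I); split=> //.
    by rewrite regradeD regradeK.
Qed.
End KoszulSum.

Section ExteriorEntries.
Variables (R : realType) (n : nat) (E : lmodType (complex R)).
Local Notation C := (complex R).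
Local Notation lattice := 'rV[int]_n.
Implicit Types (I J : {set 'I_n}) (w : ext n E).

Definition iota_entry (f : 'I_n -> E -> E) I (w : {set 'I_n} -> E) : E :=
  \sum_(i < n) (if i \in I then 0 else ext_sign R i I *: f i (w (i |: I)%SET)).
Definition wedge_entry (f : 'I_n -> E -> E) I (w : {set 'I_n} -> E) : E :=
  \sum_(i < n) (if i \in I then ext_sign R i I *: f i (w (I :\ i)%SET) else 0).

Lemma mext_entry (h : lattice -> ext n E) (x : {malg C[lattice]}) I :
  mext h x I = mext (fun u => h u I) x.
Proof. exact: (mext_comp h x (@ext_pr_lin R n E I)). Qed.

(** Exchanging the sum over the monomials of a potential with the sum over coordinates gathers the
    multiplications into the action of the coordinate forms. *)
Lemma hat_entry (mx my : lattice -> E -> E) (f : 'I_n -> E -> E) (h h' : {malg C[lattice]}) w I :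
  (mext (fun u : lattice => \sum_(i < n) (u 0 i)%:~R *: ext_iota i (ext_map (mx u) w)) h' +
   mext (fun u : lattice => \sum_(i < n) (u 0 i)%:~R *: ext_wedge i (ext_map (my u) w)) h +
   \sum_(i < n) ext_wedge i (ext_map (f i) w)) I =
  iota_entry (fun i x => mext (fun u : lattice => (u 0 i)%:~R *: mx u x) h') I w +
  wedge_entry (fun i x => mext (fun u : lattice => (u 0 i)%:~R *: my u x) h) I w +
  wedge_entry f I w.
Proof.
rewrite ffunE [X in X + _]ffunE !mext_entry ext_sumE.
rewrite /iota_entry /wedge_entry; congr (_ + _ + _).
- transitivity (mext (fun u : lattice => \sum_(i < n)
      (u 0 i)%:~R *: ext_iota i (ext_map (mx u) w) I) h').
    by apply: eq_in_mext => u _; rewrite ext_sumE; apply: eq_bigr => i _; rewrite ffunE.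
  rewrite mext_sum; apply: eq_bigr => i _; case: ifP => iI.
    by apply: mext0 => u; rewrite ffunE iI scaler0.
  rewrite -mext_scale; apply: eq_in_mext => u _.
  by rewrite ffunE iI ffunE !scalerA mulrC.
- transitivity (mext (fun u : lattice => \sum_(i < n)
      (u 0 i)%:~R *: ext_wedge i (ext_map (my u) w) I) h).
    by apply: eq_in_mext => u _; rewrite ext_sumE; apply: eq_bigr => i _; rewrite ffunE.
  rewrite mext_sum; apply: eq_bigr => i _; case: ifP => iI; last first.
    by apply: mext0 => u; rewrite ffunE iI scaler0.
  rewrite -mext_scale; apply: eq_in_mext => u _.
  by rewrite ffunE iI ffunE !scalerA mulrC.
- by apply: eq_bigr => i _; rewrite !ffunE.
Qed.

Lemma entry_ext f f' I w : (forall i x, f i x = f' i x) ->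
  (iota_entry f I w = iota_entry f' I w) /\ (wedge_entry f I w = wedge_entry f' I w).
Proof. by move=> ff; split; apply: eq_bigr => i _; rewrite ff. Qed.
End ExteriorEntries.

Lemma linf_truncate (K : fieldType) (E : lmodType K) (f : E -> E) a b c :
  linear f -> f a = a -> f b = b -> f c = 0 -> f (a + b + c) = a + b.
Proof. by move=> hf fa fb fc; rewrite !(linfD hf) fa fb fc addr0. Qed.

Section AssociatedGraded.
Variables (R : realType) (n : nat).
Local Notation C := (complex R).
Local Notation lattice := 'rV[int]_n.
Variables (S S' G G' : cone_family R n) (psi psi' : 'rV[R]_n -> R).
Variables (g g' : {malg C[lattice]}).
Local Notation B := (B_sheaf S S' G G' psi psi' g g').
Local Notation X := (C_sheaf S S' G G' psi psi' g g').
Hypothesis hB : is_gsheaf B.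
Implicit Types (eta : Phi S S') (I J : {set 'I_n}).
Local Notation BM eta := {malg C[(latpt (lcone eta) * latpt (rcone eta))%type]}.
Local Notation act_ eta := (@bact R n S S' G G' g g' eta).

Definition expo_act eta (i : 'I_n) : BM eta -> BM eta :=
  mext (fun p : bimon eta => (val p.2 0 i)%:~R *: (<< p >> : bialg eta)).

Lemma hatC_diff_entry eta (w : ext n (BM eta)) I :
  hatC_diff G G' g g' w I = iota_entry (fun i => act_ eta (lshift n i)) I w +
    wedge_entry (fun i => act_ eta (rshift n i)) I w + wedge_entry (@expo_act eta) I w.
Proof.
pose fl i (x : BM eta) : BM eta := mext (fun u : lattice => (u 0 i)%:~R *: (mulx G u x : BM eta)) g'.
pose fr i (x : BM eta) : BM eta := mext (fun u : lattice => (u 0 i)%:~R *: (muly G' u x : BM eta)) g.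
have hl i x : act_ eta (lshift n i) x = fl i x.
  rewrite (bactE G G' psi psi' g g' eta (lshift n i)) /= /B_act.
  by have /= -> := unsplitK (inl i : 'I_n + 'I_n).
have hr i x : act_ eta (rshift n i) x = fr i x.
  rewrite (bactE G G' psi psi' g g' eta (rshift n i)) /= /B_act.
  by have /= -> := unsplitK (inr i : 'I_n + 'I_n).
rewrite (proj1 (entry_ext I w hl)) (proj2 (entry_ext I w hr)).
exact: (@hat_entry R n (BM eta) (fun u => mulx G u) (fun u => muly G' u) (@expo_act eta) g g' w I).
Qed.

Lemma koszul_diff_entry eta (w : ext n (BM eta)) I :
  @koszul_diff R n (Phi S S') B eta w I = iota_entry (fun i => act_ eta (lshift n i)) I w +
    wedge_entry (fun i => act_ eta (rshift n i)) I w.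
Proof.
rewrite (proj1 (entry_ext I w (fun i x => congr1 (fun a => a x)
  (bactE G G' psi psi' g g' eta (lshift n i))))).
rewrite (proj2 (entry_ext I w (fun i x => congr1 (fun a => a x)
  (bactE G G' psi psi' g g' eta (rshift n i))))).
exact: (@koszul_diffE R n (Phi S S') B eta w I).
Qed.

Lemma act_hom eta i t (x : BM eta) : malg_hom (@bideg R n S S' psi psi' eta) t x ->
  malg_hom (@bideg R n S S' psi psi' eta) (t + var_degree R i) (act_ eta i x).
Proof. rewrite (bactE G G' psi psi' g g' eta i); exact: (@homog_act _ _ _ _ hB eta i t x). Qed.

Lemma act_linear eta i : linear (act_ eta i).
Proof. rewrite (bactE G G' psi psi' g g' eta i); exact: (@act_lin _ _ _ _ hB eta i). Qed.

Local Notation adeg eta I := (fun q : bimon eta => a_degree psi psi' q I).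

Lemma basis_eltE eta (p : bimon eta) I J :
  basis_elt p I J = if J == I then << p >> else 0 :> BM eta.
Proof. exact: ffunE. Qed.

(** Contraction lowers the exterior degree by one while multiplication by a monomial of [g'] raises
    [psi] by one, so [a] is unchanged. In [wedge_basis_hom] the exterior degree and [psi'] both go
    up by one. *)
Lemma iota_basis_hom eta (p : bimon eta) I J : malg_hom (adeg eta J) (a_degree psi psi' p I)
  (iota_entry (fun i => act_ eta (lshift n i)) J (basis_elt p I) : BM eta).
Proof.
have gr := @malg_grading C _ _ (adeg eta J).
apply: (hom_sum gr) => i _ _; case: ifP => iJ; first exact: (hom0 gr).
rewrite -[X in malg_hom _ _ X]addr0; apply: (hom_lin gr); last exact: (hom0 gr).
rewrite basis_eltE; case: eqP => [<-|_]; last first.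
  by rewrite (linf0 (act_linear (lshift n i))); apply: (hom0 gr).
move=> q /(@act_hom eta (lshift n i) _ _ (@malg_homU C _ _ (@bideg R n S S' psi psi' eta) p)).
rewrite /var_degree; have /= -> := unsplitK (inl i : 'I_n + 'I_n).
move=> -[/= e1 e2]; rewrite /a_degree cardsU1 iJ -e1 -e2 natrD /=; ring.
Qed.

Lemma wedge_basis_hom eta (p : bimon eta) I J : malg_hom (adeg eta J) (a_degree psi psi' p I)
  (wedge_entry (fun i => act_ eta (rshift n i)) J (basis_elt p I) : BM eta).
Proof.
have gr := @malg_grading C _ _ (adeg eta J).
apply: (hom_sum gr) => i _ _; case: ifP => iJ; last exact: (hom0 gr).
rewrite -[X in malg_hom _ _ X]addr0; apply: (hom_lin gr); last exact: (hom0 gr).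
rewrite basis_eltE; case: eqP => [<-|_]; last first.
  by rewrite (linf0 (act_linear (rshift n i))); apply: (hom0 gr).
move=> q /(@act_hom eta (rshift n i) _ _ (@malg_homU C _ _ (@bideg R n S S' psi psi' eta) p)).
rewrite /var_degree; have /= -> := unsplitK (inr i : 'I_n + 'I_n).
move=> -[/= e1 e2]; rewrite /a_degree (cardsD1 i J) iJ -e1 -e2 natrD /=; ring.
Qed.

(* Wedging with the exponent raises the degree a by one, so it dies in Gr_F. *)
Lemma expo_basis_hom eta (p : bimon eta) I J : malg_hom (adeg eta J) (a_degree psi psi' p I + 1)
  (wedge_entry (@expo_act eta) J (basis_elt p I) : BM eta).
Proof.
have gr := @malg_grading C _ _ (adeg eta J).
apply: (hom_sum gr) => i _ _; case: ifP => iJ; last exact: (hom0 gr).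
rewrite -[X in malg_hom _ _ X]addr0; apply: (hom_lin gr); last exact: (hom0 gr).
rewrite basis_eltE; case: eqP => [<-|_]; last first.
  by rewrite /expo_act (linf0 (@mext_lin _ _ _ _)); apply: (hom0 gr).
rewrite /expo_act mextU.
rewrite -[X in malg_hom _ _ X]addr0; apply: (hom_lin gr); last exact: (hom0 gr).
have -> : a_degree psi psi' p (J :\ i)%SET + 1 = a_degree psi psi' p J.
  by rewrite /a_degree (cardsD1 i J) iJ natrD /=; ring.
exact: (@malg_homU C _ _ (adeg eta J) p).
Qed.

Lemma a_part_basis eta (p : bimon eta) I :
  a_part psi psi' (a_degree psi psi' p I) (hatC_diff G G' g g' (basis_elt p I)) =
  @koszul_diff R n (Phi S S') B eta (basis_elt p I).
Proof.
apply/ffunP => J.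
pose tr : BM eta -> BM eta := mext (fun q : bimon eta =>
  if a_degree psi psi' q J == a_degree psi psi' p I then << q >> : bialg eta else 0).
have trl : linear tr := @mext_lin _ _ _ _.
have tr1 (x : BM eta) : malg_hom (adeg eta J) (a_degree psi psi' p I) x -> tr x = x.
  move=> hx; rewrite [RHS]malg_sumE; apply: eq_in_mext => q qx.
  by rewrite -(hx q qx) eqxx.
have tr0 (x : BM eta) : malg_hom (adeg eta J) (a_degree psi psi' p I + 1) x -> tr x = 0.
  move=> hx; rewrite -[RHS](@mext0 _ _ (BM eta) (fun=> 0) x (fun=> erefl)).
  apply: eq_in_mext => q qx; rewrite -(hx q qx) -[X in _ == X]addr0.
  by rewrite (inj_eq (addrI _)) oner_eq0.
pose a : BM eta := iota_entry (fun i => act_ eta (lshift n i)) J (basis_elt p I).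
pose b : BM eta := wedge_entry (fun i => act_ eta (rshift n i)) J (basis_elt p I).
pose c : BM eta := wedge_entry (@expo_act eta) J (basis_elt p I).
have ha : tr a = a := tr1 a (@iota_basis_hom eta p I J).
have hb : tr b = b := tr1 b (@wedge_basis_hom eta p I J).
have hc : tr c = 0 := tr0 c (@expo_basis_hom eta p I J).
have hh : hatC_diff G G' g g' (basis_elt p I) J = a + b + c := hatC_diff_entry (basis_elt p I) J.
have hk : @koszul_diff R n (Phi S S') B eta (basis_elt p I) J = a + b :=
  koszul_diff_entry (basis_elt p I) J.
have htr : tr (a + b + c) = a + b := linf_truncate trl ha hb hc.
have h1 : (a_part psi psi' (a_degree psi psi' p I) (hatC_diff G G' g g' (basis_elt p I)) J : BM eta) =
    tr (hatC_diff G G' g g' (basis_elt p I) J).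
  move: (hatC_diff G G' g g' (basis_elt p I)) => w.
  by rewrite /a_part ffunE.
have h2 := etrans h1 (etrans (congr1 tr hh) (etrans htr (esym hk))).
exact: h2.
Qed.

Lemma C_diffE eta (w : ext n (BM eta)) :
  C_diff G G' psi psi' g g' w = @koszul_diff R n (Phi S S') B eta w.
Proof.
have kl : linear (@koszul_diff R n (Phi S S') B eta).
  by apply: koszul_diff_lin => i; apply: (@act_lin _ _ _ _ hB eta i).
rewrite -{2}[w]ext_sum_inj (linf_sum kl); apply: eq_bigr => I _.
have h1 := @mext_lin C (bimon eta) (ext n (BM eta)) (fun p => a_part psi psi' (a_degree psi psi' p I)
  (hatC_diff G G' g g' (basis_elt p I))).
have h2 := lin_comp kl (@ext_inj_lin R n (BM eta) I).
apply: (malg_linP h1 h2) => p; rewrite mextU; exact: (a_part_basis p I).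
Qed.

Lemma C_hpartE eta t (w : ext n (BM eta)) :
  @hpart _ _ _ X eta t w <-> @hpart _ _ _ (koszul B) eta t w.
Proof.
split=> [h I|h I p pw].
  exists (unregrade #|I| t) => [|p pw]; first by rewrite unregradeK.
  rewrite (h I p pw).
  exact: (regradeK #|I| (bideg psi psi' p)).
have [ij -> hij] := h I; rewrite (hij p pw); reflexivity.
Qed.

(** The two complexes have the same stalks and restrictions, equal differentials and equivalent
    homogeneous parts, so an isomorphism for one serves for the other. *)
Lemma C_sheaf_iso (Z : csheaf (Phi S S')) : csheaf_iso (koszul B) Z -> csheaf_iso X Z.
Proof.
move=> [phi [[phi_lin phi_res phi_act phi_hom] phi_bij phi_d]].
exists phi; split; [split | exact: phi_bij | ].
- exact: phi_lin.
- exact: phi_res.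
- exact: phi_act.
- by move=> eta t x; split=> [/C_hpartE /phi_hom|/phi_hom /C_hpartE].
- by move=> eta x; rewrite -phi_d; congr (phi eta _); apply: C_diffE.
Qed.
End AssociatedGraded.

(** * Hypercohomology *)

Section HyperCohomology.
Variables (R : realType) (n : nat) (Psi : cone_family R (n + n)).
Local Notation C := (complex R).
Implicit Types (eta gamma theta : Psi) (F : csheaf Psi).
Hypothesis le_trans' : forall eta gamma beta : Psi,
  face_le beta gamma -> face_le gamma eta -> face_le beta eta.
Hypothesis le_anti' : forall eta gamma : Psi,
  face_le gamma eta -> face_le eta gamma -> gamma = eta.

Lemma face_ltb_trans : transitive (@face_ltb R n Psi).
Proof.
move=> gamma beta eta /asboolP[l1 n1] /asboolP[l2 n2]; apply/asboolP.
split; first exact: le_trans' l1 l2.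
by move=> e; apply: n1; apply: le_anti' => //; rewrite e.
Qed.

(** A strict chain has no repetitions, so its length is at most the number of cones. *)
Lemma chains_finite eta : exists r : seq (chains eta), uniq r /\ forall s, s \in r.
Proof.
pose r : seq (seq Psi) :=
  flatten [seq [seq tval t | t : k.-tuple Psi] | k <- iota 0 #|Psi|.+1].
exists (undup (pmap insub r)); split=> [|s]; first exact: undup_uniq.
rewrite mem_undup mem_pmap_sub; apply/flatten_mapP; exists (size (val s)).
  rewrite mem_iota /= add0n ltnS.
  have : uniq (eta :: val s).
    apply: (sorted_uniq face_ltb_trans); last exact: (valP s).
    by move=> gamma; apply/asboolP => -[_]; apply.
  by move=> /= /andP[_ /card_uniqP <-]; apply: max_card.
by apply/fintype.imageP; exists (in_tuple (val s)).
Qed.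

Lemma cochain_at_val (F : gsheaf Psi) (f : cochains F) eta (s : chains eta) :
  cochain_at f eta (val s) = f eta s.
Proof. by rewrite /cochain_at valK. Qed.

Lemma cochain_at_lin (F : gsheaf Psi) eta s :
  linear (fun f : cochains F => cochain_at f eta s).
Proof.
move=> a f h; rewrite /cochain_at; case: insub => [s'|] //.
by rewrite scaler0 addr0.
Qed.

Variables (B : csheaf Psi) (L : Psi -> csheaf Psi).
Variables (V : Psi -> lmodType C) (HV : forall theta, R * R -> set (V theta)).
Hypothesis rl : forall theta eta gamma, linear (@res _ _ _ (L theta) eta gamma).
Hypothesis cl : forall theta eta, linear (@cdiff _ _ _ (L theta) eta).
Hypothesis h0 : forall theta eta t, @hpart _ _ _ (L theta) eta t 0.
Local Notation X := (csheaf_sum HV L).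
Local Notation Y := (gcomplex_sum HV (fun theta => RGamma (L theta))).

(* Finite products commute with tensor products, and there are finitely many chains. *)
Lemma RGamma_sum : csheaf_iso B X -> exists phi, @quasi_iso _ (RGamma B) Y phi.
Proof.
move=> [phi [[phi_lin phi_res phi_act phi_hom] phi_bij phi_d]].
have [psi psiP] : exists psi : forall eta, stalk X eta -> stalk B eta,
    forall eta, cancel (phi eta) (psi eta) /\ cancel (psi eta) (phi eta).
  have H eta : exists g, cancel (phi eta) g /\ cancel g (phi eta).
    by have [g h1 h2] := phi_bij eta; exists g.
  by exists (fun eta => projT1 (cid (H eta))) => eta; case: cid.
have phiK eta := proj1 (psiP eta); have psiK eta := proj2 (psiP eta).
have psi_lin eta : linear (psi eta) := lin_can (phi_lin eta) (phiK eta) (psiK eta).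
have psi_res eta gamma x : face_le gamma eta -> psi gamma (res gamma x) = res gamma (psi eta x).
  by move=> h; apply: (can_inj (phiK gamma)); rewrite phi_res // !psiK.
have psi_d eta x : psi eta (cdiff x) = cdiff (psi eta x).
  by apply: (can_inj (phiK eta)); rewrite phi_d !psiK.
have [ch chP] : exists ch : forall eta, seq (chains eta),
    forall eta, uniq (ch eta) /\ forall s, s \in ch eta.
  by exists (fun eta => projT1 (cid (chains_finite eta))) => eta; case: cid.
have chu eta := proj1 (chP eta); have chT eta := proj2 (chP eta).
pose at_ theta eta s := fun f : cochains (L theta) => cochain_at f eta s.
have atl theta eta s : linear (at_ theta eta s) by apply: cochain_at_lin.
pose part eta s (x : gspace Y) : stalk X eta := fun theta => tmap (at_ theta eta s) (x theta).
pose down (x : gspace Y) : gspace (RGamma B) := fun eta s => psi eta (part eta (val s) x).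
pose dc theta eta s : stalk (L theta) eta -> dprod (fun _ : chains eta => stalk (L theta) eta) :=
  @dinj _ _ (fun _ : chains eta => stalk (L theta) eta) s.
pose dp theta eta : dprod (fun _ : chains eta => stalk (L theta) eta) -> cochains (L theta) :=
  @dinj _ _ (fun eta : Psi => dprod (fun _ : chains eta => stalk (L theta) eta)) eta.
have dcl theta eta s : linear (dc theta eta s) :=
  @dinj_lin _ _ (fun _ : chains eta => stalk (L theta) eta) s.
have dpl theta eta : linear (dp theta eta) :=
  @dinj_lin _ _ (fun eta : Psi => dprod (fun _ : chains eta => stalk (L theta) eta) : lmodType C) eta.
pose sp theta eta s : dprod (fun _ : chains eta => stalk (L theta) eta) -> stalk (L theta) eta :=
  fun h => h s.
pose fp theta eta : cochains (L theta) -> dprod (fun _ : chains eta => stalk (L theta) eta) :=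
  fun f => f eta.
have spl theta eta s : linear (sp theta eta s) by [].
have fpl theta eta : linear (fp theta eta) by [].
(* Each component is put back in its place, first along the chain by [dc], then along the starting
   cone by [dp]. *)
pose up (f : gspace (RGamma B)) : gspace Y := fun theta =>
  \sum_eta tmap (dp theta eta) (\sum_(s <- ch eta) tmap (dc theta eta s) (phi eta (f eta s) theta)).
have partE eta (s : chains eta) x theta : part eta (val s) x theta =
    tmap (sp theta eta s) (tmap (fp theta eta) (x theta)).
  rewrite (tmap_comp (spl theta eta s) (fpl theta eta)).
  by apply: eq_tmap => f; apply: cochain_at_val.
have Psiu := index_enum_uniq Psi; have PsiT := @mem_index_enum Psi.
have upK : cancel up down.
  move=> f; apply: functional_extensionality_dep => eta.
  apply: functional_extensionality_dep => s; rewrite /down -[RHS]phiK; congr (psi eta _).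
  apply: functional_extensionality_dep => theta; rewrite partE /up.
  rewrite (tmap_dpr_sum Psiu PsiT (fun eta =>
    \sum_(s <- ch eta) tmap (dc theta eta s) (phi eta (f eta s) theta)) eta).
  exact: (tmap_dpr_sum (chu eta) (chT eta) (fun s => phi eta (f eta s) theta) s).
have downK : cancel down up.
  move=> x; apply: functional_extensionality_dep => theta; rewrite /up /down.
  transitivity (\sum_eta tmap (dp theta eta) (tmap (fp theta eta) (x theta)));
    last exact: (tmap_sum_dinj Psiu PsiT (x theta)).
  apply: eq_bigr => eta _; congr (tmap _ _).
  rewrite -[RHS](tmap_sum_dinj (chu eta) (chT eta)); apply: eq_bigr => s _.
  by rewrite psiK partE.
have down_lin : linear down.
  move=> a x y; apply: functional_extensionality_dep => eta.
  apply: functional_extensionality_dep => s.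
  rewrite -[RHS]/(a *: down x eta s + down y eta s) /down -(psi_lin eta); congr (psi eta _).
  by apply: functional_extensionality_dep => theta; apply: (tmap_lin (atl theta eta (val s))).
have down_at x eta s : cochain_at (down x) eta s = psi eta (part eta s x).
  rewrite {1}/cochain_at; case: insubP => [s' _ <- //|ns].
  rewrite -[LHS](linf0 (psi_lin eta)); congr (psi eta _).
  apply: functional_extensionality_dep => theta.
  rewrite -[LHS](tmap0 _ (x theta)); apply: eq_tmap => f.
  by rewrite /at_ /cochain_at insubF //; apply/negbTE.
(* The differential is cut into three parts, each linear in the cochain, so that tensoring can be
   distributed over them. *)
pose resf theta eta (s : chains eta) (f : cochains (L theta)) : stalk (L theta) eta :=
  if val s is eta1 :: s' then res eta (at_ theta eta1 s' f) else 0.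
pose delf theta eta (s : chains eta) (f : cochains (L theta)) : stalk (L theta) eta :=
  \sum_(i < size (val s)) (-1) ^+ i.+1 *: at_ theta eta (take i (val s) ++ drop i.+1 (val s)) f.
pose cdf theta eta (s : chains eta) (f : cochains (L theta)) : stalk (L theta) eta :=
  (-1) ^+ size (val s) *: cdiff (at_ theta eta (val s) f).
have resl theta eta s : linear (resf theta eta s).
  rewrite /resf; case: (val s) => [|eta1 s']; first exact: lin_0.
  exact: (lin_comp (@rl theta eta1 eta) (atl theta eta1 s')).
have dell theta eta s : linear (delf theta eta s).
  by apply: lin_sum => i _; apply: (lin_scale _ (atl theta eta _)).
have cdl theta eta s : linear (cdf theta eta s).
  exact: (lin_scale _ (lin_comp (@cl theta eta) (atl theta eta (val s)))).
have gdE theta (f : gspace (RGamma (L theta))) eta (s : chains eta) :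
    at_ theta eta (val s) (gdiff f) = resf theta eta s f + delf theta eta s f + cdf theta eta s f.
  by rewrite /at_ cochain_at_val /cdf /at_ cochain_at_val.
have gdl theta : linear (@gdiff _ (RGamma (L theta))).
  move=> a f h; apply: functional_extensionality_dep => eta.
  apply: functional_extensionality_dep => s.
  have := lin_add (lin_add (resl theta eta s) (dell theta eta s)) (cdl theta eta s) a f h.
  rewrite -(gdE theta f eta s) -(gdE theta h eta s) -(gdE theta (a *: f + h) eta s) /at_.
  by rewrite !cochain_at_val.
have down_d x : down (gdiff x) = gdiff (down x).
  apply: functional_extensionality_dep => eta; apply: functional_extensionality_dep => s.
  rewrite -[RHS]/(roos_diff (down x) s + (-1) ^+ size (val s) *: cdiff (down x eta s)).
  rewrite /roos_diff.
  pose resp : stalk X eta :=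
    if val s is eta1 :: s' then res eta (part eta1 s' x) else 0.
  pose body := \sum_(i < size (val s))
    (-1) ^+ i.+1 *: part eta (take i (val s) ++ drop i.+1 (val s)) x.
  transitivity (psi eta (resp + body + (-1) ^+ size (val s) *: cdiff (part eta (val s) x))).
    rewrite /down; congr (psi eta _); apply: functional_extensionality_dep => theta.
    rewrite -[LHS]/(tmap (at_ theta eta (val s)) (tmap (@gdiff _ (RGamma (L theta))) (x theta))).
    rewrite (tmap_comp (atl theta eta (val s)) (gdl theta)) (eq_tmap (fun f => gdE theta f eta s)).
    rewrite (tmapD (lin_add (resl theta eta s) (dell theta eta s)) (cdl theta eta s)).
    rewrite (tmapD (resl theta eta s) (dell theta eta s)).
    rewrite -[RHS]/(resp theta + body theta + (-1) ^+ size (val s) *: tmap (@cdiff _ _ _ (L theta) eta)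
      (part eta (val s) x theta)).
    rewrite /body big_dprod; congr (_ + _ + _).
    - rewrite /resp /resf; case: (val s) => [|eta1 s']; first exact: tmap0.
      exact: (esym (tmap_comp (@rl theta eta1 eta) (atl theta eta1 s') (x theta))).
    - rewrite (tmap_sum _ _ (fun i : 'I_(size (val s)) => lin_scale ((-1) ^+ i.+1)
        (atl theta eta (take i (val s) ++ drop i.+1 (val s))))).
      by apply: eq_bigr => i _; rewrite (tmapZ _ (atl theta eta _)).
    - rewrite (tmapZ _ (lin_comp (@cl theta eta) (atl theta eta (val s)))).
      by rewrite -(tmap_comp (@cl theta eta) (atl theta eta (val s))).
  rewrite (linfD (psi_lin eta)) (linfD (psi_lin eta)) (linfZ (psi_lin eta)) psi_d.
  congr (_ + _ + _).
    (* Restrictions commute with [psi] only along face relations; the chain condition provides the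
       one needed here. *)
    rewrite /resp; have := valP s; case: (val s) => [|eta1 s'] /=.
      by move=> _; rewrite (linf0 (psi_lin eta)).
    by move=> /andP[/asboolP[le1 _] _]; rewrite psi_res // down_at.
  rewrite /body (linf_sum (psi_lin eta)); apply: eq_bigr => i _.
  by rewrite (linfZ (psi_lin eta)) down_at.
have up_lin : linear up := lin_can down_lin downK upK.
exists up; split; first exact: up_lin.
- by move=> f; rewrite -{1}[f]upK -(down_d (up f)) downK.
- move=> t f hf theta; apply: (@lspan_sum _ _ _ Psi) => eta _ _.
  rewrite (linf_sum (tmap_lin (dpl theta eta))); apply: lspan_sum => s _ _.
  rewrite (tmap_comp (dpl theta eta) (dcl theta eta s)).
  have incl := lin_comp (dpl theta eta) (dcl theta eta s).
  have := proj1 (phi_hom eta _ (f eta s)) (hf eta s) => /(_ theta).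
  apply: lspan_img (tmap_lin incl) _ _ => _ [t1 [t2 [v [e [tE hv he ->]]]]].
  rewrite (tmap_pure incl); apply: lspan_gen.
  (* The second degree is shifted by the length of the chain, undoing the shift in the grading of
     cochains. *)
  exists t1, (t2 + (0, (size (val s))%:R)), v, (dp theta eta (dc theta eta s e)); split=> //.
    by rewrite addrA -tE subrK.
  move=> eta' s'; have [E|ne] := eqVneq eta eta'; last by rewrite /dp dinj_out //; apply: h0.
  case: eta' / E s' => s'; rewrite /dp dinj_in.
  have [<-|ne] := eqVneq s s'; last by rewrite /dc dinj_out //; apply: h0.
  by rewrite /dc dinj_in addrK.
(* The map is an isomorphism of complexes with inverse [down], which settles both conditions on
   cohomology. *)
- by move=> x _ [y E]; exists (down y); rewrite -down_d -E upK.
- move=> y dy; exists (down y), y; rewrite downK dy addr0 -down_d dy.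
  by rewrite (linf0 down_lin).
Qed.
End HyperCohomology.

Theorem proposition6p6 (R : realType) (n : nat)
    (Sigma Sigma' Gamma Gamma' : stacky_fan R n)
    (psi psi' : 'rV[R]_n -> R)
    (f f' g g' : {malg R[i]['rV[int]_n]}) :
  (* the mirror pair (Sigma, f), (Sigma', f') *)
  LG_datum Sigma f -> LG_datum Sigma' f' ->
  is_height Sigma psi -> is_height Sigma' psi' ->
  stacky_poly Sigma = newton_infty f' -> stacky_poly Sigma' = newton_infty f ->
  (* height-one representatives and crepant subdivisions *)
  height_one_rep (stacky_poly Sigma') g -> height_one_rep (stacky_poly Sigma) g' ->
  crepant_subdivision Gamma Sigma psi g -> crepant_subdivision Gamma' Sigma' psi' g' ->
  facewise_regular Gamma Sigma g' -> facewise_regular Gamma' Sigma' g ->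
  forall L : Phi Sigma Sigma' -> gsheaf (Phi Sigma Sigma'),
  (forall theta, is_minimal_sheaf theta (L theta)) ->
  [/\ gsheaf_iso (B_sheaf Sigma Sigma' Gamma Gamma' psi psi' g g')
        (gsheaf_sum (@Vmult_homog R n Sigma Sigma' Gamma Gamma' psi psi' g g') L),
      csheaf_iso (C_sheaf Sigma Sigma' Gamma Gamma' psi psi' g g')
        (csheaf_sum (@Vmult_homog_ar R n Sigma Sigma' Gamma Gamma' psi psi' g g')
           (fun theta => koszul (L theta))) &
      exists phi, @quasi_iso R
        (RGamma (C_sheaf Sigma Sigma' Gamma Gamma' psi psi' g g'))
        (gcomplex_sum (@Vmult_homog_ar R n Sigma Sigma' Gamma Gamma' psi psi' g g')
           (fun theta => RGamma (koszul (L theta)))) phi].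
Proof.
move=> dS dS' hpsi hpsi' _ _ hg hg' [dG _ _ _] [dG' _ _ _] reg reg' L hL.
have [[sS _ _ _ _] [sS' _ _ _ _]] := (dS, dS').
have [[[fG _] _ _ _ _] [[fG' _] _ _ _ _]] := (dG, dG').
have [fS fS'] : is_fan Sigma /\ is_fan Sigma' := conj (proj1 sS) (proj1 sS').
have psi1 u : u \in monalg.msupp g' -> psi (realpt R u) = 1 := height_one sS hpsi hg'.
have psi1' u : u \in monalg.msupp g -> psi' (realpt R u) = 1 := height_one sS' hpsi' hg.
have hB := B_gsheaf fS fS' fG fG' (@heightD _ _ _ _ sS hpsi) (@heightD _ _ _ _ sS' hpsi') psi1 psi1'.
have isoB : gsheaf_iso (B_sheaf Sigma Sigma' Gamma Gamma' psi psi' g g')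
    (gsheaf_sum (@Vmult_homog R n Sigma Sigma' Gamma Gamma' psi psi' g g') L).
  apply: (pure_decomposition (Phi_refl fS fS')
    (fun eta gamma beta => @Phi_trans _ _ _ _ fS fS' beta gamma eta)
    (fun eta gamma => @Phi_anti _ _ _ _ fS fS' eta gamma) hB).
  - exact: B_boundary_onto fS fS'.
  - exact: hL.
  - exact: (@B_nonneg _ _ _ _ _ _ _ _ _ _ (@height_ge0 _ _ _ _ sS hpsi)
      (@height_ge0 _ _ _ _ sS' hpsi')).
  - by move=> eta; apply: B_regular.
  - exact: (B_primitive Gamma Gamma' fS fS' (@heightD _ _ _ _ sS hpsi)
      (@heightD _ _ _ _ sS' hpsi') psi1 psi1').
have hgL theta : is_gsheaf (L theta) := proj1 (min_pure (hL theta)).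
have isoK : csheaf_iso (koszul (B_sheaf Sigma Sigma' Gamma Gamma' psi psi' g g'))
    (csheaf_sum (@Vmult_homog_ar R n Sigma Sigma' Gamma Gamma' psi psi' g g')
       (fun theta => koszul (L theta))).
  by apply: (koszul_sum_iso hgL _ isoB).
have isoC := C_sheaf_iso hB isoK.
split=> //; apply: (RGamma_sum (fun eta gamma beta => @Phi_trans _ _ _ _ fS fS' beta gamma eta)
  (fun eta gamma => @Phi_anti _ _ _ _ fS fS' gamma eta) _ _ _ isoC).
- by move=> theta eta gamma; apply: ext_map_lin; apply: (@res_lin _ _ _ _ (hgL theta)).
- by move=> theta eta; apply: koszul_diff_lin => i; apply: (@act_lin _ _ _ _ (hgL theta)).
- move=> theta eta t I; exists (unregrade #|I| t); first by rewrite unregradeK.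
  rewrite -[X in hpart _ X]/((0 : ext n (stalk (L theta) eta)) I) ffunE.
  exact: (hom0 (homog_grading (hgL theta) eta)).
Qed.
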